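(* Let $n>2$ be an integer and let $(c_m)_{m\ge 0}$ be a sequence of real numbers $c_m\ge 0$. For every $H$-harmonic function $f$ on the unit ball $B^n\subset\mathbf R^n$, with decomposition $f=\sum_{m\ge0} f_m$, $f_m\in\mathbf H^m$, put $$\|f\|^2:=\sum_{m=0}^\infty c_m\,\|f_m\|^2_{\partial B^n}\in[0,+\infty].$$ Suppose that $\|\cdot\|$ is Moebius invariant, i.e. $\|f\circ\phi\|=\|f\|$ for every $H$-harmonic function $f$ on $B^n$ and every $\phi$ in the Moebius group $G$ of $B^n$ (both sides being allowed to be $+\infty$). Then $\|\cdot\|$ is a constant multiple of the semi-norm $\|\cdot\|_\circ$ given by $$\|f\|_\circ^2:=\sum_{m>0}\frac{(n-1)_m}{\Gamma(m)}\,\|f_m\|^2_{\partial B^n};$$ that is, there is a constant $\alpha\ge0$ such that $c_0=0$ and $c_m=\alpha\,\frac{(n-1)_m}{\Gamma(m)}$ for all $m\ge1$.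
   Context: $B^n$ is the open unit ball of $\mathbf R^n$, $\partial B^n$ the unit sphere, $d\sigma$ the normalized (total mass 1) surface measure on $\partial B^n$, and $\|\cdot\|_{\partial B^n}$ is the norm of $L^2(\partial B^n,d\sigma)$. $(x)_m:=x(x+1)\cdots(x+m-1)$ is the Pochhammer symbol, $(x)_0=1$. For $a\in B^n$ the Moebius transformation $\phi_a$ is $$\phi_a(x)=\frac{a|x-a|^2+(1-|a|^2)(a-x)}{1-2\langle x,a\rangle+|x|^2|a|^2};$$ it maps $B^n$ onto $B^n$ and interchanges $0$ and $a$. The Moebius group $G$ is the group generated under composition by all $\phi_a$, $a\in B^n$, and all orthogonal maps $x\mapsto Ux$, $U\in O(n)$. The hyperbolic Laplacian is $$\Delta_h f(x)=(1-|x|^2)\big[(1-|x|^2)\Delta f(x)+2(n-2)\langle x,\nabla f(x)\rangle\big],$$ and a function $f$ on $B^n$ is $H$-harmonic if $\Delta_h f=0$ on $B^n$. This class is invariant under composition with elements of $G$. For an integer $m\ge0$, $\mathcal H^m$ is the space of restrictions to $\partial B^n$ of harmonic polynomials on $\mathbf R^n$ homogeneous of degree $m$, and $$\mathbf H^m=\{f\in C(\overline{B^n}):\ f\text{ is }H\text{-harmonic on }B^n\text{ and }f|_{\partial B^n}\in\mathcal H^m\}.$$ Known facts: each $f_m\in\mathbf H^m$ has the form $f_m(r\zeta)=S_m(r^2)r^m f_m(\zeta)$ for $0\le r\le1$, $\zeta\in\partial B^n$, where $S_m(t)=\frac{(n-1)_m}{(n/2)_m}\,{}_2F_1(m,1-\tfrac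 n2;m+\tfrac n2;t)$; and every $H$-harmonic function $f$ on $B^n$ can be uniquely written as $f=\sum_{m\ge0} f_m$ with $f_m\in\mathbf H^m$, the sum converging uniformly on compact subsets of $B^n$. In $\|f_m\|_{\partial B^n}$ one takes the boundary values $f_m|_{\partial B^n}\in\mathcal H^m$. *)

(* Defs.v *)
From HB Require Import structures.
From mathcomp Require Import all_boot all_order all_algebra.
From mathcomp Require mpoly.
(* Notations and short names of [mpoly] clash with mathcomp-analysis. *)
Import (canonicals, coercions) mpoly.
From mathcomp Require Import all_classical all_reals all_analysis measurable_realfun.

Set Implicit Arguments.
Unset Strict Implicit.
Unset Printing Implicit Defensive.

Import Order.TTheory GRing.Theory Num.Theory.
Import numFieldNormedType.Exports.

Local Open Scope classical_set_scope.
Local Open Scope ring_scope.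

Section euclid.
Context {R : realType} {n : nat}.
Implicit Types x y : 'rV[R]_n.

(* The library norm on ['rV_n] is the sup norm; its topology is the Euclidean
   one, but balls and spheres must be defined from the scalar product. *)
Definition dotp x y : R := \sum_(i < n) x 0 i * y 0 i.
Definition sqnorm x : R := dotp x x.

Definition oball : set 'rV[R]_n := [set x | sqnorm x < 1].
Definition cball : set 'rV[R]_n := [set x | sqnorm x <= 1].
Definition sphere : set 'rV[R]_n := [set x | sqnorm x = 1].

Lemma sqnorm_ge0 x : 0 <= sqnorm x.
Proof. by apply: sumr_ge0 => i _; rewrite -expr2 sqr_ge0. Qed.

End euclid.
Arguments oball : clear implicits.
Arguments cball : clear implicits.
Arguments sphere : clear implicits.

Section surface_measure.
Local Open Scope ereal_scope.
Context {R : realType}.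
Let T := measurableTypeR R.

Definition cons_pair n (p : T * n.-tuple T) : n.+1.-tuple T :=
  [tuple of p.1 :: p.2].

Lemma measurable_cons_pair n : measurable_fun setT (@cons_pair n).
Proof. exact: measurable_cons. Qed.

Section step.
Variables (n : nat) (mu : {sigma_finite_measure set (n.-tuple T) -> \bar R}).

Definition cons_measure : set (n.+1.-tuple T) -> \bar R :=
  pushforward (@lebesgue_measure R \x mu) (@cons_pair n).

Let cons_measure0 : cons_measure set0 = 0.
Proof. by rewrite /cons_measure /pushforward preimage_set0 measure0. Qed.

Let cons_measure_ge0 A : 0 <= cons_measure A.
Proof. exact: (measure_ge0 (@lebesgue_measure R \x mu)). Qed.

Let cons_measure_sigma_additive : semi_sigma_additive cons_measure.
Proof.
have mf := @measurable_cons_pair n.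
exact (@measure_semi_sigma_additive _ _ _
  (measure_function_pushforward__canonical__measure_function_Measure
    (@lebesgue_measure R \x mu) mf)).
Qed.

HB.instance Definition _ := isMeasure.Build _ _ _ cons_measure
  cons_measure0 cons_measure_ge0 cons_measure_sigma_additive.

(* For a product, the library infers this instance only when the factors are
   subprobabilities, hence the direct proof. *)
Let cons_measure_sigma_finite : sigma_finite setT cons_measure.
Proof.
have /sigma_finiteP[F [TF ndF Foo]] := sigma_finiteT (@lebesgue_measure R).
have /sigma_finiteP[G [TG ndG Goo]] := sigma_finiteT mu.
pose u (t : n.+1.-tuple T) : T * n.-tuple T := (thead t, [tuple of behead t]).
have uK : u \o @cons_pair n = id.
  by apply/funext => -[r t]; congr pair => //; exact/val_inj.
have mU : measurable_fun setT u.
  apply/measurable_fun_pairP; split; last exact: measurable_behead.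
  exact: measurable_tnth.
exists (fun k => u @^-1` (F k `*` G k)) => [|k].
  rewrite -preimage_bigcup [X in u @^-1` X](_ : _ = setT) ?preimage_setT//.
  rewrite -subTset => -[x y] _.
  have [k _ Fkx] : (\bigcup_k F k) x by rewrite -TF.
  have [l _ Gly] : (\bigcup_k G k) y by rewrite -TG.
  exists (maxn k l) => //; split.
  - by move: x Fkx; exact/subsetPset/ndF/leq_maxl.
  - by move: y Gly; exact/subsetPset/ndG/leq_maxr.
have [mF Fk] := Foo k; have [mG Gk] := Goo k.
split.
  by rewrite -[X in measurable X]setTI; apply: mU => //; exact: measurableX.
rewrite /cons_measure /pushforward -comp_preimage uK preimage_id.
by rewrite product_measure1E// lte_mul_pinfty// ge0_fin_numE.
Qed.

HB.instance Definition _ := Measure_isSigmaFinite.Build _ _ _ cons_measure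
  cons_measure_sigma_finite.

End step.

(* Lebesgue measure on R^n: the n-fold product of [lebesgue_measure], on tuples
   because these (unlike ['rV_n]) carry the product sigma-algebra. *)
Fixpoint lebesgueT n : {sigma_finite_measure set (n.-tuple T) -> \bar R} :=
  if n is n'.+1 then cons_measure (lebesgueT n') else dirac [tuple].

Section sphere_measure.
Variable n : nat.
Let mu := lebesgueT n.

Definition row_of_tuple (t : n.-tuple T) : 'rV[R]_n := \row_i tnth t i.

Definition normalize (t : n.-tuple T) : n.-tuple T :=
  [tuple ((Num.sqrt (sqnorm (row_of_tuple t)))^-1 * tnth t i)%R | i < n].

Definition tball : set (n.-tuple T) := row_of_tuple @^-1` oball R n.

Let measurable_sqnorm : measurable_fun setT (fun t => sqnorm (row_of_tuple t)).
Proof.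
apply: measurable_sum => i; under eq_fun do rewrite mxE.
by apply: measurable_funM; exact: measurable_tnth.
Qed.

Lemma measurable_tball : measurable tball.
Proof.
rewrite -[X in measurable X]setTI.
rewrite (_ : tball = (fun t => sqnorm (row_of_tuple t)) @^-1` `]-oo, 1%R[%classic).
  exact: measurable_sqnorm.
by apply/seteqP; split => t /=; rewrite /tball /oball /= in_itv.
Qed.

Lemma measurable_normalize : measurable_fun setT normalize.
Proof.
apply/measurable_fun_tnthP => i; rewrite /comp /=.
under eq_fun do rewrite tnth_mktuple.
apply: measurable_funM; last exact: measurable_tnth.
under eq_fun do rewrite -powR12_sqrt ?sqnorm_ge0// -powRN.
by apply: (measurableT_comp (measurable_powR _)); exact: measurable_sqnorm.
Qed.

(* Normalized surface measure as cone measure: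
     sigma(A) = |{x in B^n : x/|x| in A}| / |B^n|,
   a Borel probability on R^n concentrated on the unit sphere. *)
Definition sphere_measure (A : set (n.-tuple T)) : \bar R :=
  ((fine (mu tball))^-1)%R%:E * mu (tball `&` normalize @^-1` A).

Let sphere_measure0 : sphere_measure set0 = 0.
Proof. by rewrite /sphere_measure preimage_set0 setI0 measure0 mule0. Qed.

Let sphere_measure_ge0 A : 0 <= sphere_measure A.
Proof. by rewrite mule_ge0// lee_fin invr_ge0 fine_ge0. Qed.

Let sphere_measure_sigma_additive : semi_sigma_additive sphere_measure.
Proof.
have r0 : (0 <= (fine (mu tball))^-1)%R by rewrite invr_ge0 fine_ge0.
have mf := measurable_normalize.
have h := @measure_semi_sigma_additive _ _ _ (mscale (NngNum r0)
  (measure_function_pushforward__canonical__measure_function_Measure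
  (mrestr mu measurable_tball) mf)).
rewrite (_ : sphere_measure = mscale (NngNum r0)
  (pushforward (mrestr mu measurable_tball) normalize)); last first.
  by apply: funext => A; rewrite /mscale/pushforward/mrestr/sphere_measure setIC.
exact h.
Qed.

HB.instance Definition _ := isMeasure.Build _ _ _ sphere_measure
  sphere_measure0 sphere_measure_ge0 sphere_measure_sigma_additive.

End sphere_measure.
End surface_measure.
Arguments row_of_tuple {R n}.
Arguments sphere_measure : clear implicits.

Section hharmonic.
Context {R : realType} {n : nat}.
Implicit Types (x a : 'rV[R]_n) (f : 'rV[R]_n -> R).

Definition partial (i : 'I_n) f : 'rV[R]_n -> R := 'D_(delta_mx 0 i) f.

Definition laplacian f x : R := \sum_(i < n) partial i (partial i f) x.

Definition hlaplacian f x : R :=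
  (1 - sqnorm x) * ((1 - sqnorm x) * laplacian f x
    + 2 * (n%:R - 2) * \sum_(i < n) x 0 i * partial i f x).

(* Existence of all second partials and their continuity on the open ball: by
   the mean value theorem this is the usual C^2 condition. *)
Definition C2_on_ball f := forall x, oball R n x -> forall i j : 'I_n,
  [/\ derivable f x (delta_mx 0 i), derivable (partial i f) x (delta_mx 0 j) &
      {for x, continuous (partial j (partial i f))}].

Definition Hharmonic f :=
  C2_on_ball f /\ forall x, oball R n x -> hlaplacian f x = 0.

Definition mobius a x : 'rV[R]_n :=
  (1 - 2 * dotp x a + sqnorm x * sqnorm a)^-1 *:
  (sqnorm (x - a) *: a + (1 - sqnorm a) *: (a - x)).

(* Only the values on the open ball matter. There the generators are bijective
   with inverses of the same kind; [mobius_inv] makes closure under inverses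
   explicit, and also closes the group under changing a map off the ball. *)
Inductive mobius_group : ('rV[R]_n -> 'rV[R]_n) -> Prop :=
| mobius_gen a : oball R n a -> mobius_group (mobius a)
| mobius_orth (U : 'M[R]_n) : U *m U^T = 1%:M -> mobius_group (fun x => x *m U)
| mobius_comp g h : mobius_group g -> mobius_group h -> mobius_group (g \o h)
| mobius_inv g h : mobius_group g ->
    (forall x, oball R n x -> [/\ oball R n (h x), g (h x) = x & h (g x) = x]) ->
    mobius_group h.

Definition harmonic_poly (m : nat) (p : mpoly.mpoly n R) :=
  p \is mpoly.ishomog1 m (@mpoly.mdeg n) /\
  \sum_(i < n) mpoly.mderiv i (mpoly.mderiv i p) = 0.

(* The boundary condition only involves values on the sphere; values of [f]
   off the closed ball are irrelevant. *)
Definition Hspace (m : nat) f :=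
  [/\ {within cball R n, continuous f}, Hharmonic f &
      exists2 p, harmonic_poly m p &
        forall z, sphere R n z -> f z = mpoly.meval (z 0) p].

Definition decomposition f (fm : nat -> 'rV[R]_n -> R) :=
  (forall m, Hspace m (fm m)) /\
  forall K : set 'rV[R]_n, compact K -> K `<=` oball R n ->
    {uniform K, (fun N x => \sum_(m < N) fm m x) @ \oo --> f}.

Definition sphere_normsq f : \bar R :=
  (\int[sphere_measure R n]_(t in row_of_tuple @^-1` sphere R n)
    ((f (row_of_tuple t)) ^+ 2)%:E)%E.

Definition normsq (c : nat -> R) (fm : nat -> 'rV[R]_n -> R) : \bar R :=
  (\sum_(0 <= m <oo) (c m)%:E * sphere_normsq (fm m))%E.

(* [||f||^2] is [normsq c fm] for the decomposition [fm] of [f]; the latter is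
   unique on the closed ball, so quantifying over [fm] only serves to ignore
   the irrelevant values off the closed ball. *)
Definition mobius_invariant (c : nat -> R) :=
  forall f g (fm gm : nat -> 'rV[R]_n -> R),
    Hharmonic f -> mobius_group g ->
    decomposition f fm -> decomposition (f \o g) gm ->
    normsq c gm = normsq c fm.

End hharmonic.

Definition pochhammer {R : realType} (x : R) (m : nat) : R :=
  \prod_(i < m) (x + i%:R).

(* Main.v *)
(* Test the invariance on zonal functions. Let F_k = S_k(|x|^2) P_k(x), where
   P_k is the monic zonal solid harmonic of degree k about the axis e_0 and S_k
   is the hypergeometric radial factor. The one-parameter group of boosts along
   e_0 is generated by a vector field X of the ball, and contiguity relations of
   2F1 give X F_k = A_k F_(k+1) + B_k F_(k-1). The coefficients of this ladder
   grow linearly in k, so for small s the Taylor series in s of F_m along the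
   flow converges absolutely and, rearranged by degree, is the decomposition of
   the composition of F_m with the boost.

   For f = F_m + lam F_(m+1) with lam = 1 or -1, the components of degrees m and
   m+1 of this composition are (1 + lam s B_(m+1) + O(s^2)) F_m and
   (lam + s A_m + O(s^2)) F_(m+1). All terms of the norm are nonnegative, so
   dropping the other components turns invariance into an inequality, whose
   first-order term in s, for both signs of lam, gives
     c_m N_m B_(m+1) + c_(m+1) N_(m+1) A_m = 0,   N_k = |F_k|^2 on the sphere.
   Since A_0 = 0 this forces c_0 = 0, and with the ratio N_(m+1)/N_m it becomes
   m c_(m+1) = (n + m - 1) c_m. The ratio comes from the orthogonality of the
   Gegenbauer polynomials, which follows from the invariance of the surface
   measure under rotations of the coordinate planes through e_0. *)
Require Import Defs.
From HB Require Import structures.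
From mathcomp Require Import all_boot all_order all_algebra.
From mathcomp Require mpoly.
From mathcomp Require Import ring lra.

Set Implicit Arguments.
Unset Strict Implicit.
Unset Printing Implicit Defensive.

Import Order.TTheory GRing.Theory Num.Theory.

Local Open Scope ring_scope.

(** * Zonal polynomials *)

(** In the coordinates [y = x_0], [t = |x|^2] the boosts form a closed flow, [y' = 1 + t - 2 y^2],
    [t' = 2 y (1 - t)]: the field is [(1 + t)] times the derivative along the axis minus [2 y] times
    the Euler field. The whole expansion is thus a computation in two variables. A single [F_m]
    would give no information: X shifts the degree by exactly one, so the component of degree m of
    the boosted [F_m] has no first-order variation. Two adjacent degrees are mixed in order to
    create a cross term, and since the resulting inequality involves two coefficients only, the rest
    of the expansion never has to be estimated in norm. The hypergeometric factor is taken with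
    value 1 at [t = 0], not at [t = 1], so its values on the sphere enter the norms; only the ratio
    of consecutive ones matters. A rotation of a coordinate plane is a product of three shears,
    which reduces the invariance of the measure to translations on slices. *)

Section zonal.
Context {A : comNzRingType}.
Implicit Types (b : nat -> A) (y t : A).

(** Homogenized monic three-term recurrence: for [b = zbeta n], [y] the axis coordinate and [t] the
    squared norm, this is the solid zonal harmonic of degree [k]. The ring is arbitrary because
    numbers, polynomials in one variable and polynomials in [n] variables all occur. *)
Fixpoint zonal b y t k : A :=
  if k is k1.+1 then
    if k1 is k2.+1 then y * zonal b y t k1 - b k1 * t * zonal b y t k2 else y
  else 1.

Lemma zonalSS b y t k :
  zonal b y t k.+2 = y * zonal b y t k.+1 - b k.+1 * t * zonal b y t k.
Proof. by []. Qed.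

Lemma eq_zonal b b' y t k : b =1 b' -> zonal b y t k = zonal b' y t k.
Proof.
move=> bb; suff: zonal b y t k = zonal b' y t k /\
  zonal b y t k.+1 = zonal b' y t k.+1 by case.
by elim: k => [|k [IH1 IH2]] //; split=> //; rewrite !zonalSS IH1 IH2 bb.
Qed.

(* [dz] stands for the images of the [zonal] under a derivation mapping [y] and
   [t] to [dy] and [dt]. *)
Definition zonal_derivation b y t dy dt (dz : nat -> A) :=
  [/\ dz 0%N = 0, dz 1%N = dy &
      forall k, dz k.+2 = dy * zonal b y t k.+1 + y * dz k.+1
        - b k.+1 * (dt * zonal b y t k + t * dz k)].

Section coefficients.
Variables (b kap : nat -> A) (N : A).
Hypotheses (kap0 : kap 0%N = 0) (kap1 : kap 1%N = 1)
  (kapE : forall k, kap k.+1 = b k.+1 * (N + 2 * k%:R))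
  (kapS : forall k, kap k.+2 = 1 + b k.+1 * (N + 2 * k%:R - 2)).
Variables (y t : A).
Let z := zonal b y t.

(** This derivation is the partial derivative along the axis. In [dz k.+2], [kapE] collects the
    terms in [z k] and [z k.-1] into [b k.+1 * (N + 2 k - 2)] times the recurrence for [z k.+1];
    [kapS] accounts for the remaining 1, which comes from [dy]. *)
Lemma zonal_dy dz : zonal_derivation b y t 1 (2 * y) dz ->
  forall k, dz k = kap k * z k.-1.
Proof.
move=> [dz0 dz1 dzS].
suff H k : dz k = kap k * z k.-1 /\ dz k.+1 = kap k.+1 * z k by move=> k; case: (H k).
elim: k => [|k [IH1 IH2]]; first by rewrite dz0 dz1 kap0 kap1 /z/=; split; ring.
split=> //; rewrite dzS IH2 IH1 /z/=.
case: k IH1 IH2 => [|k] _ _.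
  rewrite kapS kap1 kap0 /=.
  transitivity (y * (b 1%N * (N + 2 * 0%:R)) + y - 2 * b 1%N * y); last by ring.
  by rewrite -kapE kap1; ring.
by rewrite [kap k.+3]kapS (kapE k.+1) [kap k.+1]kapE /= -[k.+1%:R]natr1; ring.
Qed.

(** The infinitesimal boost: [1 + t] times the derivation of [zonal_dy] minus [2 * y] times that of
    [zonal_euler]. *)
Lemma zonal_flow dz :
  zonal_derivation b y t (1 + t - 2 * y ^+ 2) (2 * y * (1 - t)) dz ->
  forall k, dz k = (1 + t) * kap k * z k.-1 - 2 * k%:R * y * z k.
Proof.
move=> [dz0 dz1 dzS].
suff H k : dz k = (1 + t) * kap k * z k.-1 - 2 * k%:R * y * z k /\
    dz k.+1 = (1 + t) * kap k.+1 * z k - 2 * k.+1%:R * y * z k.+1.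
  by move=> k; case: (H k).
elim: k => [|k [IH1 IH2]].
  by rewrite dz0 dz1 kap0 kap1 /z/=; split; ring.
split=> //; rewrite dzS IH2 IH1 /z.
case: k IH1 IH2 => [|k] _ _.
  rewrite kapS kap1 kap0 /=.
  transitivity (y * (1 + t) + y * (1 + t) * (b 1%N * (N + 2 * 0%:R)) - 4 * y ^+ 3
    - b 1%N * (2 * y * (1 - t))); last by ring.
  by rewrite -kapE kap1; ring.
rewrite [kap k.+3]kapS (kapE k.+1) [kap k.+1]kapE /=.
by rewrite -![k.+3%:R]natr1 -![k.+2%:R]natr1 -[k.+1%:R]natr1; ring.
Qed.

Lemma zonal_euler dz : zonal_derivation b y t y (2 * t) dz ->
  forall k, dz k = k%:R * z k.
Proof.
move=> [dz0 dz1 dzS].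
suff H k : dz k = k%:R * z k /\ dz k.+1 = k.+1%:R * z k.+1.
  by move=> k; case: (H k).
elim: k => [|k [IH1 IH2]]; first by rewrite dz0 dz1 /z/=; split; ring.
by split=> //; rewrite dzS IH2 IH1 /z zonalSS -[k.+2%:R]natr1 -[k.+1%:R]natr1; ring.
Qed.

End coefficients.
End zonal.

Lemma rmorph_zonal (A B : comNzRingType) (f : {rmorphism A -> B}) b y t k :
  f (zonal b y t k) = zonal (f \o b) (f y) (f t) k.
Proof.
suff: f (zonal b y t k) = zonal (f \o b) (f y) (f t) k /\
  f (zonal b y t k.+1) = zonal (f \o b) (f y) (f t) k.+1 by case.
elim: k => [|k [IH1 IH2]]; first by rewrite /= rmorph1.
by split=> //; rewrite !zonalSS rmorphB !rmorphM IH1 IH2.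
Qed.

(** * Recurrence and derivative coefficients of the monic Gegenbauer polynomials *)

Section gegenbauer_coefficients.
Context {R : realFieldType} (n : nat).

(* In terms of the Gegenbauer parameter [l = n/2 - 1]:
   [zbeta k = k(k+2l-1)/(4(k+l)(k+l-1))], the recurrence coefficient of the
   monic Gegenbauer polynomials. *)
Definition zbeta k : R :=
  k%:R * (k%:R + n%:R - 3) / ((2 * k%:R + n%:R - 2) * (2 * k%:R + n%:R - 4)).

(** The derivative along the axis maps the monic zonal harmonic of degree [k] to [zkappa k] times
    that of degree [k - 1]; it is also the lowering coefficient B_k of the boosts. *)
Definition zkappa k : R := k%:R * (k%:R + n%:R - 3) / (2 * k%:R + n%:R - 4).

Hypothesis n2 : (2 < n)%N.
Let n3 : 3 <= n%:R :> R. Proof. by rewrite (ler_nat _ 3). Qed.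

Lemma zkappa0 : zkappa 0 = 0. Proof. by rewrite /zkappa !mul0r. Qed.

Lemma zkappa1 : zkappa 1 = 1.
Proof. by rewrite /zkappa; have n3' := n3; field; lra. Qed.

Lemma zkappaE k : zkappa k.+1 = zbeta k.+1 * (n%:R + 2 * k%:R).
Proof.
rewrite /zkappa /zbeta -natr1; have := n3; have := ler0n R k => k0 n3'.
by field; apply/andP; split; lra.
Qed.

Lemma zkappaS k : zkappa k.+2 = 1 + zbeta k.+1 * (n%:R + 2 * k%:R - 2).
Proof.
rewrite /zkappa /zbeta -[k.+2%:R]natr1 -natr1; have := n3; have := ler0n R k.
by move=> k0 n3'; field; apply/andP; split; lra.
Qed.

Lemma zkappa_gt0 k : 0 < zkappa k.+1.
Proof.
rewrite /zkappa -natr1; have := n3; have := ler0n R k => k0 n3'.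
by rewrite divr_gt0 ?mulr_gt0//; lra.
Qed.

Lemma zbeta_gt0 k : 0 < zbeta k.+1.
Proof.
rewrite /zbeta -natr1; have := n3; have := ler0n R k => k0 n3'.
by rewrite divr_gt0 ?mulr_gt0//; lra.
Qed.

Lemma zbeta_le1 k : zbeta k.+1 <= 1.
Proof.
rewrite /zbeta -natr1; have := n3; have := ler0n R k => k0 n3'.
rewrite ler_pdivrMr ?mulr_gt0//; try lra.
nra.
Qed.

Lemma zkappa_le k : zkappa k <= k%:R.
Proof.
case: k => [|k]; first by rewrite zkappa0.
rewrite /zkappa -natr1; have := n3; have := ler0n R k => k0 n3'.
rewrite ler_pdivrMr ?mulr_gt0//; try lra.
nra.
Qed.

End gegenbauer_coefficients.
Arguments zbeta {R}.
Arguments zkappa {R}.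

(** * Zonal harmonics as polynomials in n variables *)

Module ZonalMpoly.
Import mpoly.

Section zonal_mpoly.
Context {R : realFieldType} (n : nat) (i0 : 'I_n).
Hypothesis n2 : (2 < n)%N.
Implicit Types p q : {mpoly R[n]}.

Definition sqsum : {mpoly R[n]} := \sum_(i < n) 'X_i ^+ 2.

Definition zmpoly k : {mpoly R[n]} :=
  zonal (fun k => (zbeta n k)%:MP) 'X_i0 sqsum k.

Lemma mderivXU (i j : 'I_n) : mderiv i ('X_j : {mpoly R[n]}) = (i == j)%:R.
Proof.
rewrite mderivX mnm1E eq_sym; have [->|ij] := eqVneq i j; last by rewrite scale0r.
rewrite scale1r (_ : (U_(j) - U_(j))%MM = 0%MM) ?mpolyX0//.
by apply/mnmP => k; rewrite mnmBE mnm0E subnn.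
Qed.

Lemma mderivXX i : mderiv i ('X_i : {mpoly R[n]}) = 1.
Proof. by rewrite mderivXU eqxx. Qed.

Lemma mderivXN i j : i != j -> mderiv i ('X_j : {mpoly R[n]}) = 0.
Proof. by rewrite mderivXU => /negPf ->. Qed.

Lemma mderiv_sqsum i : mderiv i sqsum = 2 * 'X_i.
Proof.
rewrite /sqsum raddf_sum (bigD1 i)//= big1 ?addr0 => [|j ji].
  by rewrite expr2 mderivM mderivXX; ring.
by rewrite expr2 mderivM mderivXN 1?eq_sym//; ring.
Qed.

Lemma zmpoly_homog k : zmpoly k \is ishomog1 k (@mdeg n).
Proof.
have hX i : ('X_i : {mpoly R[n]}) \is ishomog1 1 (@mdeg n) by rewrite dhomogX; apply/eqP; exact: mdeg1.
have hT : sqsum \is ishomog1 2 (@mdeg n).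
  by apply: rpred_sum => i _; rewrite expr2 -[2%N]/(1 + 1)%N; apply: dhomogM.
suff: zmpoly k \is ishomog1 k (@mdeg n) /\ zmpoly k.+1 \is ishomog1 k.+1 (@mdeg n).
  by case.
elim: k => [|k [IH1 IH2]]; first by split; [exact: dhomog1|exact: hX].
split=> //; rewrite /zmpoly zonalSS -!/(zmpoly _) rpredB//.
  by rewrite -[k.+2]add1n; apply: dhomogM.
by rewrite -mulrA mul_mpolyC rpredZ// -[k.+2]add2n; apply: dhomogM.
Qed.

Lemma meval_zmpoly v k :
  meval v (zmpoly k) = zonal (zbeta n) (v i0) (\sum_(i < n) v i ^+ 2) k.
Proof.
rewrite /zmpoly rmorph_zonal /= mevalXU raddf_sum /=.
have -> : \sum_(i < n) meval v ('X_i ^+ 2) = \sum_(i < n) v i ^+ 2.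
  by apply: eq_bigr => i _; rewrite rmorphXn /= mevalXU.
by apply: eq_zonal => j; rewrite /= mevalC.
Qed.

Let kap k : {mpoly R[n]} := (zkappa n k)%:MP.

Let kap0 : kap 0 = 0. Proof. by rewrite /kap zkappa0 raddf0. Qed.
Let kap1 : kap 1 = 1. Proof. by rewrite /kap zkappa1// rmorph1. Qed.
Let kapE k : kap k.+1 = (zbeta n k.+1)%:MP * (n%:R + 2 * k%:R).
Proof.
rewrite /kap zkappaE//; move: (zbeta n k.+1) => b.
by rewrite rmorphM rmorphD rmorphM !rmorph_nat.
Qed.
Let kapS k : kap k.+2 = 1 + (zbeta n k.+1)%:MP * (n%:R + 2 * k%:R - 2).
Proof.
rewrite /kap zkappaS//; move: (zbeta n k.+1) => b.
by rewrite rmorphD rmorph1 rmorphM rmorphB rmorphD rmorphM !rmorph_nat.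
Qed.

Lemma mderiv_zmpoly k : mderiv i0 (zmpoly k) = kap k * zmpoly k.-1.
Proof.
suff D : zonal_derivation (fun k => (zbeta n k)%:MP) 'X_i0 sqsum 1 (2 * 'X_i0)
    (fun k => mderiv i0 (zmpoly k)).
  exact: (@zonal_dy _ _ kap n%:R kap0 kap1 kapE kapS _ _ _ D k).
split; first by rewrite mderivC.
  by rewrite mderivXX.
move=> j; rewrite /zmpoly zonalSS mderivB -mulrA mderiv_mulC !mderivM.
by rewrite mderivXX mderiv_sqsum.
Qed.

Lemma zmpoly_euler k : \sum_(i < n) 'X_i * mderiv i (zmpoly k) = k%:R * zmpoly k.
Proof.
pose eul p : {mpoly R[n]} := \sum_(i < n) 'X_i * mderiv i p.
have eulM p q : eul (p * q) = eul p * q + p * eul q.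
  rewrite /eul mulr_suml mulr_sumr -big_split/=.
  by apply: eq_bigr => i _; rewrite mderivM; ring.
have eulB p q : eul (p - q) = eul p - eul q.
  by rewrite /eul -sumrB; apply: eq_bigr => i _; rewrite mderivB mulrBr.
have eulC c : eul c%:MP = 0.
  by rewrite /eul big1// => i _; rewrite mderivC mulr0.
have eulX : eul 'X_i0 = 'X_i0.
  rewrite /eul (bigD1 i0)//= big1 ?addr0 => [|i ii].
    by rewrite mderivXX mulr1.
  by rewrite mderivXN// mulr0.
have eulT : eul sqsum = 2 * sqsum.
  rewrite /eul [in RHS]/sqsum mulr_sumr; apply: eq_bigr => i _.
  by rewrite mderiv_sqsum; ring.
suff D : zonal_derivation (fun k => (zbeta n k)%:MP) 'X_i0 sqsum 'X_i0
    (2 * sqsum) (fun k => eul (zmpoly k)) by exact: (zonal_euler D k).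
split; [exact: eulC|exact: eulX|move=> j].
by rewrite /zmpoly zonalSS eulB !eulM eulC eulX eulT; ring.
Qed.

(** The Leibniz rules [lapX] and [lapT], with Euler's relation, leave
    [2 zkappa k.+1 - zbeta k.+1 (2 n + 4 k)] times [zmpoly k], which [kapE] makes zero: harmonicity
    is what determines [zbeta]. *)
Lemma zmpoly_laplacian k : \sum_(i < n) mderiv i (mderiv i (zmpoly k)) = 0.
Proof.
pose lap p : {mpoly R[n]} := \sum_(i < n) mderiv i (mderiv i p).
have lapB p q : lap (p - q) = lap p - lap q.
  by rewrite /lap -sumrB; apply: eq_bigr => i _; rewrite !mderivB.
have lapC c p : lap (c%:MP * p) = c%:MP * lap p.
  by rewrite /lap mulr_sumr; apply: eq_bigr => i _; rewrite !mderiv_mulC.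
have lapX p : lap ('X_i0 * p) = 2 * mderiv i0 p + 'X_i0 * lap p.
  rewrite /lap (bigD1 i0)//= [in RHS](bigD1 i0)//= mulrDr addrA; congr (_ + _).
    by rewrite mderivM mderivXX mul1r mderivD mderivM mderivXX; ring.
  rewrite mulr_sumr; apply: eq_bigr => i ii.
  by rewrite mderivM mderivXN// mul0r add0r mderivM mderivXN//; ring.
have lapT p : lap (sqsum * p) = 2 * n%:R * p +
    4 * (\sum_(i < n) 'X_i * mderiv i p) + sqsum * lap p.
  rewrite /lap !mulr_sumr; transitivity (\sum_(i < n) (2 * p +
      4 * ('X_i * mderiv i p) + sqsum * mderiv i (mderiv i p))).
    apply: eq_bigr => i _; rewrite mderivM mderivD !mderivM mderiv_sqsum.
    have -> : mderiv i (2 * 'X_i) = 2 :> {mpoly R[n]}.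
      by rewrite -[2]/(1 *+ 2) mulr2n mulrDl mul1r mderivD mderivXX.
    by ring.
  rewrite !big_split/= sumr_const card_ord -mulr_natl; congr (_ + _ + _); ring.
suff: lap (zmpoly k) = 0 /\ lap (zmpoly k.+1) = 0 by case.
elim: k => [|k [IH1 IH2]].
  split; rewrite /lap big1// => i _; first by rewrite !mderivC.
  by rewrite mderivXU; case: (i == i0); rewrite mderivC.
split=> //; rewrite /zmpoly zonalSS -mulrA lapB lapX lapC lapT -!/(zmpoly _).
by rewrite IH1 IH2 zmpoly_euler mderiv_zmpoly kapE /=; ring.
Qed.

End zonal_mpoly.
End ZonalMpoly.

Import (canonicals, coercions) mpoly.
From mathcomp Require Import all_classical all_reals all_analysis.
From mathcomp Require Import measurable_realfun.

Import numFieldNormedType.Exports.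

Local Open Scope classical_set_scope.

(** * Power series *)

Lemma uniform_cvg_dist (R : realType) (T : choiceType) (K : set T)
    (f_ : nat -> T -> R) (f : T -> R) :
  (forall e, 0 < e -> exists N, forall m x, (N <= m)%N -> K x ->
     `|f x - f_ m x| <= e) -> {uniform K, f_ @ \oo --> f}.
Proof.
move=> H P /uniform_nbhs[E [entE EP]].
have [e e0 Ee] : exists2 e : R, 0 < e & forall x y, `|x - y| < e -> E (x, y).
  move: entE; rewrite -entourage_ballE => -[e /= e0 Ee].
  by exists e => // x y xy; apply: Ee.
have [N HN] : exists N, forall m x, (N <= m)%N -> K x -> `|f x - f_ m x| <= e / 2 by apply: H; lra.
exists N => // m /= Nm; apply: EP => y Ky; apply: Ee.
by apply: le_lt_trans (HN m y Nm Ky) _; lra.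
Qed.

Lemma norm_lim_le (R : realType) (v : R^nat) (l M : R) :
  v @ \oo --> l -> (exists N, forall m, (N <= m)%N -> `|v m| <= M) -> `|l| <= M.
Proof.
move=> vl [N H]; have cv : cvgn v by apply/cvg_ex; exists l.
rewrite -(cvg_lim _ vl)// ler_norml; apply/andP; split.
  apply: limr_ge => //; exists N => // m /= Nm.
  by have := H m Nm; rewrite ler_norml => /andP[].
apply: limr_le => //; exists N => // m /= Nm.
by have := H m Nm; rewrite ler_norml => /andP[].
Qed.

Section pointwise_derivatives.
Context {R : realType} {V : normedModType R}.
Implicit Types (f g : V -> R) (x v : V) (c df dg : R).

Lemma is_derive_add f g x v df dg : is_derive x v f df -> is_derive x v g dg ->
  is_derive x v (fun y => f y + g y) (df + dg).
Proof. by move=> hf hg; exact: is_deriveD hf hg. Qed.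

Lemma is_derive_mul f g x v df dg : is_derive x v f df -> is_derive x v g dg ->
  is_derive x v (fun y => f y * g y) (df * g x + f x * dg).
Proof.
move=> hf hg; apply: is_derive_eq (is_deriveM hf hg) _.
by rewrite addrC /GRing.scale/= mulrC.
Qed.

Lemma is_derive_scale c f x v df : is_derive x v f df ->
  is_derive x v (fun y => c * f y) (c * df).
Proof. by move=> hf; exact: (@is_deriveZ _ _ _ f c x v df hf). Qed.

Lemma is_derive_pow f n x v df : is_derive x v f df ->
  is_derive x v (fun y => f y ^+ n) (n%:R * f x ^+ n.-1 * df).
Proof.
move=> hf; have := is_deriveX n hf; congr is_derive.
by apply/funext => y; rewrite exprfctE.
Qed.

End pointwise_derivatives.

Section power_series.
Context {R : realType}.
Implicit Types (c d : nat -> R) (x : R).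

Definition psum c x : R := limn (pseries c x).

Definition disc_cvg c := forall x, `|x| < 1 -> cvgn (pseries c x).

Definition sums_to c (f : R -> R) :=
  forall x, `|x| < 1 -> pseries c x @ \oo --> f x.

(** Identities between radial functions are proved by comparing Taylor coefficients; the lemmas from
    [sums_toD] to [sums_to_euler] compute the coefficients of a linear differential expression. *)
Lemma sums_to_unique c d f g x : sums_to c f -> sums_to d g -> c =1 d ->
  `|x| < 1 -> f x = g x.
Proof.
move=> cf dg /funext cd x1; apply: (cvg_unique _ (cf x x1)) => //.
by rewrite cd; exact: dg.
Qed.

Lemma sums_toD c d f g : sums_to c f -> sums_to d g ->
  sums_to (fun j => c j + d j) (fun x => f x + g x).
Proof.
move=> cf dg x x1.
have -> : pseries (fun j => c j + d j) x = (fun m => pseries c x m + pseries d x m).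
  apply/funext => m; rewrite /pseries /series/= -big_split/=.
  by apply: eq_bigr => i _; rewrite mulrDl.
by apply: cvgD; [exact: cf|exact: dg].
Qed.

Lemma sums_toZ a c f : sums_to c f ->
  sums_to (fun j => a * c j) (fun x => a * f x).
Proof.
move=> cf x x1.
have -> : pseries (fun j => a * c j) x = (fun m => a * pseries c x m).
  apply/funext => m; rewrite /pseries /series/= mulr_sumr.
  by apply: eq_bigr => i _; rewrite mulrA.
by apply: cvgMr; exact: cf.
Qed.

Arguments sums_toZ a [c f] _.

Lemma sums_to_shift c f : sums_to c f ->
  sums_to (fun j => if j is i.+1 then c i else 0) (fun x => x * f x).
Proof.
move=> cf x x1; set d := (X in pseries X x); rewrite -(cvg_shiftS (pseries d x)).
have -> : (fun m => pseries d x m.+1) = (fun m => x * pseries c x m).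
  apply/funext => m; rewrite /pseries /series/= big_nat_recl// mul0r add0r.
  by rewrite mulr_sumr; apply: eq_bigr => i _; rewrite /= exprS; ring.
by apply: cvgMr; exact: cf.
Qed.

Lemma sums_to_euler c f : sums_to (pseries_diffs c) f ->
  sums_to (fun j => j%:R * c j) (fun x => x * f x).
Proof.
move=> /sums_to_shift; congr sums_to; apply/funext => -[|j] //.
by rewrite mul0r.
Qed.

Lemma disc_cvg_sums c : disc_cvg c -> sums_to c (psum c).
Proof. by move=> cc x x1; exact: cc. Qed.

(** For [|x| < K < 1] the terms [c j * K ^+ j] are bounded. What remains is [j.+1 * q ^+ j] with
    [q = |x| / K < 1], dominated by a geometric series of ratio [r] in []q, 1[]. *)
Lemma disc_cvg_diffs c : disc_cvg c -> disc_cvg (pseries_diffs c).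
Proof.
move=> cc x x1.
pose K := (1 + `|x|) / 2.
have xK : `|x| < K by rewrite /K; lra.
have K1 : K < 1 by rewrite /K; lra.
have K0 : 0 < K by apply: le_lt_trans xK.
have cK : cvgn (pseries c K) by apply: cc; rewrite gtr0_norm.
have [B [_ HB]] := cvg_series_bounded cK.
have {}HB j : `|c j * K ^+ j| <= `|B| + 1.
  by apply: HB => //; rewrite (le_lt_trans (ler_norm _))// ltrDl.
pose q := `|x| / K.
have q0 : 0 <= q by rewrite divr_ge0// ltW.
have q1 : q < 1 by rewrite ltr_pdivrMr// mul1r.
pose r := (1 + q) / 2.
have r1 : r < 1 by rewrite /r; lra.
have qr : q < r by rewrite /r; lra.
have r0 : 0 < r by rewrite /r; lra.
(* The second condition is what the induction in [geo] needs to absorb the additional term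
   [q ^+ j.+1]. *)
have [C [C1 Cq]] : exists C, 1 <= C /\ q <= C * (r - q).
  exists (1 + r / (r - q)); rewrite mulrDl divfK; last by lra.
  by rewrite mul1r lerDl divr_ge0//; lra.
have geo j : j.+1%:R * q ^+ j <= C * r ^+ j.
  elim: j => [|j IH]; first by rewrite !expr0 !mulr1.
  have h2 : q ^+ j.+1 <= q * r ^+ j by rewrite exprS ler_wpM2l// lerXn2r ?nnegrE// ltW.
  have h3 : q * (j.+1%:R * q ^+ j) <= q * (C * r ^+ j) by rewrite ler_wpM2l.
  have h4 : q * r ^+ j <= C * (r - q) * r ^+ j by rewrite ler_wpM2r// exprn_ge0// ltW.
  rewrite -[j.+2%:R]natr1 mulrDl mul1r [q ^+ j.+1 in X in X + _]exprS mulrCA [r ^+ j.+1]exprS.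
  lra.
apply: normed_cvg; rewrite /normed_series_of /=.
apply: (@series_le_cvg _ _ (geometric ((`|B| + 1) / K * C) r)).
- by move=> j; exact: normr_ge0.
- move=> j /=; rewrite !mulr_ge0 ?invr_ge0 ?exprn_ge0 ?addr_ge0//; try exact: ltW.
  exact: le_trans C1.
- move=> j /=; rewrite /pseries_diffs normrM normrM normr_nat normrX.
  have -> : `|x| = q * K by rewrite divfK// gt_eqF.
  have cb : `|c j.+1| * K ^+ j <= (`|B| + 1) / K.
    rewrite ler_pdivlMr// -mulrA -exprSr; have := HB j.+1.
    by rewrite normrM normrX (gtr0_norm K0).
  rewrite exprMn; have -> : j.+1%:R * `|c j.+1| * (q ^+ j * K ^+ j) =
    (`|c j.+1| * K ^+ j) * (j.+1%:R * q ^+ j) by ring.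
  rewrite -[leRHS]mulrA; apply: (ler_pM _ _ cb (geo j)).
  - by apply: mulr_ge0 => //; exact/exprn_ge0/ltW.
  - by apply: mulr_ge0 => //; exact: exprn_ge0.
by apply: is_cvg_geometric_series; rewrite gtr0_norm.
Qed.

Lemma is_derive_psum c x : disc_cvg c -> `|x| < 1 ->
  is_derive x 1 (psum c) (psum (pseries_diffs c) x).
Proof.
move=> cc x1; pose K := (1 + `|x|) / 2.
have xK : `|x| < K by rewrite /K; lra.
have K0 : 0 < K by apply: le_lt_trans xK.
have K1 : `|K| < 1 by rewrite gtr0_norm// /K; lra.
have cc1 := disc_cvg_diffs cc; have cc2 := disc_cvg_diffs cc1.
apply: (@pseries_snd_diffs _ c K x).
- exact: cc.
- exact: cc1.
- exact: cc2.
- by rewrite (gtr0_norm K0).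
Qed.

End power_series.
Arguments sums_toZ {R} a [c f] _.

(** * The radial factor *)

Section radial.
Context {R : realType} (n : nat).
Hypothesis n2 : (2 < n)%N.
Let h : R := n%:R / 2.
Let h1 : 3 <= 2 * h.
Proof. by rewrite /h mulrC divfK// (ler_nat _ 3). Qed.

(* Taylor coefficients of [2F1(k, 1 - n/2; k + n/2; t)]. *)
Fixpoint radial_coef k j : R :=
  if j is i.+1 then
    radial_coef k i * ((k%:R + i%:R) * (1 - h + i%:R)
      / ((k%:R + h + i%:R) * i.+1%:R))
  else 1.

Local Notation u := radial_coef.

Lemma radial_coefS k j :
  (k%:R + h + j%:R) * j.+1%:R * u k j.+1 = (k%:R + j%:R) * (1 - h + j%:R) * u k j.
Proof.
have := ler0n R j; have := ler0n R k => k0 j0; have h1' := h1.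
rewrite /= -[j.+1%:R]natr1; field; apply/andP; split; lra.
Qed.

(** Ratios of Pochhammer symbols: [(k+1)_j / (k)_j = (k+j) / k] and
    [(k+h)_j / (k+1+h)_j = (k+h) / (k+h+j)]. Keeping the factor [k] on the left covers [k = 0]. *)
Lemma radial_coef_succ k j :
  k%:R * (k%:R + h + j%:R) * u k.+1 j = (k%:R + j%:R) * (k%:R + h) * u k j.
Proof.
have := ler0n R k => k0; have h1' := h1.
elim: j => [|j IH]; first by rewrite /= !addr0; ring.
have := ler0n R j => j0.
have := radial_coefS k.+1 j; have := radial_coefS k j.
move: (u k j) (u k.+1 j) (u k j.+1) (u k.+1 j.+1) IH => a b a' b' IH.
rewrite -[k.+1%:R]natr1 -[j.+1%:R]natr1 => e1 e2.
have p1 : (k%:R + h + j%:R) * (j%:R + 1) != 0 by rewrite gt_eqF// mulr_gt0//; lra.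
have p2 : (k%:R + 1 + h + j%:R) * (j%:R + 1) != 0 by rewrite gt_eqF// mulr_gt0//; lra.
apply: (mulfI p1); apply: (mulfI p2).
have -> : (k%:R + 1 + h + j%:R) * (j%:R + 1) * ((k%:R + h + j%:R) * (j%:R + 1) *
   (k%:R * (k%:R + h + (j%:R + 1)) * b')) =
   (k%:R + h + j%:R) * (j%:R + 1) * k%:R * (k%:R + h + (j%:R + 1)) *
   ((k%:R + 1 + h + j%:R) * (j%:R + 1) * b') by ring.
have -> : (k%:R + 1 + h + j%:R) * (j%:R + 1) * ((k%:R + h + j%:R) * (j%:R + 1) *
   ((k%:R + (j%:R + 1)) * (k%:R + h) * a')) =
  (k%:R + 1 + h + j%:R) * (j%:R + 1) * (k%:R + (j%:R + 1)) * (k%:R + h) *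
   ((k%:R + h + j%:R) * (j%:R + 1) * a') by ring.
rewrite e1 e2.
have -> : (k%:R + h + j%:R) * (j%:R + 1) * k%:R * (k%:R + h + (j%:R + 1)) *
   ((k%:R + 1 + j%:R) * (1 - h + j%:R) * b) =
   (j%:R + 1) * (k%:R + h + (j%:R + 1)) * (k%:R + 1 + j%:R) * (1 - h + j%:R) *
   (k%:R * (k%:R + h + j%:R) * b) by ring.
by rewrite IH; ring.
Qed.

Lemma radial_coef0 j : u 0 j.+1 = 0.
Proof.
by elim: j => [|j IH]; [rewrite /= !addr0 !mul0r mulr0|rewrite -/(u 0 j.+1) [LHS]/= -/(u 0 j.+1) IH mul0r].
Qed.

(** Quadratic decay in [j] gives absolute convergence up to [t = 1], with a bound linear in [k].
    Since [h >= 1], [(k)_j (k+j) = k (k+1)_j <= k (k+h)_j]; this leaves [w j], which is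
    [|(1-h)_j| / j!], and [j * w j] is bounded. *)
Lemma radial_coef_bound : exists2 C, 0 <= C &
  forall k j, `|u k j.+1| * (j.+1%:R * (k%:R + j.+1%:R)) <= k%:R * C.
Proof.
have h1' := h1.
pose fix w j : R := if j is i.+1 then w i * (`|1 - h + i%:R| / i.+1%:R) else 1.
have w0 j : 0 <= w j by elim: j => [|j IH] //=; rewrite mulr_ge0// divr_ge0.
have wS j : j.+1%:R * w j.+1 = `|1 - h + j%:R| * w j.
  by rewrite /= [RHS]mulrC mulrCA; congr (_ * _); rewrite mulrC divfK.
(* For [j >= n] one has [0 <= 1 - h + j <= j], so [j * w j] no longer increases; the sum majorizes
   each of the values up to [n]. *)
pose C := \sum_(i < n.+1) i%:R * w i.
have C0 : 0 <= C by apply: sumr_ge0 => i _; rewrite mulr_ge0.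
have wC j : j%:R * w j <= C.
  elim: j => [|j IH]; first by rewrite mul0r.
  have [jn|jn] := ltnP j n.
    rewrite /C (bigD1 (Ordinal (jn : (j.+1 < n.+1)%N)))//= lerDl.
    by apply: sumr_ge0 => i _; rewrite mulr_ge0.
  apply: le_trans IH; rewrite wS ler_wpM2r// ger0_norm; first by lra.
  have : n%:R <= j%:R :> R by rewrite ler_nat.
  have : h <= n%:R by rewrite /h ler_pdivrMr// ler_peMr// ler1n.
  lra.
have uw k j : `|u k j| * (k%:R + j%:R) <= k%:R * w j.
  have k0 := ler0n R k.
  elim: j => [|j IH]; first by rewrite /= normr1 addr0 mul1r mulr1.
  have j0 := ler0n R j.
  rewrite /= normrM normrM normrM normrV ?unitfE; last first.
    by rewrite mulf_neq0// gt_eqF//; lra.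
  rewrite normrM (ger0_norm (_ : 0 <= k%:R + j%:R)) ?addr_ge0//.
  rewrite (ger0_norm (_ : 0 <= k%:R + h + j%:R)); last by lra.
  rewrite normr_nat invfM.
  have H : 0 <= (k%:R + j.+1%:R) / (k%:R + h + j%:R) <= 1.
    rewrite -natr1; apply/andP; split; first by rewrite divr_ge0//; lra.
    by rewrite ler_pdivrMr; lra.
  have -> : `|u k j| * ((k%:R + j%:R) * `|1 - h + j%:R| *
      ((k%:R + h + j%:R)^-1 * j.+1%:R^-1)) * (k%:R + j.+1%:R) =
    (`|u k j| * (k%:R + j%:R)) * (`|1 - h + j%:R| / j.+1%:R) *
      ((k%:R + j.+1%:R) / (k%:R + h + j%:R)) by ring.
  have H2 : 0 <= `|1 - h + j%:R| / j.+1%:R by rewrite divr_ge0.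
  have H3 : 0 <= `|u k j| * (k%:R + j%:R) * (`|1 - h + j%:R| / j.+1%:R).
    by rewrite !mulr_ge0// addr_ge0.
  apply: (@le_trans _ _ (`|u k j| * (k%:R + j%:R) * (`|1 - h + j%:R| / j.+1%:R))).
    by rewrite ler_piMr//; case/andP: H.
  by rewrite [leRHS]mulrA ler_wpM2r.
exists C => // k j; have := uw k j.+1; have := wC j.+1.
have j0 := ler0n R j; rewrite -natr1 => hw hu; have k0 := ler0n R k.
have e1 : (j%:R + 1) * (`|u k j.+1| * (k%:R + (j%:R + 1))) <=
  (j%:R + 1) * (k%:R * w j.+1) by rewrite ler_wpM2l//; lra.
have e2 : k%:R * ((j%:R + 1) * w j.+1) <= k%:R * C by rewrite ler_wpM2l.
lra.
Qed.

(** For [k >= 1] the previous bound on the coefficient of index [j.+1] is at most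
    [k C / ((j+1)(j+2))], which telescopes. *)
Lemma radial_coef_sum : exists2 C, 0 <= C &
  forall k m, \sum_(0 <= j < m) `|u k j| <= 1 + k%:R * C.
Proof.
have [C C0 HC] := radial_coef_bound; exists C => // k m.
have H m' : \sum_(0 <= j < m'.+1) `|u k j| <= 1 + k%:R * C * (1 - m'.+1%:R^-1).
  elim: m' => [|m' IH].
    by rewrite big_nat1 /= normr1 invr1 subrr mulr0 addr0.
  rewrite big_nat_recr//; apply: le_trans (lerD IH (lexx _)) _.
  rewrite -addrA lerD2l.
  case: k HC {IH} => [|k] HC.
    by rewrite radial_coef0 normr0 !mul0r addr0.
  have k0 := ler0n R k; have m0 := ler0n R m'; have h' := HC k.+1 m'.
  suff : `|u k.+1 m'.+1| <= k.+1%:R * C * (m'.+1%:R^-1 - m'.+2%:R^-1).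
    by move: (k.+1%:R * C) (m'.+1%:R^-1) (m'.+2%:R^-1) => x y z; lra.
  have -> : m'.+1%:R^-1 - m'.+2%:R^-1 = (m'.+1%:R * m'.+2%:R)^-1 :> R.
    by rewrite -[m'.+2%:R]natr1 -[m'.+1%:R]natr1; field; apply/andP; split; lra.
  rewrite ler_pdivlMr ?mulr_gt0//; apply: le_trans h'.
  rewrite ler_wpM2l// ler_wpM2l// -[m'.+2%:R]natr1 -[k.+1%:R]natr1; lra.
case: m => [|m]; first by rewrite big_nil addr_ge0// mulr_ge0.
apply: le_trans (H m) _; rewrite lerD2l ler_piMr ?mulr_ge0//.
Qed.

End radial.

Section radial_function.
Context {R : realType} (n : nat).
Hypothesis n2 : (2 < n)%N.
Let h : R := n%:R / 2.
Let h1 : 3 <= 2 * h.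
Proof. by rewrite /h mulrC divfK// (ler_nat _ 3). Qed.
Let hE : 2 * h = n%:R. Proof. by rewrite /h mulrC divfK. Qed.

Local Notation u := (@radial_coef R n).

Definition radial k (t : R) : R := psum (u k) t.

Let abs_cvg k : cvgn (series (fun j => `|u k j|)).
Proof.
have [C C0 HC] := @radial_coef_sum R n n2.
apply: nondecreasing_is_cvgn.
  by apply/nondecreasing_seqP => m; rewrite /series/= big_nat_recr//= lerDl.
by exists (1 + k%:R * C) => _ [m _ <-]; exact: HC.
Qed.

Let pseries_dist k t m p : `|t| <= 1 -> (m <= p)%N ->
  `|pseries (u k) t p - pseries (u k) t m| <=
  limn (series (fun j => `|u k j|)) - (series (fun j => `|u k j|)) m.
Proof.
move=> t1 mp; rewrite /pseries sub_series mp.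
apply: le_trans (ler_norm_sum _ _ _) _.
apply: (@le_trans _ _ (\sum_(m <= j < p) `|u k j|)).
  apply: ler_sum => j _; rewrite normrM ler_piMr// normrX exprn_ile1//.
rewrite lerBrDl.
have -> : (series (fun j => `|u k j|)) m + \sum_(m <= j < p) `|u k j| = (series (fun j => `|u k j|)) p.
  by rewrite /series/= -big_cat_nat.
apply: nondecreasing_cvgn_le => //.
by apply/nondecreasing_seqP => i; rewrite /series/= big_nat_recr//= lerDl.
Qed.

Lemma radial_cvg k t : `|t| <= 1 -> pseries (u k) t @ \oo --> radial k t.
Proof.
move=> t1; apply: normed_cvg.
apply: (@series_le_cvg _ _ (fun j => `|u k j|)) => [j|j|j|].
- exact: normr_ge0.
- exact: normr_ge0.
- by rewrite /= normrM ler_piMr// normrX exprn_ile1.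
- exact: abs_cvg.
Qed.

Lemma radial_disc_cvg k : disc_cvg (u k).
Proof. by move=> t t1; apply/cvg_ex; eexists; apply: radial_cvg; exact: ltW. Qed.

Lemma radial_bounded : exists2 C, 0 <= C & forall k t, `|t| <= 1 ->
  `|radial k t| <= 1 + k%:R * C.
Proof.
have [C C0 HC] := @radial_coef_sum R n n2; exists C => // k t t1.
apply: (norm_lim_le (@radial_cvg k t t1)); exists 0%N => m _.
apply: le_trans (HC k m); apply: le_trans (ler_norm_sum _ _ _) _.
by apply: ler_sum => j _; rewrite normrM ler_piMr// normrX exprn_ile1.
Qed.

(** Continuity must hold up to [|f x| = 1], as on the closed ball; it comes from uniform
    convergence, the tails being dominated by those of the numerical series of [abs_cvg]. *)
Lemma radial_comp_continuous (T : topologicalType) (K : set T) (f : T -> R) k :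
  continuous f -> (forall x, K x -> `|f x| <= 1) ->
  {within K, continuous (fun x => radial k (f x))}.
Proof.
move=> cf fK.
apply: (@uniform_limit_continuous_subspace _ _ _
  ((fun m x => pseries (u k) (f x) m) @ \oo)).
  near=> g0; apply: continuous_subspaceT; near: g0.
  exists 0%N => // m _ /=; rewrite /pseries /series /=.
  move=> x; elim: m => [|m IH].
    by under eq_fun do rewrite big_nil; exact: cvg_cst.
  under eq_fun do rewrite big_nat_recr//=.
  apply: cvgD => //; apply: cvgM; first exact: cvg_cst.
  exact: (continuous_comp (cf x) (@exprn_continuous _ m (f x))).
apply: uniform_cvg_dist => e e0.
have /cvgrPdist_le/(_ e e0)[N _ HN] : series (fun j => `|u k j|) @ \oo -->
    limn (series (fun j => `|u k j|)) by exact: abs_cvg.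
exists N => m x Nm Kx; have tn := fK x Kx.
have H := @radial_cvg k (f x) tn.
have : (fun p => pseries (u k) (f x) p - pseries (u k) (f x) m) @ \oo -->
    radial k (f x) - pseries (u k) (f x) m.
  by apply: cvgB => //; exact: cvg_cst.
move/norm_lim_le; apply; exists m => p mp.
apply: le_trans (pseries_dist k tn mp) _.
by apply: le_trans (HN m Nm); exact: ler_norm.
Unshelve. all: by end_near. Qed.

Lemma radial0 t : `|t| <= 1 -> radial 0 t = 1.
Proof.
move=> t1; have H := @radial_cvg 0 t t1; rewrite -(cvg_shiftS (pseries (u 0) t)) in H.
apply: (cvg_unique _ H) => //; have -> : (fun m => pseries (u 0) t m.+1) = fun=> 1.
  apply/funext => m; rewrite /pseries /series/= big_nat_recl// big1 ?addr0 ?mulr1//.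
  by move=> i _; rewrite radial_coef0 mul0r.
exact: cvg_cst.
Qed.

(** Coefficient form of the lowering relation, shared by [radial_lower] inside the disc and by
    [radial1_succ] at the end point 1, where it is summed directly. *)
Lemma radial_coef_lower k m :
  (2 * k%:R + n%:R) * u k m.+1 =
  2 * (m.+1%:R + k%:R + h) * u k.+1 m.+1 + (n%:R - 2 - 2 * m%:R) * u k.+1 m.
Proof.
have := @radial_coefS R n n2 k.+1 m; have := @radial_coef_succ R n n2 k m.+1.
rewrite -!/h -hE; have := h1; have := ler0n R k; have := ler0n R m.
set a := u k.+1 m; set a' := u k.+1 m.+1; set c := u k m.+1.
rewrite -[k.+1%:R]natr1 -[m.+1%:R]natr1 => m0 k0 h1' e1 e2.
have p : k%:R + (m%:R + 1) != 0 :> R by rewrite gt_eqF//; lra.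
apply: (mulfI p); rewrite mulrDr.
have -> : (k%:R + (m%:R + 1)) * ((2 * k%:R + 2 * h) * c) =
  2 * ((k%:R + (m%:R + 1)) * (k%:R + h) * c) by ring.
have -> : (k%:R + (m%:R + 1)) * ((2 * h - 2 - 2 * m%:R) * a) =
  - 2 * ((k%:R + 1 + m%:R) * (1 - h + m%:R) * a) by ring.
by rewrite -e1 -e2; ring.
Qed.

(* At [t = 1] the lowering relation loses its derivative term, since
   [j * u k j] tends to [0]. *)
Lemma radial1_succ k :
  (2 * k%:R + 2 * n%:R - 2) * radial k.+1 1 = (2 * k%:R + n%:R) * radial k 1.
Proof.
have n11 : `|1| <= 1 :> R by rewrite normr1.
have H k' := @radial_cvg k' 1 n11.
(* In the sum of [radial_coef_lower] the terms [2 * j * u k.+1 j] telescope to the boundary term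
   [2 * (m * u k.+1 m)]. *)
have E m : (2 * k%:R + n%:R) * pseries (u k) 1 m.+1 =
    2 * (m%:R * u k.+1 m) + (2 * k%:R + n%:R) * pseries (u k.+1) 1 m.+1
    + (n%:R - 2) * pseries (u k.+1) 1 m.
  elim: m => [|m IH].
    rewrite /pseries /series/= !big_nat_recr// !big_nil; ring.
  have pS k' m' : pseries (u k') 1 m'.+1 = pseries (u k') 1 m' + u k' m'.
    by rewrite /pseries /series/= big_nat_recr//= expr1n mulr1.
  rewrite [pseries (u k) 1 m.+2]pS [pseries (u k.+1) 1 m.+2]pS.
  rewrite [pseries (u k.+1) 1 m.+1 in X in _ = _ + X]pS.
  rewrite mulrDr IH radial_coef_lower -hE -natr1; ring.
have ju : (fun m => m%:R * u k.+1 m) @ \oo --> (0 : R).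
  have [C C0 HC] := @radial_coef_bound R n n2.
  apply/cvgr0Pnorm_le => e e0.
  have [N HN] : exists N : nat, k.+1%:R * C <= e * N.+1%:R.
    have HN := archi_boundP (divr_ge0 (mulr_ge0 (ler0n R k.+1) C0) (ltW e0)).
    exists (Num.bound (k.+1%:R * C / e)).
    rewrite -ler_pdivrMl// mulrC; apply: le_trans (ltW HN) _.
    by rewrite ler_nat.
  exists N.+1 => // -[//|m] Nm; rewrite -[X in X <= _]/(`|m.+1%:R * u k.+1 m.+1|).
  rewrite normrM normr_nat.
  have m0 : 0 < k.+1%:R + m.+1%:R :> R by rewrite addr_gt0.
  rewrite -(ler_pM2r m0).
  apply: le_trans (_ : k.+1%:R * C <= _).
    by rewrite [_ * `|_|]mulrC -mulrA; exact: (HC k.+1 m).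
  apply: le_trans HN _; rewrite ler_pM2l// -natrD ler_nat.
  by apply: leq_trans Nm _; rewrite leq_addl.
have L1 : (fun m => (2 * k%:R + n%:R) * pseries (u k) 1 m.+1) @ \oo -->
    (2 * k%:R + n%:R) * radial k 1.
  by apply: cvgMr; rewrite (cvg_shiftS (pseries (u k) 1)); exact: H.
have L2 : (fun m => (2 * k%:R + n%:R) * pseries (u k) 1 m.+1) @ \oo -->
    2 * 0 + (2 * k%:R + n%:R) * radial k.+1 1 + (n%:R - 2) * radial k.+1 1.
  under eq_fun do rewrite E.
  apply: cvgD; last by apply: cvgMr; exact: H.
  apply: cvgD; first by apply: cvgMr.
  by apply: cvgMr; rewrite (cvg_shiftS (pseries (u k.+1) 1)); exact: H.
by rewrite (cvg_unique _ L1 L2)//; ring.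
Qed.

Lemma radial1_gt0 k : 0 < radial k 1.
Proof.
have h1' := h1; have hE' := hE; elim: k => [|k IH].
  by rewrite radial0 ?normr1.
have k0 := ler0n R k.
have p : 0 < 2 * k%:R + 2 * n%:R - 2 :> R by lra.
by rewrite -(pmulr_rgt0 _ p) radial1_succ mulr_gt0//; lra.
Qed.

Definition dradial k := psum (pseries_diffs (u k)).
Definition ddradial k := psum (pseries_diffs (pseries_diffs (u k))).

Lemma is_derive_radial k (t : R) : `|t| < 1 -> is_derive t 1 (radial k) (dradial k t).
Proof. by move=> t1; apply: is_derive_psum => //; exact: radial_disc_cvg. Qed.

Lemma is_derive_dradial k (t : R) :
  `|t| < 1 -> is_derive t 1 (dradial k) (ddradial k t).
Proof.
by move=> t1; apply: is_derive_psum => //; apply: disc_cvg_diffs; exact: radial_disc_cvg.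
Qed.

Lemma ddradial_continuous k (t : R) : `|t| < 1 -> {for t, continuous (ddradial k)}.
Proof.
move=> t1.
have : is_derive t 1 (ddradial k)
    (psum (pseries_diffs (pseries_diffs (pseries_diffs (u k)))) t).
  by apply: is_derive_psum => //; do 2 apply: disc_cvg_diffs; exact: radial_disc_cvg.
by move=> ?; exact/differentiable_continuous/derivable1_diffP.
Qed.

Let s0 k : sums_to (u k) (radial k).
Proof. by apply: disc_cvg_sums; exact: radial_disc_cvg. Qed.
Let s1 k : sums_to (pseries_diffs (u k)) (dradial k).
Proof. by apply: disc_cvg_sums; apply: disc_cvg_diffs; exact: radial_disc_cvg. Qed.
Let s2 k : sums_to (pseries_diffs (pseries_diffs (u k))) (ddradial k).
Proof.
by apply: disc_cvg_sums; do 2 apply: disc_cvg_diffs; exact: radial_disc_cvg.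
Qed.

(** By [radial_coefS], [(j+1) u_(j+1) - (k+j) u_j = - (n+k-1) (k+j) u_j / (k+h+j)], in which
    [radial_coef_succ] recognizes the coefficients of [radial k.+1]. *)
Lemma radial_raise k t : `|t| < 1 ->
  (k%:R + h) * ((1 - t) * dradial k t - k%:R * radial k t) =
  - (k%:R * (n%:R + k%:R - 1)) * radial k.+1 t.
Proof.
move=> t1.
have L := sums_toD (sums_toZ (k%:R + h) (@s1 k)) (sums_toD
  (sums_toZ (- (k%:R + h)) (sums_to_euler (@s1 k)))
  (sums_toZ (- (k%:R + h) * k%:R) (@s0 k))).
have M := sums_toZ (- (k%:R * (n%:R + k%:R - 1))) (@s0 k.+1).
rewrite -(sums_to_unique L M _ t1); first by ring.
move=> j; rewrite /pseries_diffs.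
have := @radial_coefS R n n2 k j; have := @radial_coef_succ R n n2 k j.
rewrite -!/h; have := h1; have := ler0n R k; have := ler0n R j.
move: (u k j) (u k.+1 j) (u k j.+1) => a b a' j0 k0 h1' f1 f2.
have p : k%:R + h + j%:R != 0 by rewrite gt_eqF//; lra.
apply: (mulfI p).
have -> : (k%:R + h + j%:R) * (- (k%:R * (n%:R + k%:R - 1)) * b) =
  - (n%:R + k%:R - 1) * (k%:R * (k%:R + h + j%:R) * b) by ring.
have -> : (k%:R + h + j%:R) * ((k%:R + h) * (j.+1%:R * a') +
    (- (k%:R + h) * (j%:R * a) + - (k%:R + h) * k%:R * a)) =
  (k%:R + h) * ((k%:R + h + j%:R) * j.+1%:R * a') -
  (k%:R + h + j%:R) * (k%:R + h) * (j%:R + k%:R) * a by ring.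
by rewrite f1 f2 -hE; ring.
Qed.

Lemma radial_lower k t : `|t| < 1 ->
  2 * t * (1 - t) * dradial k.+1 t +
    ((n%:R + 2 * k%:R) + (n%:R - 2) * t) * radial k.+1 t =
  (n%:R + 2 * k%:R) * radial k t.
Proof.
move=> t1.
have E := sums_to_euler (@s1 k.+1).
have L := sums_toD (sums_toD (sums_toZ 2 E)
    (sums_toZ (n%:R + 2 * k%:R) (@s0 k.+1)))
  (sums_to_shift (sums_toD (sums_toZ (- 2) E)
    (sums_toZ (n%:R - 2) (@s0 k.+1)))).
have M := sums_toZ (n%:R + 2 * k%:R) (@s0 k).
rewrite -(sums_to_unique L M _ t1); first by ring.
case=> [|j]; first by rewrite /=; ring.
have := @radial_coef_lower k j; rewrite addrC => ->.
move: (u k j) (u k.+1 j) (u k.+1 j.+1) => a b a'.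
by rewrite -hE -[j.+1%:R]natr1; ring.
Qed.

(** The hypergeometric equation with parameters [a = k], [b = 1 - h], [c = k + h]; coefficientwise
    it is [radial_coefS]. *)
Lemma radial_ode k t : `|t| < 1 ->
  t * (1 - t) * ddradial k t + ((k%:R + h) - (k%:R - h + 2) * t) * dradial k t
    + k%:R * (h - 1) * radial k t = 0.
Proof.
move=> t1.
have L := sums_toD (sums_to_euler (@s2 k)) (sums_toD
  (sums_toZ (k%:R + h) (@s1 k))
  (sums_toZ (k%:R * (h - 1)) (@s0 k))).
have M := sums_toD (sums_to_shift (sums_to_euler (@s2 k)))
  (sums_toZ (k%:R - h + 2) (sums_to_euler (@s1 k))).
have -> : t * (1 - t) * ddradial k t +
    ((k%:R + h) - (k%:R - h + 2) * t) * dradial k t + k%:R * (h - 1) * radial k t =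
  (t * ddradial k t + ((k%:R + h) * dradial k t + k%:R * (h - 1) * radial k t))
  - (t * (t * ddradial k t) + (k%:R - h + 2) * (t * dradial k t)) by ring.
rewrite (sums_to_unique L M _ t1) ?subrr// => -[|j].
  rewrite /pseries_diffs; have := @radial_coefS R n n2 k 0; rewrite -!/h.
  move: (u k 0) (u k 1) => a a'; rewrite !addr0 => e.
  rewrite !mul0r mulr0 addr0 add0r.
  have -> : (k%:R + h) * (1%:R * a') = (k%:R + h) * 1%:R * a' by ring.
  by rewrite e; ring.
rewrite /pseries_diffs; have := @radial_coefS R n n2 k j.+1; rewrite -!/h.
move: (u k j.+1) (u k j.+2) => a a'.
rewrite -![j.+2%:R]natr1 -![j.+1%:R]natr1 => e.
transitivity ((k%:R + h + (j%:R + 1)) * (j%:R + 1 + 1) * a' +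
  k%:R * (h - 1) * a); first by ring.
by rewrite e; ring.
Qed.

End radial_function.

(** * Taylor expansion along a flow *)

Section taylor.
Context {R : realType}.
Implicit Types (G : nat -> R -> R) (s r : R).

(** The sum telescopes under differentiation: only the last term survives. *)
Lemma is_derive_taylor_sum G r J s :
  (forall j, is_derive s 1 (G j) (G j.+1 s)) ->
  is_derive s 1 (fun s => \sum_(j < J.+1) (r - s) ^+ j / j`!%:R * G j s)
    ((r - s) ^+ J / J`!%:R * G J.+1 s).
Proof.
move=> dG; elim: J => [|J IH].
  under eq_fun do rewrite big_ord1 expr0 fact0 divr1 mul1r.
  by rewrite expr0 fact0 divr1 mul1r; exact: dG.
under eq_fun do rewrite big_ord_recr/=.
have dw : is_derive s 1 (fun s => (r - s) ^+ J.+1 / J.+1`!%:R)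
    (- ((r - s) ^+ J / J`!%:R)).
  have dl : is_derive s 1 (fun s => r - s) (- 1).
    have := is_derive_add (is_derive_cst r s 1) (is_derive_scale (- 1) (is_derive_id s 1)).
    by rewrite add0r mulr1; congr is_derive; apply/funext => x; rewrite mulN1r.
  have := is_derive_scale J.+1`!%:R^-1 (is_derive_pow J.+1 dl).
  rewrite (_ : (fun s => J.+1`!%:R^-1 * (r - s) ^+ J.+1) =
    (fun s => (r - s) ^+ J.+1 / J.+1`!%:R)); last first.
    by apply/funext => s'; rewrite mulrC.
  move/is_derive_eq; apply; rewrite /= factS natrM.
  have f0 : J`!%:R != 0 :> R by rewrite pnatr_eq0 -lt0n fact_gt0.
  have j0 : J.+1%:R != 0 :> R by rewrite pnatr_eq0.
  by field; rewrite f0 nat1r.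
have := is_derive_add IH (is_derive_mul dw (dG J.+1)).
by move/is_derive_eq; apply; ring.
Qed.

(** Mean value theorem for [E], which is the Taylor polynomial at [s = 0] and [G 0 r] at [s = r].
    This is Cauchy's form of the remainder, whence the factorial of [J - 1]. *)
Lemma taylor_bound G r J M : (0 < J)%N ->
  (forall j s, `|s| <= `|r| -> is_derive s 1 (G j) (G j.+1 s)) ->
  (forall s, `|s| <= `|r| -> `|G J s| <= M) ->
  `|G 0%N r - \sum_(j < J) r ^+ j / j`!%:R * G j 0| <=
    `|r| ^+ J / J.-1`!%:R * M.
Proof.
case: J => // J _ dG GM.
pose E s := \sum_(j < J.+1) (r - s) ^+ j / j`!%:R * G j s.
pose dE s := (r - s) ^+ J / J`!%:R * G J.+1 s.
have E0 : E 0 = \sum_(j < J.+1) r ^+ j / j`!%:R * G j 0.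
  by apply: eq_bigr => j _; rewrite subr0.
have Er : E r = G 0%N r.
  rewrite /E big_ord_recl big1 ?addr0; last first.
    by move=> j _; rewrite subrr expr0n/= !mul0r.
  by rewrite expr0 fact0 divr1 mul1r.
have dEE s : `|s| <= `|r| -> is_derive s 1 E (dE s).
  by move=> sr; apply: is_derive_taylor_sum => j; exact: dG.
have dEb s : `|s| <= `|r| -> `|r - s| <= `|r| -> `|dE s| <= `|r| ^+ J / J`!%:R * M.
  move=> sr rs; rewrite /dE normrM; apply: ler_pM => //; last exact: GM.
  rewrite normrM normrX normfV normr_nat ler_wpM2r ?invr_ge0//.
  by rewrite lerXn2r ?nnegrE.
have cE a b : (forall s, a <= s <= b -> `|s| <= `|r|) ->
    {within `[a, b], continuous E}.
  move=> ab; apply: derivable_within_continuous => s; rewrite in_itv/= => sab.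
  by have [] := dEE s (ab s sab).
have M0 : 0 <= M by apply: le_trans (GM 0 _) => //; rewrite normr0.
rewrite -Er -E0 exprS.
have [r0|r0] := leP 0 r.
  have [s||s + ->] := @MVT_segment R E dE 0 r r0.
  - rewrite in_itv/= => /andP[s0 sr]; apply: dEE.
    by rewrite !ger0_norm// ltW.
  - apply: cE => s' /andP[? ?]; rewrite !ger0_norm//.
  rewrite in_itv/= => /andP[s0 sr]; rewrite subr0 normrM mulrC -!mulrA.
  rewrite ler_wpM2l// mulrA dEb// !ger0_norm ?subr_ge0//; lra.
have [s||s + H] := @MVT_segment R E dE r 0 (ltW r0).
- rewrite in_itv/= => /andP[s0 sr]; apply: dEE.
  by rewrite !ltr0_norm// lerN2 ltW.
- apply: cE => s' /andP[? ?]; rewrite (ltr0_norm r0) ler0_norm// lerN2//.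
rewrite in_itv/= distrC H => /andP[s0 sr]; rewrite sub0r normrM normrN mulrC -!mulrA.
rewrite ler_wpM2l// mulrA dEb//.
  by rewrite (ltr0_norm r0) ler0_norm// lerN2.
by rewrite (ltr0_norm r0) ler0_norm ?subr_le0//; lra.
Qed.

End taylor.

Lemma is_derive_bigsum {R : realType} {V : normedModType R} (F : nat -> V -> R)
    (dF : nat -> R) x v L :
  (forall k, is_derive x v (F k) (dF k)) ->
  is_derive x v (fun y => \sum_(0 <= k < L) F k y) (\sum_(0 <= k < L) dF k).
Proof.
move=> dFF; elim: L => [|L IH].
  under eq_fun do rewrite big_nil; rewrite big_nil; exact: is_derive_cst.
under eq_fun do rewrite big_nat_recr//=; rewrite big_nat_recr//=.
exact: is_derive_add.
Qed.

(** * Taylor series along a ladder, rearranged by degree *)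

Section ladder.
Context {R : realType} (A B : nat -> R) (K : R).
Hypotheses (K0 : 0 <= K) (B0 : B 0%N = 0)
  (HA : forall k, `|A k| <= K * k.+1%:R) (HB : forall k, `|B k| <= K * k.+1%:R).

(* [ladder m j k] is the coefficient of [H k] in the [j]-th derivative of [H m],
   for functions such that [(H k)' = A k * H k.+1 + B k * H k.-1]. *)
Fixpoint ladder m j k : R :=
  if j is i.+1 then
    (if k is k1.+1 then ladder m i k1 * A k1 else 0) + ladder m i k.+1 * B k.+1
  else (k == m)%:R.

Arguments ladder : simpl never.

Lemma ladder0 m k : ladder m 0 k = (k == m)%:R.
Proof. by []. Qed.

Lemma ladderS m j k : ladder m j.+1 k =
  (if k is k1.+1 then ladder m j k1 * A k1 else 0) + ladder m j k.+1 * B k.+1.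
Proof. by []. Qed.

Lemma ladder1_diag m : ladder m 1 m = 0.
Proof.
rewrite ladderS !ladder0 gtn_eqF// mul0r addr0; case: m => // m.
by rewrite ladder0 ltn_eqF// mul0r.
Qed.

Lemma ladder1_up m : ladder m 1 m.+1 = A m.
Proof. by rewrite ladderS !ladder0 eqxx mul1r gtn_eqF ?mul0r ?addr0// ltnW. Qed.

Lemma ladder1_down m : ladder m.+1 1 m = B m.+1.
Proof.
rewrite ladderS !ladder0 eqxx mul1r; case: m => [|m]; first by rewrite add0r.
by rewrite ladder0 ltn_eqF ?mul0r ?add0r// ltnW.
Qed.

Lemma ladder_eq0 m j k : (m + j < k)%N -> ladder m j k = 0.
Proof.
elim: j k => [|j IH] k jk; first by rewrite ladder0 gtn_eqF// -(addn0 m).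
rewrite ladderS (IH k.+1) ?mul0r ?addr0; last first.
  by rewrite (ltn_trans _ (ltnSn k))// (leq_trans _ jk)// addnS ltnW.
by case: k jk => // k jk; rewrite IH ?mul0r//; rewrite addnS in jk.
Qed.

(** Here 5 = 4 + 1: raising the degree multiplies the weight [4 ^+ k] by 4, and lowering it does not
    increase the weight. *)
Definition rate m := 5 * K * m.+1%:R.

Lemma rate_ge0 m : 0 <= rate m.
Proof. by rewrite !mulr_ge0. Qed.

(** The weight [4 ^+ k] is the growth allowed for [H k] in [HC]. As [ladder m j] is supported in
    [k <= m + j], one more derivative costs at most a factor [5 K (m+j+1)], and
    [m+j+1 <= (m+1)(j+1)] splits it into [rate m] and the next factor of [j.+1] factorial. *)
Lemma ladder_weight m j L :
  \sum_(0 <= k < L) `|ladder m j k| * 4 ^+ k <= 4 ^+ m * rate m ^+ j * j`!%:R.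
Proof.
elim: j L => [|j IH] L.
  rewrite expr0 fact0 !mulr1.
  have [mL|Lm] := ltnP m L.
    rewrite (bigD1_seq m) ?iota_uniq ?mem_index_iota//= ladder0 eqxx normr1 mul1r.
    rewrite big1 ?addr0// => k /negPf km; rewrite ladder0 km normr0 mul0r//.
  rewrite big_nat big1 ?exprn_ge0// => k /andP[_ kL].
  by rewrite ladder0 ltn_eqF ?normr0 ?mul0r// (leq_trans kL).
set W := 4 ^+ m * rate m ^+ j * j`!%:R in IH *.
have W0 : 0 <= W by rewrite !mulr_ge0 ?exprn_ge0 ?rate_ge0.
have mono (M : nat -> R) k : (forall k, `|M k| <= K * k.+1%:R) ->
    `|ladder m j k * M k| <= K * (m + j).+1%:R * `|ladder m j k|.
  move=> HM; rewrite normrM mulrC; have [kj|kj] := leqP k (m + j).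
    rewrite ler_wpM2r// (le_trans (HM k))// ler_wpM2l// ler_nat//.
  by rewrite ladder_eq0// normr0 !mulr0.
have step : \sum_(0 <= k < L) `|ladder m j.+1 k| * 4 ^+ k <=
    K * (m + j).+1%:R * (4 * W) + K * (m + j).+1%:R * W.
  apply: (@le_trans _ _ (\sum_(0 <= k < L)
     ((if k is k1.+1 then K * (m + j).+1%:R * (4 * (`|ladder m j k1| * 4 ^+ k1)) else 0) +
      K * (m + j).+1%:R * (`|ladder m j k.+1| * 4 ^+ k.+1)))).
    apply: ler_sum => k _; rewrite ladderS.
    apply: (@le_trans _ _ (`|if k is k1.+1 then ladder m j k1 * A k1 else 0| * 4 ^+ k
      + `|ladder m j k.+1 * B k.+1| * 4 ^+ k)).
      by rewrite -mulrDl ler_wpM2r ?exprn_ge0// ler_normD.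
    apply: lerD.
      case: k => [|k]; first by rewrite normr0 mul0r.
      rewrite exprS mulrCA [leRHS]mulrCA ler_wpM2l// mulrA.
      by rewrite ler_wpM2r ?exprn_ge0//; apply: mono.
    rewrite mulrA; apply: ler_pM.
    - exact: normr_ge0.
    - exact: exprn_ge0.
    - exact: mono.
    - by rewrite ler_weXn2l// ler1n.
  rewrite big_split/=; apply: lerD.
    have KW : 0 <= K * (m + j).+1%:R * (4 * W).
      by apply: mulr_ge0; apply: mulr_ge0.
    case: L => [|L]; first by rewrite big_nil.
    rewrite big_nat_recl// add0r -mulr_sumr ler_wpM2l ?mulr_ge0//.
    by rewrite -mulr_sumr ler_wpM2l// IH.
  rewrite -mulr_sumr ler_wpM2l ?mulr_ge0//.
  apply: le_trans (IH L.+1); rewrite [leRHS]big_nat_recl// lerDr.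
  by rewrite mulr_ge0// exprn_ge0.
apply: le_trans step _.
have -> : 4 ^+ m * rate m ^+ j.+1 * (j.+1)`!%:R = (5 * K * W) * (m.+1%:R * j.+1%:R).
  by rewrite factS natrM exprS /W /rate; ring.
have -> : K * (m + j).+1%:R * (4 * W) + K * (m + j).+1%:R * W =
  (5 * K * W) * (m + j).+1%:R by ring.
have W5 : 0 <= 5 * K * W by rewrite mulr_ge0// mulr_ge0.
rewrite ler_wpM2l// -natrM ler_nat mulSn mulnS.
by rewrite addSn ltnS addnA [(j + m)%N]addnC leq_addr.
Qed.

(** The coefficient of [H k 0] in the Taylor series of [H m r] collected by degree. *)
Definition flow_coef m r k : R :=
  limn (series (fun j => r ^+ j / j`!%:R * ladder m j k)).

Section small_time.
Variables (m : nat) (r : R).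
Hypothesis small : 4 * (`|r| * rate m) <= 1.
Let q := `|r| * rate m.
Let q0 : 0 <= q. Proof. by rewrite mulr_ge0// rate_ge0. Qed.

Let term_weight j L :
  \sum_(0 <= k < L) `|r ^+ j / j`!%:R * ladder m j k| * 4 ^+ k <= 4 ^+ m * q ^+ j.
Proof.
have f0 : 0 < j`!%:R :> R by rewrite ltr0n fact_gt0.
have -> : \sum_(0 <= k < L) `|r ^+ j / j`!%:R * ladder m j k| * 4 ^+ k =
    (`|r| ^+ j / j`!%:R) * \sum_(0 <= k < L) `|ladder m j k| * 4 ^+ k.
  rewrite mulr_sumr; apply: eq_bigr => k _.
  by rewrite normrM normrM normrX normfV normr_nat mulrA.
apply: le_trans (ler_wpM2l _ (ladder_weight m j L)) _.
  by rewrite divr_ge0// exprn_ge0.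
rewrite /q [(_ * rate m) ^+ j]exprMn [_ * j`!%:R]mulrC mulrA divfK ?lt0r_neq0//.
by rewrite [leLHS]mulrCA.
Qed.

Let term_le j k : `|r ^+ j / j`!%:R * ladder m j k| * 4 ^+ k <= 4 ^+ m * q ^+ j.
Proof.
apply: le_trans (term_weight j k.+1); rewrite big_nat_recr//= lerDr.
by apply: sumr_ge0 => i _; rewrite mulr_ge0// exprn_ge0.
Qed.

Let term_le1 j k : `|r ^+ j / j`!%:R * ladder m j k| <= 4 ^+ m * q ^+ j.
Proof. by apply: le_trans (term_le j k); rewrite ler_peMr// exprn_ege1// ler1n. Qed.

Let q14 : q <= 1 / 4.
Proof. by move: small; rewrite -/q; lra. Qed.

Lemma flow_coef_cvg k :
  series (fun j => r ^+ j / j`!%:R * ladder m j k) @ \oo --> flow_coef m r k.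
Proof.
apply: normed_cvg; apply: (@series_le_cvg _ _ (geometric (4 ^+ m) q)) => [j|j|j|].
- exact: normr_ge0.
- by rewrite /geometric/= mulr_ge0 ?exprn_ge0.
- exact: term_le1.
by apply: is_cvg_geometric_series; rewrite ger0_norm//; have := q14; lra.
Qed.

Let geo_tail J L : (J <= L)%N -> \sum_(J <= j < L) q ^+ j <= 2 * q ^+ J.
Proof.
move=> JL; have := q14; have := q0 => q0' q14'.
(* The added term makes the induction work: it absorbs the next summand because
   [q ^+ M + 2 * q ^+ M.+1 <= 2 * q ^+ M] for [q <= 1/4]. *)
have : forall L, \sum_(J <= j < L) q ^+ j + 2 * q ^+ (maxn J L) <= 2 * q ^+ J.
  elim=> [|M IH]; first by rewrite big_geq// maxn0 add0r.
  have [MJ|JM] := ltnP M J.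
    by rewrite big_geq// add0r (maxn_idPl _).
  rewrite big_nat_recr//= (maxn_idPr _) ?leqW//.
  have := IH; rewrite (maxn_idPr JM) exprS.
  have : 0 <= q ^+ M by rewrite exprn_ge0.
  nra.
move=> /(_ L); have : 0 <= q ^+ maxn J L by rewrite exprn_ge0.
lra.
Qed.

Lemma flow_coef_first_order k :
  `|flow_coef m r k - (ladder m 0 k + r * ladder m 1 k)| <=
    2 * (4 ^+ m * rate m ^+ 2) * r ^+ 2.
Proof.
have L : (fun J => series (fun j => r ^+ j / j`!%:R * ladder m j k) J -
    (ladder m 0 k + r * ladder m 1 k)) @ \oo -->
    flow_coef m r k - (ladder m 0 k + r * ladder m 1 k).
  by apply: cvgB; [exact: flow_coef_cvg|exact: cvg_cst].
apply: (norm_lim_le L); exists 2%N => J J2.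
rewrite /series/= (big_cat_nat (leq0n 2) J2)//= !big_nat_recr//= big_nil add0r.
rewrite expr0 expr1 factS fact0 muln1 !divr1 mul1r [X in `|X|]addrAC subrr add0r.
apply: le_trans (ler_norm_sum _ _ _) _.
apply: (@le_trans _ _ (\sum_(2 <= j < J) 4 ^+ m * q ^+ j)).
  by apply: ler_sum => j _; exact: term_le1.
rewrite -mulr_sumr; apply: le_trans (ler_wpM2l _ (geo_tail J2)) _.
  by rewrite exprn_ge0.
rewrite le_eqVlt; apply/orP; left; apply/eqP.
by rewrite /q exprMn real_normK ?num_real//; ring.
Qed.

Variables (H : nat -> R -> R) (C : R).
Hypotheses
  (dH : forall k (s : R), `|s| <= `|r| ->
    is_derive s 1 (H k) (A k * H k.+1 s + B k * H k.-1 s))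
  (HC : forall k (s : R), `|s| <= `|r| -> `|H k s| <= C * 4 ^+ k).

Let C0 : 0 <= C.
Proof. by have := HC 0 (lexx _); rewrite expr0 mulr1; apply: le_trans. Qed.

(** The [j]-th derivative of [H m]; by [ladder_eq0] no degree above [m + j] occurs. *)
Let G j s := \sum_(0 <= k < (m + j).+1) ladder m j k * H k s.

Let supp (X : nat -> R) j L : (m + j < L)%N ->
  \sum_(0 <= k < L) ladder m j k * X k =
  \sum_(0 <= k < (m + j).+1) ladder m j k * X k.
Proof.
move=> jL; rewrite (big_cat_nat (leq0n _) jL)//= [X in _ + X]big_nat [X in _ + X]big1 ?addr0//.
by move=> k /andP[jk _]; rewrite ladder_eq0// mul0r.
Qed.

Let dG j (s : R) : `|s| <= `|r| -> is_derive s 1 (G j) (G j.+1 s).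
Proof.
move=> sr; have D k : is_derive s 1 (fun s => ladder m j k * H k s)
    (ladder m j k * (A k * H k.+1 s + B k * H k.-1 s)).
  by apply: is_derive_scale; exact: dH.
apply: is_derive_eq (is_derive_bigsum _ D) _.
rewrite /G; transitivity
  (\sum_(0 <= k < (m + j).+2)
     (if k is k1.+1 then ladder m j k1 * A k1 else 0) * H k s +
   \sum_(0 <= k < (m + j).+2) ladder m j k.+1 * B k.+1 * H k s); last first.
  rewrite -big_split/= addnS; apply: eq_bigr => k _; rewrite -mulrDl//.
under eq_bigr do rewrite mulrDr; rewrite big_split/=; congr (_ + _).
  rewrite [RHS]big_nat_recl// mul0r add0r; apply: eq_bigr => k _.
  by rewrite mulrA.
(* The longer range makes both sides end at the same index after the downward shift. The term
   [k = 0], where [k.-1] is again 0, vanishes by [B0]. *)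
rewrite -(supp (fun k => B k * H k.-1 s) (L := (m + j).+3)); last by rewrite ltnW.
rewrite [LHS]big_nat_recl//= B0 mul0r mulr0 add0r; apply: eq_bigr => k _.
by rewrite mulrA.
Qed.

Let G_le j (s : R) : `|s| <= `|r| -> `|G j s| <= C * (4 ^+ m * rate m ^+ j * j`!%:R).
Proof.
move=> sr; apply: le_trans (ler_norm_sum _ _ _) _.
apply: (@le_trans _ _ (\sum_(0 <= k < (m + j).+1) C * (`|ladder m j k| * 4 ^+ k))).
  by apply: ler_sum => k _; rewrite normrM mulrCA ler_wpM2l// HC.
by rewrite -mulr_sumr ler_wpM2l// ladder_weight.
Qed.

(** Both quantities are compared with the Taylor polynomial of [J] terms: in [J + 2], the [J] comes
    from its remainder and the 2 from the tails of the series [flow_coef]. The condition on [N]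
    ensures that every degree in this polynomial is below [N]. *)
Lemma flow_expansion J N : (0 < J)%N -> (m + J <= N)%N ->
  `|H m r - \sum_(k < N) flow_coef m r k * H k 0| <=
    C * 4 ^+ m * (J%:R + 2) * q ^+ J.
Proof.
move=> J0 JN.
have GJ : G 0%N r = H m r.
  rewrite /G addn0 big_nat_recr//= big_nat big1 ?add0r; last first.
    by move=> k /andP[_ km]; rewrite ladder0 ltn_eqF// mul0r.
  by rewrite ladder0 eqxx mul1r.
have T1 : `|H m r - \sum_(j < J) r ^+ j / j`!%:R * G j 0| <= C * 4 ^+ m * J%:R * q ^+ J.
  rewrite -GJ; apply: le_trans (taylor_bound J0 _ _) _.
  - by move=> j s; exact: dG.
  - by move=> s; exact: G_le.
  rewrite le_eqVlt; apply/orP; left; apply/eqP.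
  case: J J0 {JN} => // J _; rewrite factS natrM /q [(_ * _) ^+ J.+1]exprMn /=.
  have f0 : J`!%:R != 0 :> R by rewrite pnatr_eq0 -lt0n fact_gt0.
  rewrite mulrAC; apply: (canLR (mulfK f0)).
  set a := _ ^+ J.+1; set b := rate m ^+ _; set c := 4 ^+ m; ring.
have T2 : `|\sum_(k < N) flow_coef m r k * H k 0 -
    \sum_(j < J) r ^+ j / j`!%:R * G j 0| <= C * 4 ^+ m * 2 * q ^+ J.
  pose S L := \sum_(0 <= k < N)
    series (fun j => r ^+ j / j`!%:R * ladder m j k) L * H k 0.
  have SL : S @ \oo --> \sum_(0 <= k < N) flow_coef m r k * H k 0.
    rewrite /S; elim: N {JN S} => [|N IH].
      by under eq_fun do rewrite big_nil; rewrite big_nil; exact: cvg_cst.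
    under eq_fun do rewrite big_nat_recr//=; rewrite big_nat_recr//=.
    apply: cvgD => //; apply: cvgM; first exact: flow_coef_cvg.
    exact: cvg_cst.
  have SE L : S L = \sum_(0 <= j < L) \sum_(0 <= k < N)
      r ^+ j / j`!%:R * ladder m j k * H k 0.
    rewrite /S exchange_big/=; apply: eq_bigr => k _.
    by rewrite /series/= mulr_suml.
  rewrite -(big_mkord xpredT (fun k => flow_coef m r k * H k 0)).
  have SD : (fun L => S L - \sum_(j < J) r ^+ j / j`!%:R * G j 0) @ \oo -->
      \sum_(0 <= k < N) flow_coef m r k * H k 0 -
      \sum_(j < J) r ^+ j / j`!%:R * G j 0.
    by apply: cvgB => //; exact: cvg_cst.
  apply: (norm_lim_le SD); exists J => L JL.
  rewrite SE (big_cat_nat (leq0n _) JL)//= -(big_mkord xpredT (fun j => r ^+ j / j`!%:R * G j 0)).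
  have -> : \sum_(0 <= j < J) r ^+ j / j`!%:R * G j 0 = \sum_(0 <= j < J)
      \sum_(0 <= k < N) r ^+ j / j`!%:R * ladder m j k * H k 0.
    rewrite big_nat [RHS]big_nat; apply: eq_bigr => j /andP[_ jJ].
    under [RHS]eq_bigr do rewrite -mulrA; rewrite -mulr_sumr supp//.
    by rewrite (leq_trans _ JN)// ltn_add2l.
  rewrite addrAC subrr add0r; apply: le_trans (ler_norm_sum _ _ _) _.
  apply: (@le_trans _ _ (\sum_(J <= j < L) C * 4 ^+ m * q ^+ j)).
    apply: ler_sum => j _; apply: le_trans (ler_norm_sum _ _ _) _.
    rewrite -mulrA; apply: le_trans (ler_wpM2l C0 (term_weight j N)).
    rewrite mulr_sumr; apply: ler_sum => k _; rewrite normrM mulrCA.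
    by rewrite ler_wpM2l// HC// normr0.
  by rewrite -mulr_sumr -[leRHS]mulrA ler_wpM2l ?geo_tail// mulr_ge0// exprn_ge0.
rewrite (_ : H m r - _ = (H m r - \sum_(j < J) r ^+ j / j`!%:R * G j 0) -
  (\sum_(k < N) flow_coef m r k * H k 0 - \sum_(j < J) r ^+ j / j`!%:R * G j 0)).
  apply: le_trans (ler_normB _ _) _; rewrite mulrDr mulrDl; exact: lerD.
by rewrite opprB addrA subrK.
Qed.

End small_time.
End ladder.

(** * The hyperbolic flow *)

Section zonal_function.
Context {R : realType} (n : nat).
Hypothesis n2 : (2 < n)%N.
Let n3 : 3 <= n%:R :> R. Proof. by rewrite (ler_nat _ 3). Qed.
Implicit Types y t : R.

Definition zfun k y t : R := radial n k t * zonal (zbeta n) y t k.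

(** The raising coefficient A_k; it vanishes at [k = 0] because [zfun 0] is the constant 1 on the
    ball. *)
Definition zup k : R := - (2 * k%:R * (n%:R + k%:R - 1) / (k%:R + n%:R / 2)).

Lemma zup_le k : `|zup k| <= 2 * n%:R * k.+1%:R.
Proof.
have := ler0n R k; have := n3 => n3' k0.
have d0 : 0 < k%:R + n%:R / 2 :> R by lra.
rewrite normrN ger0_norm; last first.
  by apply: divr_ge0; [apply: mulr_ge0; lra|exact: ltW].
rewrite ler_pdivrMr// -[k.+1%:R]natr1; set N : R := n%:R in n3' *; set k' : R := k%:R in k0 *.
have N3 : 0 <= N - 3 by rewrite subr_ge0.
have := mulr_ge0 (mulr_ge0 k0 k0) N3; have := mulr_ge0 k0 k0.
have : 0 <= N * N * k' by rewrite !mulr_ge0//; lra.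
have : 0 <= N * N by rewrite mulr_ge0//; lra.
lra.
Qed.

Lemma zkappa_norm_le k : `|@zkappa R n k| <= 2 * n%:R * k.+1%:R.
Proof.
have k0 := ler0n R k; have n3' := n3.
have h0 : 0 <= @zkappa R n k.
  by case: k {k0} => [|k]; rewrite ?zkappa0// ltW// zkappa_gt0.
rewrite ger0_norm//; apply: le_trans (@zkappa_le R n n2 k) _; rewrite -[k.+1%:R]natr1; nra.
Qed.

Lemma zonal_le k y t : `|y| <= 1 -> `|t| <= 1 -> `|zonal (zbeta n) y t k| <= 2 ^+ k.
Proof.
move=> y1 t1.
suff: `|zonal (zbeta n) y t k| <= 2 ^+ k /\ `|zonal (zbeta n) y t k.+1| <= 2 ^+ k.+1.
  by case.
elim: k => [|k [IH1 IH2]].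
  by rewrite /= normr1 expr0; split=> //; rewrite expr1; apply: le_trans y1 _; lra.
split=> //; rewrite zonalSS; apply: le_trans (ler_normB _ _) _.
have b1 : `|@zbeta R n k.+1| <= 1.
  by rewrite ger0_norm ?zbeta_le1// ltW// zbeta_gt0.
move: (zbeta n k.+1) b1 => b b1.
rewrite !normrM; apply: (@le_trans _ _ (2 ^+ k.+1 + 2 ^+ k)).
  apply: lerD; first by rewrite -[leRHS]mul1r ler_pM.
  rewrite -[leRHS]mul1r; apply: ler_pM => //.
  by rewrite -[leRHS]mul1r ler_pM.
by have := exprn_ge0 k (ler0n R 2); rewrite !exprS; lra.
Qed.

(** Origin of the weight [4 ^+ k]: one factor [2 ^+ k] bounds the zonal polynomial, the other
    absorbs the linear growth in [k] of the radial factor. *)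
Lemma zfun_le : exists2 C, 0 <= C & forall k y t, `|y| <= 1 -> `|t| <= 1 ->
  `|zfun k y t| <= C * 4 ^+ k.
Proof.
have [C C0 HC] := @radial_bounded R n n2.
exists (1 + C) => [|k y t y1 t1]; first by rewrite addr_ge0.
rewrite normrM -[4]/(2 * 2)%:R natrM exprMn mulrA.
apply: ler_pM => //; last exact: zonal_le.
apply: le_trans (HC k t t1) _.
have k1 : k.+1%:R <= 2 ^+ k :> R by rewrite -natrX ler_nat ltn_expl.
have k2 : 1 <= 2 ^+ k :> R by rewrite exprn_ege1// ler1n.
rewrite mulrDl mul1r lerD// mulrC ler_wpM2l//.
by apply: le_trans k1; rewrite ler_nat.
Qed.

(** Write S_k for the radial factor and z_k for the zonal one. By [zonal_flow] the derivative
    contains [2 y z_k ((1 - t) S_k' - k S_k)], which [radial_raise] turns into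
    [zup k * S_(k+1) y z_k]. Replacing [y z_k] by the three-term recurrence isolates z_(k+1); the
    terms in z_(k-1) then form the left-hand side of [radial_lower]. *)
Lemma zfun_flow k (y t : R -> R) (s : R) :
  is_derive s 1 y (1 + t s - 2 * y s ^+ 2) ->
  is_derive s 1 t (2 * y s * (1 - t s)) -> `|t s| < 1 ->
  is_derive s 1 (fun s => zfun k (y s) (t s))
    (zup k * zfun k.+1 (y s) (t s) + zkappa n k * zfun k.-1 (y s) (t s)).
Proof.
move=> dy dt t1.
pose z m s := zonal (zbeta n) (y s) (t s) m : R.
have zSS m : z m.+2 = fun s => y s * z m.+1 s + - zbeta n m.+1 * (t s * z m s).
  by apply/funext => r; rewrite /z zonalSS; ring.
have dz m : derivable (z m) s 1.
  suff: derivable (z m) s 1 /\ derivable (z m.+1) s 1 by case.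
  elim: m => [|m [IH1 IH2]]; first by split; [exact: derivable_cst|case: dy].
  split; [exact: IH2|rewrite zSS].
  have [] // := is_derive_add (is_derive_mul dy (derivableP IH2))
    (is_derive_scale (- zbeta n m.+1) (is_derive_mul dt (derivableP IH1))).
have D : zonal_derivation (zbeta n) (y s) (t s) (1 + t s - 2 * y s ^+ 2)
    (2 * y s * (1 - t s)) (fun m => 'D_1 (z m) s).
  split; first exact: derive_cst.
    by rewrite (_ : z 1%N = y)//; case: dy.
  move=> m; rewrite zSS.
  have := is_derive_add (is_derive_mul dy (derivableP (dz m.+1)))
    (is_derive_scale (- zbeta n m.+1) (is_derive_mul dt (derivableP (dz m)))).
  by case=> _ ->; rewrite /z; ring.
have {}D := @zonal_flow _ _ (zkappa n) n%:R (zkappa0 n) (zkappa1 n2) (zkappaE n2)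
  (zkappaS n2) _ _ _ D k.
have dS : is_derive s 1 (fun s => radial n k (t s))
    (dradial n k (t s) * (2 * y s * (1 - t s))).
  by apply: is_derive1_comp => //; exact: is_derive_radial.
apply: is_derive_eq (is_derive_mul dS (derivableP (dz k))) _.
rewrite D /zfun -/(z k s) -/(z k.+1 s) -/(z k.-1 s).
have up := radial_raise n2 k t1.
have c0 : k%:R + n%:R / 2 != 0 :> R.
  by have := ler0n R k; have := n3 => ? ?; rewrite gt_eqF//; lra.
have {}up : 2 * ((1 - t s) * dradial n k (t s) - k%:R * radial n k (t s)) =
    zup k * radial n k.+1 (t s).
  apply: (mulfI c0); rewrite mulrCA up /zup; field.
  by have := ler0n R k; have := n3 => ? ?; rewrite gt_eqF//; lra.
rewrite [zup k * (_ * _)]mulrA -up.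
case: k D dS up c0 => [|k] D dS up c0.
  by rewrite zkappa0 /z/=; ring.
have lo := radial_lower n2 k t1.
rewrite zSS /=.
have -> : zkappa n k.+1 * (radial n k (t s) * z k s) =
    zbeta n k.+1 * z k s * ((n%:R + 2 * k%:R) * radial n k (t s)).
  by rewrite zkappaE//; ring.
by rewrite -lo zkappaE// -[k.+1%:R]natr1; ring.
Qed.

End zonal_function.

(* Orbit of the one-parameter group [x |-> mobius (tanh s e) (- x)] in the
   coordinates [y = x_0], [t = |x|^2]; [flow_q] is the denominator of
   [mobius], multiplied by [cosh^2 s], so that [1 - t] is proportional to its
   inverse and [y] is half its logarithmic derivative. *)
Section hyperbolic_flow.
Context {R : realType}.
Variables (y0 t0 : R).
Hypotheses (yt : y0 ^+ 2 <= t0) (t01 : t0 < 1).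
Let w := (1 - t0) / 2.
Let a := (1 + t0) / 2 + y0.
Let b := (1 + t0) / 2 - y0.

Definition flow_q (s : R) : R := w + (a * expR (2 * s) + b * expR (- 2 * s)) / 2.
Let dq (s : R) : R := a * expR (2 * s) - b * expR (- 2 * s).

Definition flow_y (s : R) : R := dq s / (2 * flow_q s).
Definition flow_t (s : R) : R := 1 - (1 - t0) / flow_q s.

Let w0 : 0 < w. Proof. by rewrite divr_gt0// subr_gt0. Qed.
Let ab : a * b = w ^+ 2 + (t0 - y0 ^+ 2).
Proof. by rewrite /a /b /w; field. Qed.
Let a0 : 0 <= a. Proof. by rewrite /a; have := sqr_ge0 (1 + y0); move: yt; lra. Qed.
Let b0 : 0 <= b. Proof. by rewrite /b; have := sqr_ge0 (1 - y0); move: yt; lra. Qed.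
Let EE s : expR (2 * s) * expR (- 2 * s) = 1 :> R.
Proof. by rewrite mulNr expRxMexpNx_1. Qed.

Lemma flow_q_gt0 s : 0 < flow_q s.
Proof. by rewrite ltr_wpDr// divr_ge0// addr_ge0// mulr_ge0// expR_ge0. Qed.

Let dE c (s : R) : is_derive s 1 (fun s => expR (c * s)) (c * expR (c * s)).
Proof.
have dl := is_derive_scale c (is_derive_id s (1 : R)).
by apply: is_derive_eq (is_derive1_comp (is_derive_expR (c * s)) dl) _; rewrite mulr1 mulrC.
Qed.

Let is_derive_flow_q (s : R) : is_derive s 1 flow_q (dq s).
Proof.
have := is_derive_add (is_derive_cst w s 1) (is_derive_scale 2^-1
  (is_derive_add (is_derive_scale a (dE 2 s)) (is_derive_scale b (dE (- 2) s)))).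
rewrite (_ : (fun _ => _ + _) = flow_q); last first.
  by apply/funext => r; rewrite /flow_q mulrC.
by move/is_derive_eq; apply; rewrite /dq; field.
Qed.

Let is_derive_dq (s : R) : is_derive s 1 dq (4 * (flow_q s - w)).
Proof.
have := is_derive_add (is_derive_scale a (dE 2 s)) (is_derive_scale (- b) (dE (- 2) s)).
rewrite (_ : (fun _ => _ + _) = dq); last by apply/funext => r; rewrite /dq [- b * _]mulNr.
by move/is_derive_eq; apply; rewrite /flow_q; field.
Qed.

Let is_derive_iq (s : R) : is_derive s 1 (fun s => (flow_q s)^-1) (- (dq s / flow_q s ^+ 2)).
Proof.
have q0 : flow_q s != 0 by rewrite gt_eqF// flow_q_gt0.
apply: is_derive_eq (is_deriveV q0 (is_derive_flow_q s)) _.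
by rewrite /GRing.scale/= mulNr mulrC.
Qed.

Lemma is_derive_flow_t (s : R) : is_derive s 1 flow_t (2 * flow_y s * (1 - flow_t s)).
Proof.
have := is_derive_add (is_derive_cst (1 : R) s 1)
  (is_derive_scale (- (1 - t0)) (is_derive_iq s)).
rewrite (_ : (fun _ => _ + _) = flow_t); last first.
  by apply/funext => r; rewrite /flow_t mulNr.
move/is_derive_eq; apply; rewrite /flow_y /flow_t.
by field; rewrite gt_eqF// flow_q_gt0.
Qed.

Lemma is_derive_flow_y (s : R) : is_derive s 1 flow_y (1 + flow_t s - 2 * flow_y s ^+ 2).
Proof.
have := is_derive_scale 2^-1 (is_derive_mul (is_derive_dq s) (is_derive_iq s)).
rewrite (_ : (fun _ => 2^-1 * _) = flow_y); last first.
  by apply/funext => r; rewrite /flow_y invfM mulrCA.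
move/is_derive_eq; apply; rewrite /flow_y /flow_t /w.
by field; rewrite gt_eqF// flow_q_gt0.
Qed.

(** After clearing denominators, the difference of the two sides is [4 (a b - w^2)], which is
    [4 (t0 - y0^2)] at every time. *)
Lemma flow_y_sqr_le s : flow_y s ^+ 2 <= flow_t s.
Proof.
have q0 := flow_q_gt0 s; rewrite /flow_y exprMn exprVn ler_pdivrMr; last first.
  by rewrite exprn_gt0// mulr_gt0.
have -> : flow_t s * (2 * flow_q s) ^+ 2 = 4 * flow_q s * (flow_q s - 2 * w).
  by rewrite /flow_t /w; field; rewrite gt_eqF.
have e := EE s; rewrite /flow_q /dq.
move: (expR (2 * s)) (expR (- 2 * s)) e => E F EF.
have -> : 4 * (w + (a * E + b * F) / 2) * (w + (a * E + b * F) / 2 - 2 * w) =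
  (a * E - b * F) ^+ 2 + 4 * (a * b * (E * F) - w ^+ 2) by field.
by rewrite EF mulr1 ab; move: yt; nra.
Qed.

Lemma flow_t_lt1 s : flow_t s < 1.
Proof. by rewrite /flow_t ltrBlDr ltrDl divr_gt0 ?subr_gt0 ?flow_q_gt0. Qed.

Lemma flow_q0 : flow_q 0 = 1.
Proof. by rewrite /flow_q !mulr0 expR0 /w /a /b; field. Qed.

Lemma flow_y0 : flow_y 0 = y0.
Proof. by rewrite /flow_y flow_q0 /dq !mulr0 expR0 /a /b; field. Qed.

Lemma flow_t0 : flow_t 0 = t0.
Proof. by rewrite /flow_t flow_q0; field. Qed.

(** Here [h] is tanh s and [(E + 1)^2 / (4 E)] is cosh^2 s, the ratio of [flow_q] to the denominator
    [D] of the Moebius map. *)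
Lemma flow_mobius s : let E := expR (2 * s) in let h := (E - 1) / (E + 1) in
  let D := 1 + 2 * h * y0 + h ^+ 2 * t0 in
  [/\ D != 0, flow_y s = (h * (1 + t0) + (1 + h ^+ 2) * y0) / D &
      flow_t s = (t0 + 2 * h * y0 + h ^+ 2) / D].
Proof.
move=> E h D; have E0 : 0 < E := expR_gt0 _.
have e : expR (- 2 * s) = E^-1 by rewrite mulNr expRN.
have E1 : E + 1 != 0 by rewrite gt_eqF// addr_gt0.
have qD : flow_q s = D * ((E + 1) ^+ 2 / (4 * E)).
  rewrite /flow_q e -/E /D /h /w /a /b; field.
  by rewrite E1 gt_eqF.
have D0 : D != 0.
  by have := flow_q_gt0 s; rewrite qD; apply: contraTneq => ->; rewrite mul0r ltxx.
have E0' : E != 0 by rewrite gt_eqF.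
split=> //; rewrite /flow_y /flow_t /dq qD ?e -?/E.
  rewrite /a /b; apply: (mulfI D0).
  have -> : D * ((((1 + t0) / 2 + y0) * E - ((1 + t0) / 2 - y0) * E^-1) /
     (2 * (D * ((E + 1) ^+ 2 / (4 * E))))) =
     (((1 + t0) / 2 + y0) * E - ((1 + t0) / 2 - y0) * E^-1) /
     (2 * ((E + 1) ^+ 2 / (4 * E))) by field; rewrite D0 E1 E0'.
  by rewrite [RHS]mulrCA divff// mulr1 /h; field; rewrite E1 E0'.
apply: (mulfI D0).
have -> : D * (1 - (1 - t0) / (D * ((E + 1) ^+ 2 / (4 * E)))) =
   D - (1 - t0) / ((E + 1) ^+ 2 / (4 * E)) by field; rewrite D0 E1 E0'.
by rewrite [RHS]mulrCA divff// mulr1 /D /h; field; rewrite E1 E0'.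
Qed.

End hyperbolic_flow.

(** The constant is chosen before the point, so the error is uniform on the whole open ball. *)
Lemma zfun_expansion (R : realType) (n : nat) : (2 < n)%N ->
  exists2 C : R, 0 <= C &
  forall m (s y0 t0 : R), y0 ^+ 2 <= t0 -> t0 < 1 ->
    4 * (`|s| * rate (2 * n%:R) m) <= 1 ->
  forall J N, (0 < J)%N -> (m + J <= N)%N ->
  `|zfun n m (flow_y y0 t0 s) (flow_t y0 t0 s) -
     \sum_(k < N) flow_coef (zup n) (zkappa n) m s k * zfun n k y0 t0| <=
  C * 4 ^+ m * (J%:R + 2) * (`|s| * rate (2 * n%:R) m) ^+ J.
Proof.
move=> n2; have [C C0 HC] := @zfun_le R n n2; exists C => //.
move=> m s y0 t0 yt t01 small J N J0 JN.
pose H k r := zfun n k (flow_y y0 t0 r) (flow_t y0 t0 r).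
have t1 r : `|flow_t y0 t0 r| < 1.
  rewrite ger0_norm; first exact: flow_t_lt1.
  by apply: le_trans (flow_y_sqr_le yt t01 r); exact: sqr_ge0.
have y1 r : `|flow_y y0 t0 r| <= 1.
  have := flow_y_sqr_le yt t01 r; have := t1 r; rewrite ltr_norml => /andP[_ ?] ?.
  by rewrite ler_norml; apply/andP; split; nra.
have K0 : 0 <= 2 * n%:R :> R by rewrite mulr_ge0.
have dH k (r : R) : `|r| <= `|s| ->
    is_derive r 1 (H k) (zup n k * H k.+1 r + zkappa n k * H k.-1 r).
  move=> _; have dy := is_derive_flow_y yt t01 r; have dt := is_derive_flow_t yt t01 r.
  exact (@zfun_flow R n n2 k (flow_y y0 t0) (flow_t y0 t0) r dy dt (t1 r)).
have HC' k (r : R) : `|r| <= `|s| -> `|H k r| <= C * 4 ^+ k.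
  by move=> _; apply: HC; [exact: y1|exact/ltW/t1].
have E := @flow_expansion R (zup n) (zkappa n) (2 * n%:R) K0 (zkappa0 n) (zup_le n2)
  (zkappa_norm_le n2) m s small H C dH HC' J N J0 JN.
have F : \sum_(k < N) flow_coef (zup n) (zkappa n) m s k * H k 0 =
    \sum_(k < N) flow_coef (zup n) (zkappa n) m s k * zfun n k y0 t0.
  by apply: eq_bigr => k _; rewrite /H flow_y0 flow_t0.
by rewrite -F; exact: E.
Qed.

(** * H-harmonicity *)

Section directional.
Context {R : realType} {V : normedModType R}.
Implicit Types (f : V -> R) (x v : V).

Lemma is_derive_line f x v (df : R) :
  is_derive x v f df <-> is_derive (0 : R) 1 (fun h : R => f (h *: v + x)) df.
Proof.
have E : (fun h : R => h^-1 *: ((f \o shift x) (h *: v) - f x)) =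
  (fun h : R => h^-1 *: (((fun h : R => f (h *: v + x)) \o shift 0) (h *: (1 : R^o)) -
    f (0 *: v + x))).
  apply/funext => h; rewrite /= scale0r add0r addr0.
  by congr (_ *: (f (_ *: _ + _) - _)); rewrite /GRing.scale/= mulr1.
by split=> -[d1 d2]; split; move: d1 d2; rewrite /derivable /derive E.
Qed.

Lemma is_derive_comp_scalar (g : R -> R) f x v (dg df : R) :
  is_derive (f x) 1 g dg -> is_derive x v f df ->
  is_derive x v (fun y => g (f y)) (dg * df).
Proof.
move=> dgx /is_derive_line dfx; apply/is_derive_line.
have dg' : is_derive (f (0 *: v + x)) 1 g dg by rewrite scale0r add0r.
exact: (is_derive1_comp dg' dfx).
Qed.

Lemma near_eq_continuous f g x : (\forall y \near x, f y = g y) ->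
  {for x, continuous f} -> {for x, continuous g}.
Proof.
move=> E cf; apply: (cvg_trans (near_eq_cvg E)).
by rewrite -(nbhs_singleton E); exact: cf.
Qed.

End directional.

Section calculus.
Context {R : realType} (n : nat).
Implicit Types (x : 'rV[R]_n) (p : mpoly.mpoly n R).
Local Notation e i := (delta_mx 0 i : 'rV[R]_n).

Definition peval p x : R := mpoly.meval (x 0) p.

Lemma is_derive_coord (i j : 'I_n) x :
  is_derive x (e i) (fun y : 'rV[R]_n => y 0 j) (i == j)%:R.
Proof.
apply/is_derive_line.
have -> : (fun h : R => (h *: e i + x) 0 j) = (fun h : R => (i == j)%:R * h + x 0 j).
  by apply/funext => h; rewrite !mxE eqxx/= eq_sym mulrC.
have := is_derive_add (is_derive_scale (i == j)%:R (is_derive_id (0 : R) 1))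
  (is_derive_cst (x 0 j) (0 : R) 1).
by rewrite addr0 mulr1.
Qed.

Lemma mpoly_closure_ind (Q : mpoly.mpoly n R -> Prop) :
  (forall c, Q (mpoly.mpolyC n c)) ->
  (forall j, Q (mpoly.mpolyX R (mpoly.mnm1 j))) ->
  (forall p q, Q p -> Q q -> Q (p + q)) ->
  (forall p q, Q p -> Q q -> Q (p * q)) -> forall p, Q p.
Proof.
move=> QC QX QD QM.
elim/mpoly.mpolyind => [|c m p _ _ IH]; first by rewrite -(mpoly.mpolyC0 n R).
apply: (QD) => //; rewrite -mpoly.mul_mpolyC; apply: (QM) => //.
rewrite mpoly.mpolyXE_id.
apply: (big_ind Q) => [|p1 p2 Q1 Q2|j _]; first by rewrite -mpoly.mpolyC1; exact: QC.
  exact: QM.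
elim: (m j) => [|l IHl]; first by rewrite expr0 -mpoly.mpolyC1; exact: QC.
by rewrite exprS; exact: QM.
Qed.

Lemma is_derive_peval p i x :
  is_derive x (e i) (peval p) (peval (mpoly.mderiv i p) x).
Proof.
elim/mpoly_closure_ind: p i x => [c|j|p q Qp Qq|p q Qp Qq] k y.
- have := is_derive_cst c y (e k).
  rewrite /peval mpoly.mderivC mpoly.meval0; congr is_derive.
  by apply/funext => z; rewrite mpoly.mevalC.
- have := is_derive_coord k j y.
  rewrite /peval ZonalMpoly.mderivXU rmorph_nat; congr is_derive.
  by apply/funext => z; rewrite mpoly.mevalXU.
- have := is_derive_add (Qp k y) (Qq k y).
  rewrite /peval mpoly.mderivD mpoly.mevalD; congr is_derive.
  by apply/funext => z; rewrite mpoly.mevalD.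
have := is_derive_mul (Qp k y) (Qq k y).
rewrite /peval mpoly.mderivM mpoly.mevalD !mpoly.mevalM; congr is_derive.
by apply/funext => z; rewrite mpoly.mevalM.
Qed.

Lemma continuous_peval p : continuous (peval p).
Proof.
elim/mpoly_closure_ind: p => [c|j|p q Qp Qq|p q Qp Qq].
- rewrite (_ : peval _ = fun=> c); first exact: cst_continuous.
  by apply/funext => z; rewrite /peval mpoly.mevalC.
- rewrite (_ : peval _ = fun z => z 0 j); first exact: coord_continuous.
  by apply/funext => z; rewrite /peval mpoly.mevalXU.
- rewrite (_ : peval _ = fun z => peval p z + peval q z).
    by move=> x; exact: (continuousD (Qp x) (Qq x)).
  by apply/funext => z; rewrite /peval mpoly.mevalD.
rewrite (_ : peval _ = fun z => peval p z * peval q z).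
  by move=> x; exact: (continuousM (Qp x) (Qq x)).
by apply/funext => z; rewrite /peval mpoly.mevalM.
Qed.

Lemma sqnorm_peval x : sqnorm x = peval (ZonalMpoly.sqsum n) x.
Proof.
rewrite /peval /ZonalMpoly.sqsum raddf_sum; apply: eq_bigr => i _.
by rewrite /= expr2 mpoly.mevalM mpoly.mevalXU.
Qed.

Lemma continuous_sqnorm : continuous (@sqnorm R n).
Proof.
rewrite (_ : @sqnorm R n = peval (ZonalMpoly.sqsum n)); first exact: continuous_peval.
by apply/funext => x; exact: sqnorm_peval.
Qed.

Lemma open_oball : open (oball R n).
Proof.
rewrite (_ : oball R n = @sqnorm R n @^-1` [set t | t < 1]); last by [].
by apply: open_comp => [x _|]; [exact: continuous_sqnorm|exact: open_lt].
Qed.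

Lemma near_oball x (P : 'rV[R]_n -> Prop) : oball R n x ->
  (forall y, oball R n y -> P y) -> \forall y \near x, P y.
Proof.
move=> xB HP; apply: (filterS HP).
exact: (open_nbhs_nbhs (conj open_oball xB)).
Qed.

Lemma sqnorm_lt1 x : oball R n x -> `|sqnorm x| < 1.
Proof. by move=> xB; rewrite ger0_norm// sqnorm_ge0. Qed.

(** Partial derivatives of such products are sums of products of the same form, so all second
    derivatives are explicit. *)
Definition radial_times (g : R -> R) p x : R := g (sqnorm x) * peval p x.

Lemma is_derive_radial_times (g g' : R -> R) p i x : oball R n x ->
  (forall t : R, `|t| < 1 -> is_derive t 1 g (g' t)) ->
  is_derive x (e i) (radial_times g p)
    (radial_times g' (2 * mpoly.mpolyX R (mpoly.mnm1 i) * p) x +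
     radial_times g (mpoly.mderiv i p) x).
Proof.
move=> xB dg.
have ds : is_derive x (e i) (@sqnorm R n) (2 * x 0 i).
  have := is_derive_peval (ZonalMpoly.sqsum n) i x.
  rewrite (_ : peval (ZonalMpoly.sqsum n) = @sqnorm R n); last first.
    by apply/funext => y; rewrite sqnorm_peval.
  by rewrite ZonalMpoly.mderiv_sqsum /peval mpoly.mevalM rmorph_nat mpoly.mevalXU.
have := is_derive_mul (is_derive_comp_scalar (dg _ (sqnorm_lt1 xB)) ds)
  (is_derive_peval p i x).
move/is_derive_eq; apply; rewrite /radial_times /peval.
by rewrite !mpoly.mevalM rmorph_nat mpoly.mevalXU; ring.
Qed.

Lemma continuous_radial_times (g : R -> R) p x : oball R n x ->
  {for sqnorm x, continuous g} -> {for x, continuous (radial_times g p)}.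
Proof.
move=> xB cg; have cs : {for x, continuous (fun y => g (sqnorm y))}.
  by apply: (@continuous_comp _ _ _ (@sqnorm R n) g) => //; exact: continuous_sqnorm.
exact: (continuousM cs (@continuous_peval p x)).
Qed.

Section second_order.
Variables (g0 g1 g2 : R -> R).
Hypotheses (d0 : forall t : R, `|t| < 1 -> is_derive t 1 g0 (g1 t))
  (d1 : forall t : R, `|t| < 1 -> is_derive t 1 g1 (g2 t))
  (c2 : forall t : R, `|t| < 1 -> {for t, continuous g2}).
Variable p : mpoly.mpoly n R.
Local Notation X i := (mpoly.mpolyX R (mpoly.mnm1 i)).
Local Notation D i := (mpoly.mderiv i).

Let partial1 i x := radial_times g1 (2 * X i * p) x + radial_times g0 (D i p) x.

Let partial2 i j x := radial_times g2 (2 * X j * (2 * X i * p)) x +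
  radial_times g1 (D j (2 * X i * p)) x +
  (radial_times g1 (2 * X j * D i p) x + radial_times g0 (D j (D i p)) x).

Let partialE i x : oball R n x -> partial i (radial_times g0 p) x = partial1 i x.
Proof. by move=> xB; have [_ H] := is_derive_radial_times p i xB d0; exact: H. Qed.

(** The formula [partialE] holds on the ball only; since the ball is open, it holds near [x] and can
    be differentiated there. *)
Let dpartial i j x : oball R n x ->
  is_derive x (e j) (partial i (radial_times g0 p)) (partial2 i j x).
Proof.
move=> xB; apply: (@near_eq_is_derive _ _ _ (partial1 i)).
  by apply: near_oball xB _ => y yB; rewrite partialE.
by apply: is_derive_add; apply: is_derive_radial_times.
Qed.

Let partial2E i j x : oball R n x ->
  partial j (partial i (radial_times g0 p)) x = partial2 i j x.
Proof. by move=> xB; have [_ H] := dpartial i j xB; exact: H. Qed.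

Lemma radial_times_C2 : C2_on_ball (radial_times g0 p).
Proof.
move=> x xB i j; split.
- by have [] := is_derive_radial_times p i xB d0.
- by have [] := dpartial i j xB.
have t1 := sqnorm_lt1 xB.
have cont (g g' : R -> R) q : (forall t : R, `|t| < 1 -> is_derive t 1 g (g' t)) ->
    {for x, continuous (radial_times g q)}.
  move=> dg; apply: continuous_radial_times => //; have := dg _ t1 => dgx.
  exact/differentiable_continuous/derivable1_diffP.
have H : {for x, continuous (partial2 i j)}.
  have c2' := @continuous_radial_times g2 (2 * X j * (2 * X i * p)) x xB (@c2 _ t1).
  exact: (continuousD (continuousD c2' (cont _ _ _ d1))
    (continuousD (cont _ _ _ d1) (cont _ _ _ d0))).
have E : \forall y \near x, partial2 i j y = partial j (partial i (radial_times g0 p)) y.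
  by apply: near_oball xB _ => y yB; rewrite partial2E.
exact: near_eq_continuous E H.
Qed.

(** Harmonicity removes the Laplacian of [p] and Euler's relation evaluates the cross terms; what is
    left is the hypergeometric operator of [radial_ode] applied to [g0]. *)
Lemma hlaplacian_radial_times k x : oball R n x ->
  \sum_(i < n) D i (D i p) = 0 ->
  \sum_(i < n) X i * D i p = k%:R * p ->
  hlaplacian (radial_times g0 p) x =
  (1 - sqnorm x) * 4 * peval p x *
  (sqnorm x * (1 - sqnorm x) * g2 (sqnorm x) +
   ((k%:R + n%:R / 2) - (k%:R - n%:R / 2 + 2) * sqnorm x) * g1 (sqnorm x) +
   k%:R * (n%:R / 2 - 1) * g0 (sqnorm x)).
Proof.
move=> xB lap eul.
have evX i : peval (X i) x = x 0 i by rewrite /peval mpoly.mevalXU.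
have evM q r : peval (q * r) x = peval q x * peval r x by rewrite /peval mpoly.mevalM.
have evD q r : peval (q + r) x = peval q x + peval r x by rewrite /peval mpoly.mevalD.
have evn m : peval m%:R x = m%:R by rewrite /peval rmorph_nat.
have evS (F : 'I_n -> mpoly.mpoly n R) :
    \sum_(i < n) peval (F i) x = peval (\sum_(i < n) F i) x.
  by rewrite /peval raddf_sum.
have evE : \sum_(i < n) x 0 i * peval (D i p) x = k%:R * peval p x.
  rewrite -evn -evM -eul -evS; apply: eq_bigr => i _.
  by rewrite evM evX.
have evL : \sum_(i < n) peval (D i (D i p)) x = 0.
  by rewrite evS lap /peval mpoly.meval0.
have sq : sqnorm x = \sum_(i < n) x 0 i * x 0 i by [].
have E1 : \sum_(i < n) x 0 i * partial i (radial_times g0 p) x =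
    2 * sqnorm x * g1 (sqnorm x) * peval p x + g0 (sqnorm x) * (k%:R * peval p x).
  transitivity (\sum_(i < n) (2 * g1 (sqnorm x) * peval p x * (x 0 i * x 0 i) +
     g0 (sqnorm x) * (x 0 i * peval (D i p) x))).
    apply: eq_bigr => i _; rewrite partialE// /partial1 /radial_times !evM evX evn.
    by ring.
  by rewrite big_split/= -!mulr_sumr -sq evE; ring.
have E2 : laplacian (radial_times g0 p) x =
    4 * sqnorm x * g2 (sqnorm x) * peval p x +
    g1 (sqnorm x) * (2 * n%:R + 4 * k%:R) * peval p x.
  rewrite /laplacian; transitivity (\sum_(i < n)
     (4 * g2 (sqnorm x) * peval p x * (x 0 i * x 0 i) +
     2 * g1 (sqnorm x) * peval p x + 4 * g1 (sqnorm x) * (x 0 i * peval (D i p) x) +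
     g0 (sqnorm x) * peval (D i (D i p)) x)).
    apply: eq_bigr => i _; rewrite partial2E// /partial2 /radial_times.
    have -> : D i (2 * X i * p) = 2 * p + 2 * X i * D i p.
      rewrite mpoly.mderivM; congr (_ * _ + _).
      by rewrite -[2]/(1 *+ 2) mulr2n mulrDl mul1r mpoly.mderivD ZonalMpoly.mderivXX.
    by rewrite !evD !evM !evX !evn; ring.
  rewrite !big_split/= -!mulr_sumr -sq evE evL sumr_const card_ord -mulr_natl.
  by ring.
rewrite /hlaplacian E1 E2.
by field.
Qed.

End second_order.

Lemma Hharmonic_lin (a b : R) (f g : 'rV[R]_n -> R) :
  Hharmonic f -> Hharmonic g -> Hharmonic (fun x => a * f x + b * g x).
Proof.
move=> [Cf Lf] [Cg Lg].
have dlin (F G : 'rV[R]_n -> R) x v : derivable F x v -> derivable G x v ->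
    is_derive x v (fun y => a * F y + b * G y) (a * 'D_v F x + b * 'D_v G x).
  move=> dF dG; exact: (is_derive_add (is_derive_scale a (derivableP dF))
    (is_derive_scale b (derivableP dG))).
have P1 x i : oball R n x -> partial i (fun x => a * f x + b * g x) x =
    a * partial i f x + b * partial i g x.
  move=> xB; have [df _ _] := Cf x xB i i; have [dg _ _] := Cg x xB i i.
  by have [_ H] := dlin _ _ _ _ df dg; exact: H.
have P2 x i j : oball R n x -> is_derive x (e j)
    (partial i (fun x => a * f x + b * g x))
    (a * partial j (partial i f) x + b * partial j (partial i g) x).
  move=> xB; have [_ df _] := Cf x xB i j; have [_ dg _] := Cg x xB i j.
  apply: near_eq_is_derive (dlin _ _ _ _ df dg).
  by apply: near_oball xB _ => y yB; rewrite P1.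
have P3 x i j : oball R n x -> partial j (partial i (fun x => a * f x + b * g x)) x =
    a * partial j (partial i f) x + b * partial j (partial i g) x.
  by move=> xB; have [_ H] := P2 x i j xB; exact: H.
split.
  move=> x xB i j; have [df1 df2 df3] := Cf x xB i j; have [dg1 dg2 dg3] := Cg x xB i j.
  split.
  - by have [] := dlin _ _ _ _ df1 dg1.
  - by have [] := P2 x i j xB.
  have E : \forall y \near x, a * partial j (partial i f) y + b * partial j (partial i g) y =
      partial j (partial i (fun x => a * f x + b * g x)) y.
    by apply: near_oball xB _ => y yB; rewrite P3.
  apply: (near_eq_continuous E).
  exact: (continuousD (continuousM (@cst_continuous _ _ a x) df3)
    (continuousM (@cst_continuous _ _ b x) dg3)).
move=> x xB; transitivity (a * hlaplacian f x + b * hlaplacian g x); last first.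
  by rewrite Lf// Lg// !mulr0 addr0.
have E1 : laplacian (fun x => a * f x + b * g x) x = a * laplacian f x + b * laplacian g x.
  rewrite /laplacian !mulr_sumr -big_split/=; apply: eq_bigr => i _.
  by rewrite P3.
have E2 : \sum_(i < n) x 0 i * partial i (fun x => a * f x + b * g x) x =
    a * (\sum_(i < n) x 0 i * partial i f x) + b * (\sum_(i < n) x 0 i * partial i g x).
  by rewrite !mulr_sumr -big_split/=; apply: eq_bigr => i _; rewrite P1//; ring.
by rewrite /hlaplacian E1 E2; ring.
Qed.

End calculus.

(** * Mean values on the sphere *)

Section lebesgue_shear.
Context {R : realType}.
Let T := measurableTypeR R.
Local Open Scope ereal_scope.

Lemma lebesgue_measure_shift (c : R) (A : set T) : measurable A ->
  lebesgue_measure ((fun x : T => (x + c)%R) @^-1` A) = lebesgue_measure A.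
Proof.
move=> mA.
have mf : measurable_fun setT (fun x : T => (x + c)%R : T).
  exact: measurable_funD.
pose m := measure_function_pushforward__canonical__measure_function_Measure
  (@lebesgue_measure R) mf.
rewrite -[LHS]/(m A); apply/esym/lebesgue_measure_unique => // _ [[a b]] _ <-.
rewrite /= /pushforward.
have -> : ((fun x : T => (x + c)%R) @^-1` `]a, b]%classic) =
    `](a - c)%R, (b - c)%R]%classic :> set T.
  by apply/seteqP; split => x /=; rewrite !in_itv/= ltrBlDr lerBrDr.
rewrite !lebesgue_measure_itv/= !lte_fin ltrD2r.
by case: ifP => // _; rewrite -!EFinD opprB addrA subrK.
Qed.

(** For fixed second coordinate the shear is a translation. The real coordinate has to be integrated
    first, hence the passage to the product in the other order. *)
Lemma product_measure_shear d (T' : measurableType d)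
    (mu : {sigma_finite_measure set T' -> \bar R}) (v : T' -> T)
    (A : set (T * T')) :
  measurable_fun setT v -> measurable A ->
  (@lebesgue_measure R \x mu) ((fun p => ((p.1 + v p.2)%R, p.2)) @^-1` A) =
  (@lebesgue_measure R \x mu) A.
Proof.
move=> mv mA.
have mf : measurable_fun setT
    (fun p : T * T' => ((p.1 + v p.2)%R : T, p.2)).
  apply/measurable_fun_pairP; split => //=.
    by apply: measurable_funD => //; exact: measurableT_comp mv _.
  exact: measurable_snd.
have E (B : set (T * T')) : measurable B ->
    (@lebesgue_measure R \x mu) B = (@lebesgue_measure R \x^ mu) B.
  by move=> mB; apply: product_measure_unique => // ? ? ? ?;
    rewrite /= product_measure2E.
have mfA : measurable ((fun p : T * T' => ((p.1 + v p.2)%R : T, p.2)) @^-1` A).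
  by rewrite -[X in measurable X]setTI; exact: mf.
rewrite !E//; apply: eq_integral => s _ /=.
rewrite -[RHS](lebesgue_measure_shift (v s)); last exact: measurable_ysection.
by congr (lebesgue_measure _).
Qed.

Lemma product_measure_fiber d (T' : measurableType d)
    (mu : {sigma_finite_measure set T' -> \bar R}) (g : T -> T' -> T')
    (A : set (T * T')) :
  (forall x B, measurable B -> mu (g x @^-1` B) = mu B) -> measurable A ->
  (@lebesgue_measure R \x mu) ((fun p => (p.1, g p.1 p.2)) @^-1` A) =
  (@lebesgue_measure R \x mu) A.
Proof.
move=> mug mA; apply: eq_integral => x _ /=.
rewrite -[RHS](mug x); last exact: measurable_xsection.
by congr (mu _); apply/seteqP; split => y; rewrite /xsection/= !inE.
Qed.

Definition addcoord n (i : 'I_n) (v : R) (t : n.-tuple T) : n.-tuple T :=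
  [tuple (tnth t k + (if k == i then v else 0))%R | k < n].

Lemma addcoord_cons n (i : 'I_n) v (p : T * n.-tuple T) :
  addcoord (lift ord0 i) v (cons_pair p) = cons_pair (p.1, addcoord i v p.2).
Proof.
apply: eq_from_tnth => k; rewrite tnth_mktuple.
have [j ->|->] := unliftP ord0 k; last by rewrite !tnth0 /= addr0.
by rewrite !tnthS tnth_mktuple (inj_eq lift_inj).
Qed.

Lemma addcoord0_cons n v (p : T * n.-tuple T) :
  addcoord ord0 v (cons_pair p) = cons_pair ((p.1 + v)%R, p.2).
Proof.
apply: eq_from_tnth => k; rewrite tnth_mktuple.
have [j ->|->] := unliftP ord0 k; last by rewrite !tnth0.
by rewrite !tnthS /= addr0.
Qed.

Lemma measurable_addcoord n (i : 'I_n) (f : n.-tuple T -> R) :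
  measurable_fun setT f -> measurable_fun setT (fun t => addcoord i (f t) t).
Proof.
move=> mf; apply/measurable_fun_tnthP => k; rewrite /comp/=.
under eq_fun do rewrite tnth_mktuple.
apply: measurable_funD; first exact: measurable_tnth.
by case: (k == i); [exact: mf | exact: measurable_cst].
Qed.

Lemma lebesgueT_addcoord n (i : 'I_n) v (A : set (n.-tuple T)) :
  measurable A -> lebesgueT n (addcoord i v @^-1` A) = lebesgueT n A.
Proof.
elim: n i v A => [|n IH] i v A mA; first by case: i.
have mA' : measurable (@cons_pair R n @^-1` A).
  by rewrite -[X in measurable X]setTI; apply: measurable_cons_pair.
rewrite -[LHS]/((_ \x lebesgueT n) (@cons_pair R n @^-1` (addcoord i v @^-1` A))).
rewrite -[RHS]/((_ \x lebesgueT n) (@cons_pair R n @^-1` A)).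
have [j ->|->] := unliftP ord0 i.
  rewrite -(product_measure_fiber (fun _ B mB => IH j v B mB) mA').
  congr (product_measure1 _ _ _); apply/seteqP.
  by split => p /=; rewrite addcoord_cons.
rewrite -(product_measure_shear _ (@measurable_cst _ _ _ _ setT v) mA').
congr (product_measure1 _ _ _); apply/seteqP.
by split => p /=; rewrite addcoord0_cons.
Qed.

Definition shear_head n (j : 'I_n) (c : R) (t : n.+1.-tuple T) :=
  addcoord ord0 (c * tnth t (lift ord0 j)) t.

Definition shear_tail n (j : 'I_n) (c : R) (t : n.+1.-tuple T) :=
  addcoord (lift ord0 j) (c * tnth t ord0) t.

Lemma lebesgueT_shear_head n (j : 'I_n) c (A : set (n.+1.-tuple T)) :
  measurable A -> lebesgueT n.+1 (shear_head j c @^-1` A) = lebesgueT n.+1 A.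
Proof.
move=> mA; have mA' : measurable (@cons_pair R n @^-1` A).
  by rewrite -[X in measurable X]setTI; apply: measurable_cons_pair.
rewrite -[LHS]/((_ \x lebesgueT n) (@cons_pair R n @^-1` (shear_head j c @^-1` A))).
rewrite -[RHS]/((_ \x lebesgueT n) (@cons_pair R n @^-1` A)).
have mv : measurable_fun setT (fun s : n.-tuple T => (c * tnth s j)%R : T).
  by apply: measurable_funM => //; exact: measurable_tnth.
rewrite -(product_measure_shear _ mv mA').
congr (product_measure1 _ _ _); apply/seteqP.
by split => p /=; rewrite /shear_head addcoord0_cons tnthS.
Qed.

Lemma lebesgueT_shear_tail n (j : 'I_n) c (A : set (n.+1.-tuple T)) :
  measurable A -> lebesgueT n.+1 (shear_tail j c @^-1` A) = lebesgueT n.+1 A.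
Proof.
move=> mA; have mA' : measurable (@cons_pair R n @^-1` A).
  by rewrite -[X in measurable X]setTI; apply: measurable_cons_pair.
rewrite -[LHS]/((_ \x lebesgueT n) (@cons_pair R n @^-1` (shear_tail j c @^-1` A))).
rewrite -[RHS]/((_ \x lebesgueT n) (@cons_pair R n @^-1` A)).
rewrite -(product_measure_fiber
  (fun x B mB => lebesgueT_addcoord j (c * x)%R mB) mA').
congr (product_measure1 _ _ _); apply/seteqP.
by split => p /=; rewrite /shear_tail addcoord_cons tnth0.
Qed.

Lemma measurable_shear_head n (j : 'I_n) c :
  measurable_fun setT (shear_head j c).
Proof.
apply: measurable_addcoord; apply: measurable_funM => //.
exact: measurable_tnth.
Qed.

Lemma measurable_shear_tail n (j : 'I_n) c :
  measurable_fun setT (shear_tail j c).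
Proof.
apply: measurable_addcoord; apply: measurable_funM => //.
exact: measurable_tnth.
Qed.

End lebesgue_shear.

(** * Invariance of the surface measure under plane rotations *)

Section rotation.
Context {R : realType}.
Let T := measurableTypeR R.
Variables (n : nat) (j : 'I_n).

(** Rational parametrization of the rotations: [u] is the tangent of half the angle. *)
Definition plane_rot (u : R) (t : n.+1.-tuple T) : n.+1.-tuple T :=
  let c := (1 - u ^+ 2) / (1 + u ^+ 2) in
  let s := 2 * u / (1 + u ^+ 2) in
  let x := tnth t ord0 in let y := tnth t (lift ord0 j) in
  [tuple if k == ord0 then c * x - s * y
         else if k == lift ord0 j then s * x + c * y else tnth t k | k < n.+1].

(** Three shears, with coefficients minus tangent of the half angle, sine of the angle, minus
    tangent of the half angle; each preserves Lebesgue measure by Fubini. *)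
Lemma plane_rotE u t : plane_rot u t =
  shear_head j (- u)
    (shear_tail j (2 * u / (1 + u ^+ 2)) (shear_head j (- u) t)).
Proof.
have u1 : 1 + u ^+ 2 != 0 by rewrite gt_eqF// ltr_wpDr// sqr_ge0.
apply: eq_from_tnth => k; rewrite !tnth_mktuple !eqxx/=.
have [-> | k0] := eqVneq k ord0; first by rewrite (negbTE (neq_lift _ _)); field.
by have [-> | kj] := eqVneq k (lift ord0 j); rewrite ?addr0//; field.
Qed.

Lemma sqnorm_plane_rot u t :
  sqnorm (row_of_tuple (plane_rot u t)) = sqnorm (row_of_tuple t).
Proof.
have u1 : 1 + u ^+ 2 != 0 by rewrite gt_eqF// ltr_wpDr// sqr_ge0.
rewrite /sqnorm /dotp !big_ord_recl (bigD1 j)//= [in RHS](bigD1 j)//=.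
rewrite !mxE !tnth_mktuple !eqxx/=.
under eq_bigr => k kj do
  rewrite !mxE !tnth_mktuple/= (inj_eq (@lift_inj _ ord0)) (negbTE kj).
under [in RHS]eq_bigr => k kj do rewrite !mxE.
by rewrite !addrA; congr (_ + _); field.
Qed.

Lemma normalize_plane_rot u t :
  normalize (plane_rot u t) = plane_rot u (normalize t).
Proof.
apply: eq_from_tnth => k; rewrite !tnth_mktuple sqnorm_plane_rot.
by case: ifP => _; [|case: ifP => _ //]; rewrite ?mulrBr ?mulrDr !(mulrCA _^-1).
Qed.

Lemma measurable_plane_rot u : measurable_fun setT (plane_rot u).
Proof.
have -> : plane_rot u = shear_head j (- u) \o
    (shear_tail j (2 * u / (1 + u ^+ 2)) \o shear_head j (- u)).
  by apply/funext => t; exact: plane_rotE.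
exact: (measurableT_comp (measurable_shear_head j (- u))
  (measurableT_comp (measurable_shear_tail j (2 * u / (1 + u ^+ 2)))
    (measurable_shear_head j (- u)))).
Qed.

Lemma lebesgueT_plane_rot u (A : set (n.+1.-tuple T)) : measurable A ->
  lebesgueT n.+1 (plane_rot u @^-1` A) = lebesgueT n.+1 A.
Proof.
move=> mA.
rewrite -(lebesgueT_shear_head j (- u) mA).
have mB : measurable (shear_head j (- u) @^-1` A).
  by rewrite -[X in measurable X]setTI; exact: measurable_shear_head.
rewrite -(lebesgueT_shear_tail j (2 * u / (1 + u ^+ 2)) mB).
rewrite -[RHS](lebesgueT_shear_head j (- u)).
  congr (lebesgueT _ _); apply/seteqP.
  by split => t /=; rewrite plane_rotE.
by rewrite -[X in measurable X]setTI; exact: measurable_shear_tail.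
Qed.

Lemma sphere_measure_plane_rot u (A : set (n.+1.-tuple T)) : measurable A ->
  sphere_measure R n.+1 (plane_rot u @^-1` A) = sphere_measure R n.+1 A.
Proof.
move=> mA; rewrite /sphere_measure; congr (_ * _)%E.
rewrite -[RHS](lebesgueT_plane_rot u); last first.
  apply: measurableI; first exact: measurable_tball.
  by rewrite -[X in measurable X]setTI; exact: measurable_normalize.
congr (lebesgueT _ _); apply/seteqP.
by split => t; rewrite /tball/oball/= sqnorm_plane_rot normalize_plane_rot.
Qed.

End rotation.

(** * Volumes of cubes, for bounding the measures of the ball and the sphere *)

Section box.
Context {R : realType}.
Let T := measurableTypeR R.
Implicit Types a b : R.

Definition box n a b : set (n.-tuple T) :=
  [set t | forall i, a < tnth t i <= b].
Arguments box : clear implicits.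

Lemma measurable_box n a b : measurable (box n a b).
Proof.
rewrite (_ : box n a b =
    \bigcap_(i in [set: 'I_n]) ((@tnth n T ^~ i) @^-1` `]a, b]%classic)).
  apply: fin_bigcap_measurable => // i _.
  by rewrite -[X in measurable X]setTI; exact: measurable_tnth.
apply/seteqP; split => [t ht i _|t ht i].
  by rewrite /= in_itv/=; exact: ht.
by have := ht i I; rewrite /= in_itv.
Qed.

Lemma lebesgueT_box n a b : a <= b ->
  lebesgueT n (box n a b) = ((b - a) ^+ n)%:E.
Proof.
move=> ab; elim: n => [|n IH].
  rewrite /= diracE mem_set ?expr0// => -[]//.
rewrite -[LHS]/((_ \x lebesgueT n)%E (@cons_pair R n @^-1` box n.+1 a b)).
have -> : @cons_pair R n @^-1` box n.+1 a b = `]a, b]%classic `*` box n a b.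
  apply/seteqP; split => [p h|p [h1 h2] i].
    split => [|i]; first by rewrite /= in_itv/=; have := h ord0; rewrite tnth0.
    by have := h (lift ord0 i); rewrite tnthS.
  have [k ->|->] := unliftP ord0 i; first by rewrite tnthS; exact: h2.
  by move: h1; rewrite tnth0 /= in_itv.
transitivity (@lebesgue_measure R `]a, b]%classic * lebesgueT n (box n a b))%E.
  by apply: product_measure1E => //; exact: measurable_box.
rewrite lebesgue_measure_itv/= lte_fin [X in (_ * X)%E]IH exprS EFinM -EFinB.
case: ltP => // ba; have -> : b = a by apply/eqP; rewrite eq_le ab ba.
by rewrite subrr !mul0e.
Qed.

End box.
Arguments box {R} n a b.

(** * Means of bounded functions on the sphere *)

Section sphere_mean.
Context {R : realType} (n : nat).
Let T := measurableTypeR R.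
Let D : set (n.+1.-tuple T) := row_of_tuple @^-1` sphere R n.+1.
Let sigma := sphere_measure R n.+1.
Implicit Types f g : n.+1.-tuple T -> R.

Lemma measurable_sqnorm_tuple m :
  measurable_fun setT (fun t : m.-tuple T => sqnorm (row_of_tuple t)).
Proof.
apply: measurable_sum => i; under eq_fun do rewrite mxE.
by apply: measurable_funM; exact: measurable_tnth.
Qed.

Lemma measurable_sphere : measurable D.
Proof.
rewrite -[X in measurable X]setTI.
rewrite (_ : D = (fun t => sqnorm (row_of_tuple t)) @^-1` [set 1]).
  exact: measurable_sqnorm_tuple.
by apply/seteqP; split.
Qed.

Lemma sqnorm_tuple m (t : m.-tuple T) :
  sqnorm (row_of_tuple t) = \sum_(i < m) tnth t i ^+ 2.
Proof. by apply: eq_bigr => i _; rewrite !mxE expr2. Qed.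

Lemma norm_coord_sphere (t : n.+1.-tuple T) i :
  D t -> `|tnth t i| <= 1.
Proof.
rewrite /D/sphere/= sqnorm_tuple (bigD1 i)//= => t1.
have : 0 <= \sum_(k < n.+1 | k != i) tnth t k ^+ 2.
  by apply: sumr_ge0 => k _; exact: sqr_ge0.
by move=> ?; rewrite ler_norml; apply/andP; split; nra.
Qed.

Lemma lebesgueT_tball_lty m : (lebesgueT m (@tball R m) < +oo)%E.
Proof.
have h : @tball R m `<=` box m (-2) 2.
  move=> t tb i.
  have : tnth t i ^+ 2 < 1.
    apply: le_lt_trans tb; rewrite sqnorm_tuple (bigD1 i)//= lerDl.
    by apply: sumr_ge0 => k _; exact: sqr_ge0.
  by move=> ?; apply/andP; split; nra.
apply: (le_lt_trans (le_measure (lebesgueT m) _ _ h)); rewrite ?inE.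
- exact: measurable_tball.
- exact: measurable_box.
- by rewrite [ltLHS]lebesgueT_box ?ltry//; lra.
Qed.

Lemma sphere_measure_gt0 : (0 < sigma D)%E.
Proof.
(* Since [(n+1) e^2 < 1], the cube with sides []e/2, e]] lies in the ball; it avoids the origin,
   which [normalize] does not send to the sphere. *)
pose e : R := (n.+2%:R)^-1.
have e0 : 0 < e by rewrite invr_gt0.
have hb : box n.+1 (e / 2) e `<=` @tball R n.+1 `&` @normalize R n.+1 @^-1` D.
  move=> t bt; have tx i : e / 2 < tnth t i <= e by exact: bt.
  have s0 : 0 < sqnorm (row_of_tuple t).
    rewrite sqnorm_tuple big_ord_recl ltr_pwDl//.
      by rewrite exprn_gt0//; have := tx ord0; lra.
    by apply: sumr_ge0 => k _; exact: sqr_ge0.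
  split.
    rewrite /tball/oball/= sqnorm_tuple.
    apply: (@le_lt_trans _ _ (\sum_(i < n.+1) e ^+ 2)).
      apply: ler_sum => i _; rewrite lerXn2r ?nnegrE//; have := tx i; lra.
    rewrite sumr_const card_ord -[ltLHS]mulr_natl expr2 mulrA.
    have e1 : n.+1%:R * e < 1 by rewrite ltr_pdivrMr// mul1r ltr_nat.
    have e2 : e <= 1 by rewrite invf_le1// ler1n.
    have : 0 <= n.+1%:R * e by rewrite mulr_ge0// ltW.
    nra.
  rewrite /D/sphere/= sqnorm_tuple.
  under eq_bigr do rewrite tnth_mktuple exprMn.
  rewrite -mulr_sumr -sqnorm_tuple exprVn sqr_sqrtr ?ltW//.
  by rewrite mulVf// gt_eqF.
have mE : measurable (@tball R n.+1 `&` @normalize R n.+1 @^-1` D).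
  apply: measurableI; first exact: measurable_tball.
  rewrite -[X in measurable X]setTI; apply: measurable_normalize => //.
  exact: measurable_sphere.
have h1 : (0 < lebesgueT n.+1 (@tball R n.+1 `&` @normalize R n.+1 @^-1` D))%E.
  apply: lt_le_trans (le_measure (lebesgueT n.+1) _ _ hb); rewrite ?inE//.
    by rewrite [ltRHS]lebesgueT_box ?lte_fin ?exprn_gt0//; lra.
  exact: measurable_box.
have h2 : (0 < lebesgueT n.+1 (@tball R n.+1))%E.
  apply: lt_le_trans h1 _; apply: le_measure; rewrite ?inE//.
  exact: measurable_tball.
(* Finiteness of the volume of the ball matters: [fine] would send an infinite volume to 0. *)
apply: mule_gt0 => //; rewrite lte_fin invr_gt0 fine_gt0// h2/=.
exact: lebesgueT_tball_lty.
Qed.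

Lemma sphere_measure_lty : (sigma D < +oo)%E.
Proof.
apply: lte_mul_pinfty => //; first by rewrite lee_fin invr_ge0 fine_ge0.
apply: le_lt_trans (lebesgueT_tball_lty n.+1); apply: le_measure; rewrite ?inE.
- apply: measurableI; first exact: measurable_tball.
  rewrite -[X in measurable X]setTI; apply: measurable_normalize => //.
  exact: measurable_sphere.
- exact: measurable_tball.
- by move=> t [].
Qed.

Definition smean f := \int[sigma]_(t in D) f t.

Definition sphere_bounded f :=
  measurable_fun setT f /\ exists K, forall t, D t -> `|f t| <= K.

Lemma sphere_bounded_integrable f :
  sphere_bounded f -> sigma.-integrable D (EFin \o f).
Proof.
move=> [mf [K fK]]; apply: measurable_bounded_integrable.
- exact: measurable_sphere.
- exact: sphere_measure_lty.
- exact: measurable_funTS.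
- exists K; split => [|k Kk t Dt]; first exact: num_real.
  exact: le_trans (fK t Dt) (ltW Kk).
Qed.

Lemma sphere_bounded_cst c : sphere_bounded (fun=> c).
Proof. by split; [exact: measurable_cst|exists `|c|]. Qed.

Lemma sphere_bounded_coord i : sphere_bounded (fun t => tnth t i).
Proof.
by split; [exact: measurable_tnth|exists 1 => t; exact: norm_coord_sphere].
Qed.

Lemma sphere_boundedD f g : sphere_bounded f -> sphere_bounded g ->
  sphere_bounded (fun t => f t + g t).
Proof.
move=> [mf [K fK]] [mg [L gL]]; split; first exact: measurable_funD.
by exists (K + L) => t Dt; rewrite (le_trans (ler_normD _ _))// lerD ?fK ?gL.
Qed.

Lemma sphere_boundedM f g : sphere_bounded f -> sphere_bounded g ->
  sphere_bounded (fun t => f t * g t).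
Proof.
move=> [mf [K fK]] [mg [L gL]]; split; first exact: measurable_funM.
by exists (K * L) => t Dt; rewrite normrM ler_pM ?fK ?gL.
Qed.

Lemma sphere_boundedX f k : sphere_bounded f ->
  sphere_bounded (fun t => f t ^+ k).
Proof.
move=> bf; elim: k => [|k IH]; first exact: sphere_bounded_cst.
by under eq_fun do rewrite exprS; exact: sphere_boundedM.
Qed.

Lemma smeanD f g : sphere_bounded f -> sphere_bounded g ->
  smean (fun t => f t + g t) = smean f + smean g.
Proof.
move=> bf bg; rewrite /smean RintegralD//; first exact: measurable_sphere.
all: exact: sphere_bounded_integrable.
Qed.

Lemma smeanZ c f : sphere_bounded f -> smean (fun t => c * f t) = c * smean f.
Proof.
move=> bf; rewrite /smean RintegralZl//; first exact: measurable_sphere.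
exact: sphere_bounded_integrable.
Qed.

Lemma eq_smean f g : (forall t, D t -> f t = g t) -> smean f = smean g.
Proof. by move=> fg; apply: eq_Rintegral => t; rewrite inE; exact: fg. Qed.

Lemma smean1_gt0 : 0 < smean (fun=> 1).
Proof.
rewrite /smean Rintegral_cst ?mul1r; last exact: measurable_sphere.
by rewrite fine_gt0// sphere_measure_gt0 sphere_measure_lty.
Qed.

Lemma le_norm_smean f K : sphere_bounded f -> (forall t, D t -> `|f t| <= K) ->
  `|smean f| <= K * smean (fun=> 1).
Proof.
move=> bf fK; rewrite -smeanZ; last exact: sphere_bounded_cst.
apply: le_trans (le_normr_Rintegral _ _) _.
- exact: measurable_sphere.
- exact: sphere_bounded_integrable.
apply: le_Rintegral => [||//|t Dt].
- exact: measurable_sphere.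
- have [mf [L fL]] := bf; apply: sphere_bounded_integrable.
  split; first exact: measurableT_comp.
  by exists L => t Dt; rewrite normr_id fL.
- by apply: sphere_bounded_integrable; apply: sphere_boundedM;
    exact: sphere_bounded_cst.
- by rewrite mulr1 fK.
Qed.

Lemma sphere_bounded_rot (j : 'I_n) u f :
  sphere_bounded f -> sphere_bounded (fun t => f (plane_rot j u t)).
Proof.
move=> [mf [K fK]]; split.
  exact: (measurableT_comp mf (measurable_plane_rot j u)).
by exists K => t Dt; apply: fK; rewrite /D/sphere/= sqnorm_plane_rot.
Qed.

Lemma smean_rot (j : 'I_n) u f :
  sphere_bounded f -> smean (fun t => f (plane_rot j u t)) = smean f.
Proof.
move=> bf; have rD : plane_rot j u @^-1` D = D.
  by apply/seteqP; split => t; rewrite /D/sphere/= sqnorm_plane_rot.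
have bfr := sphere_bounded_rot j u bf.
rewrite /smean /Rintegral; congr fine.
transitivity (\int[pushforward sigma (plane_rot j u)]_(t in D) (f t)%:E)%E.
  rewrite (@integral_pushforward _ _ _ _ _ _ (measurable_plane_rot j u) sigma).
  - by rewrite rD.
  - by apply/measurable_EFinP; case: bf.
  - by rewrite rD; exact: sphere_bounded_integrable bfr.
  - exact: measurable_sphere.
apply: eq_measure_integral => [|mf A mA _]; first exact: measurable_plane_rot.
exact: sphere_measure_plane_rot.
Qed.
End sphere_mean.

Lemma le_eq d (T : porderType d) (x y : T) : x = y -> (x <= y)%O.
Proof. by move=> ->. Qed.

(** * First-order expansions with a uniform quadratic remainder *)

Section jets.
Context {R : realFieldType}.
Implicit Types (F G : R -> R) (a b K L : R).

(** A single constant controls the value, the derivative and the remainder; when it is the same for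
    all points of the sphere, the expansion can be integrated over the sphere. *)
Definition jet F a a' K :=
  [/\ `|a| <= K, `|a'| <= K &
      forall u, `|u| <= 1 -> `|F u - (a + u * a')| <= K * u ^+ 2].

(** The constant is 6 = 1 + 3 + 2: the term [u^2 a' b'], the remainder of [F] times [G] (at most
    [3 L]), the remainder of [G] times the linear part of [F] (at most [2 K]). *)
Lemma jetM F G a a' b b' K L : jet F a a' K -> jet G b b' L ->
  jet (fun u => F u * G u) (a * b) (a * b' + a' * b) (6 * (K * L)).
Proof.
move=> [aK a'K FK] [bL b'L GL].
have K0 : 0 <= K by exact: le_trans aK.
have L0 : 0 <= L by exact: le_trans bL.
have KL0 : 0 <= K * L by exact: mulr_ge0.
have nM x y : `|x| <= K -> `|y| <= L -> `|x * y| <= K * L.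
  by move=> xK yL; rewrite normrM ler_pM.
split.
- by apply: le_trans (nM _ _ aK bL) _; rewrite ler_peMl// ler1n.
- apply: le_trans (ler_normD _ _) _.
  have := nM _ _ aK b'L; have := nM _ _ a'K bL; lra.
move=> u u1; have {FK} := FK u u1; have {GL} := GL u u1.
set r := F u - _; set s := G u - _ => sL rK.
have -> : F u * G u - (a * b + u * (a * b' + a' * b)) =
    u ^+ 2 * (a' * b') + r * (b + u * b' + s) + s * (a + u * a').
  by rewrite /r /s; ring.
have u2 : u ^+ 2 <= 1 by rewrite -real_normK ?num_real// expr_le1.
have uM x M : `|x| <= M -> `|u * x| <= M.
  by move=> xM; rewrite normrM -[M]mul1r ler_pM.
have h1 : `|b + u * b' + s| <= 3 * L.
  apply: le_trans (ler_normD _ _) _.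
  have := ler_normD b (u * b'); have := uM _ _ b'L.
  have : L * u ^+ 2 <= L by rewrite ler_piMr.
  lra.
have h2 : `|a + u * a'| <= 2 * K.
  apply: le_trans (ler_normD _ _) _; have := uM _ _ a'K; lra.
apply: le_trans (ler_normD _ _) _.
apply: (@le_trans _ _ (u ^+ 2 * (K * L) + K * u ^+ 2 * (3 * L)
   + L * u ^+ 2 * (2 * K))); last by lra.
apply: lerD; last by rewrite normrM ler_pM.
apply: le_trans (ler_normD _ _) _.
apply: lerD; last by rewrite normrM ler_pM.
by rewrite normrM ger0_norm ?sqr_ge0// ler_wpM2l ?sqr_ge0// nM.
Qed.

(** [C] depends on [d] only, so the expansion is uniform over the sphere; 10 is the constant of
    [jet_rot]. *)
Lemma jetX d : exists2 C, 0 <= C &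
  forall F a a', jet F a a' 10 ->
    jet (fun u => F u ^+ d) (a ^+ d) (d%:R * a ^+ d.-1 * a') C.
Proof.
elim: d => [|d [C C0 IH]].
  exists 1 => // F a a' _; split; rewrite ?expr0 ?normr1// ?mul0r ?normr0//.
  by move=> u _; rewrite mulr0 addr0 subrr normr0 mul1r sqr_ge0.
exists (6 * (10 * C)); first lra.
move=> F a a' jF; have := jetM jF (IH _ _ _ jF).
have -> : a * (d%:R * a ^+ d.-1 * a') + a' * a ^+ d =
    d.+1%:R * a ^+ d.+1.-1 * a'.
  case: d {C C0 IH} => [|d]; first by rewrite expr0; ring.
  by rewrite /= exprS; ring.
rewrite -exprS; under eq_fun do rewrite -exprS; exact.
Qed.

End jets.

(** * Moments of the axis coordinate and orthogonality of the zonal polynomials *)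

Section moments.
Context {R : realType} (n : nat).
Let T := measurableTypeR R.
Implicit Types (t : n.+1.-tuple T).
Local Notation bd := (@sphere_bounded R n).
Local Notation E := (@smean R n).

(** The angle is [2 u] to first order, whence the factors 2. The remainder has the form
    [- 2 u^2 (a + u b) / (1 + u^2)], at most [4 u^2]; 10 is a round majorant. *)
Lemma jet_rot (x y : R) : `|x| <= 1 -> `|y| <= 1 ->
  jet (fun u => (1 - u ^+ 2) / (1 + u ^+ 2) * x - 2 * u / (1 + u ^+ 2) * y)
    x (- 2 * y) 10 /\
  jet (fun u => 2 * u / (1 + u ^+ 2) * x + (1 - u ^+ 2) / (1 + u ^+ 2) * y)
    y (2 * x) 10.
Proof.
move=> x1 y1.
have H (a b : R) u : `|u| <= 1 -> `|a| <= 1 -> `|b| <= 1 ->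
    `|((1 - u ^+ 2) / (1 + u ^+ 2) - 1) * a + (2 * u / (1 + u ^+ 2) - 2 * u) * b|
    <= 10 * u ^+ 2.
  move=> u1 a1 b1.
  have d1 : 1 + u ^+ 2 != 0 by rewrite gt_eqF// ltr_wpDr// sqr_ge0.
  have -> : ((1 - u ^+ 2) / (1 + u ^+ 2) - 1) * a +
      (2 * u / (1 + u ^+ 2) - 2 * u) * b =
      u ^+ 2 * ((1 + u ^+ 2)^-1 * (- 2 * (a + u * b))) by field.
  rewrite normrM ger0_norm ?sqr_ge0// mulrC ler_wpM2r ?sqr_ge0//.
  rewrite normrM ger0_norm ?invr_ge0 ?addr_ge0 ?sqr_ge0//.
  rewrite -[leRHS]mul1r ler_pM ?invr_ge0 ?addr_ge0 ?sqr_ge0//.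
    by rewrite invf_le1 ?ltr_wpDr ?sqr_ge0// lerDl sqr_ge0.
  have ub : `|u * b| <= 1 by rewrite normrM -[leRHS]mul1r ler_pM.
  rewrite normrM normrN [`|2|]ger0_norm//; have := ler_normD a (u * b).
  by move=> h; lra.
split; split => [||u u1]; rewrite ?normrM ?normrN ?[`|2|]ger0_norm//; try lra.
- apply: le_trans (H x (- y) u u1 x1 _); last by rewrite normrN.
  by apply: le_eq; congr (`|_|); ring.
- apply: le_trans (H y x u u1 y1 x1).
  by apply: le_eq; congr (`|_|); ring.
Qed.

(* First-order term at [u = 0] of the invariance of the mean of [x_0^d x_j]
   under the rotations of the plane [(0, j)]. *)
Lemma smean_moment_coord (j : 'I_n) d :
  d%:R * E (fun t => tnth t ord0 ^+ d.-1 * tnth t (lift ord0 j) ^+ 2) =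
  E (fun t => tnth t ord0 ^+ d.+1).
Proof.
pose x t := tnth t ord0; pose y t := tnth t (lift ord0 j).
pose f t := x t ^+ d * y t.
(* Half the derivative at [u = 0] of [f] along the rotation; its mean has to vanish. *)
pose q t := x t ^+ d.+1 + - d%:R * (x t ^+ d.-1 * y t ^+ 2).
have bx : bd x by exact: sphere_bounded_coord.
have by_ : bd y by exact: sphere_bounded_coord.
have bf : bd f by apply: sphere_boundedM => //; exact: sphere_boundedX.
have bxy : bd (fun t => x t ^+ d.-1 * y t ^+ 2).
  by apply: sphere_boundedM => //; exact: sphere_boundedX.
have bxd : bd (fun t => x t ^+ d.+1) by exact: sphere_boundedX.
have bZ c g : bd g -> bd (fun t => c * g t).
  by move=> bg; apply: sphere_boundedM => //; exact: sphere_bounded_cst.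
have bq : bd q by apply: sphere_boundedD => //; exact: bZ.
have [C C0 HC] := @jetX R d.
pose K := 6 * (C * 10).
have key u : `|u| <= 1 -> `|2 * u * E q| <= K * u ^+ 2 * E (fun=> 1).
  move=> u1.
  have bg : bd (fun t => f (plane_rot j u t) + (- 1 * f t + - (2 * u) * q t)).
    apply: sphere_boundedD; first exact: sphere_bounded_rot.
    by apply: sphere_boundedD; exact: bZ.
  have -> : 2 * u * E q =
      - E (fun t => f (plane_rot j u t) + (- 1 * f t + - (2 * u) * q t)).
    have lin (g1 g2 g3 : n.+1.-tuple T -> R) a b : bd g1 -> bd g2 -> bd g3 ->
        E (fun t => g1 t + (a * g2 t + b * g3 t)) = E g1 + (a * E g2 + b * E g3).
      move=> b1 b2 b3; rewrite smeanD//; last by apply: sphere_boundedD; exact: bZ.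
      by rewrite smeanD ?smeanZ//; exact: bZ.
    rewrite lin//; last exact: sphere_bounded_rot.
    by rewrite smean_rot//; ring.
  rewrite normrN; apply: le_norm_smean => // t Dt.
  have x1 : `|x t| <= 1 by exact: norm_coord_sphere.
  have y1 : `|y t| <= 1 by exact: norm_coord_sphere.
  have [jx jy] := jet_rot x1 y1.
  have [_ _ /(_ u u1)] := jetM (HC _ _ _ jx) jy.
  apply: le_trans; apply: le_eq; congr (`|_|).
  rewrite /f /q {1}/x {1}/y /plane_rot !tnth_mktuple eqxx.
  rewrite [lift ord0 j == ord0]eq_sym (negbTE (neq_lift _ _)) eqxx -/(x t) -/(y t).
  set A := (X in X ^+ d * _ + _); set B := A ^+ d; rewrite [x t ^+ d.+1]exprSr.
  by set X := x t ^+ d; set X1 := x t ^+ d.-1; set m := d%:R; ring.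
have q0 : E q = 0.
  apply/eqP; rewrite -normr_le0; apply/ler_addgt0Pl => e e0; rewrite addr0.
  have K0 : 0 <= K by rewrite !mulr_ge0.
  have KE : 0 <= K * E (fun=> 1) by apply: mulr_ge0 => //; rewrite ltW ?smean1_gt0.
  (* With this [u] the right-hand side of [key] is at most [u * e], and dividing by [u] bounds the
     mean of [q] by [e]. *)
  pose u := Num.min 1 (e / (K * E (fun=> 1) + 1)).
  have u0 : 0 < u by rewrite lt_min ltr01 divr_gt0//; lra.
  have u1 : `|u| <= 1 by rewrite gtr0_norm// ge_min lexx.
  have := key u u1; rewrite !normrM (gtr0_norm u0) [`|2|]ger0_norm//.
  have : u * (K * E (fun=> 1) + 1) <= e.
    by rewrite -ler_pdivlMr ?ge_min ?lexx ?orbT//; lra.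
  have := normr_ge0 (E q); nra.
move: q0; rewrite smeanD ?smeanZ//; last exact: bZ.
by move=> /eqP; rewrite mulNr subr_eq0 => /eqP.
Qed.

(** Sum of [smean_moment_coord] over the [n] other coordinates, whose squares add up to [1 - x_0^2]
    on the sphere. *)
Lemma smean_moment d :
  d%:R * E (fun t => tnth t ord0 ^+ d.-1 * (1 - tnth t ord0 ^+ 2)) =
  n%:R * E (fun t => tnth t ord0 ^+ d.+1).
Proof.
have bsum (s : seq 'I_n) (F : 'I_n -> n.+1.-tuple T -> R) :
    (forall j, bd (F j)) ->
    bd (fun t => \sum_(j <- s) F j t) /\
    E (fun t => \sum_(j <- s) F j t) = \sum_(j <- s) E (F j).
  move=> bF; elim: s => [|a s [IH1 IH2]].
    under eq_fun do rewrite big_nil; split; first exact: sphere_bounded_cst.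
    have -> : E (fun=> 0) = E (fun=> 0 * 1) by congr smean; apply/funext => t; rewrite mulr1.
    by rewrite big_nil smeanZ ?mul0r//; exact: sphere_bounded_cst.
  under eq_fun do rewrite big_cons.
  by split; [exact: sphere_boundedD|rewrite smeanD// IH2 big_cons].
have -> : E (fun t => tnth t ord0 ^+ d.-1 * (1 - tnth t ord0 ^+ 2)) =
    E (fun t => \sum_(j < n) tnth t ord0 ^+ d.-1 * tnth t (lift ord0 j) ^+ 2).
  apply: eq_smean => t; rewrite /sphere/= sqnorm_tuple big_ord_recl => <-.
  by rewrite addrC addKr mulr_sumr.
rewrite (proj2 (bsum _
  (fun j t => tnth t ord0 ^+ d.-1 * tnth t (lift ord0 j) ^+ 2) _)).
  rewrite mulr_sumr; under eq_bigr do rewrite smean_moment_coord.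
  by rewrite sumr_const card_ord mulr_natl.
by move=> j; apply: sphere_boundedM; apply: sphere_boundedX;
  exact: sphere_bounded_coord.
Qed.

Definition zmean (p : {poly R}) : R := E (fun t => p.[tnth t ord0]).

Lemma sphere_bounded_poly (p : {poly R}) : bd (fun t => p.[tnth t ord0]).
Proof.
elim/poly_ind: p => [|p c IH].
  by under eq_fun do rewrite horner0; exact: sphere_bounded_cst.
under eq_fun do rewrite hornerMXaddC.
apply: sphere_boundedD; last exact: sphere_bounded_cst.
by apply: sphere_boundedM => //; exact: sphere_bounded_coord.
Qed.

Lemma zmeanD p q : zmean (p + q) = zmean p + zmean q.
Proof.
rewrite /zmean -smeanD; try exact: sphere_bounded_poly.
by apply: eq_smean => t _; rewrite hornerD.
Qed.

Lemma zmeanZ c p : zmean (c *: p) = c * zmean p.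
Proof.
rewrite /zmean -smeanZ; last exact: sphere_bounded_poly.
by apply: eq_smean => t _; rewrite hornerZ.
Qed.

HB.instance Definition _ := GRing.isLinear.Build R {poly R} R _ zmean
  (fun c p q => etrans (zmeanD (c *: p) q) (congr1 (+%R^~ _) (zmeanZ c p))).

Lemma zmean1_gt0 : 0 < zmean 1.
Proof.
by rewrite /zmean; under eq_fun do rewrite hornerC; exact: smean1_gt0.
Qed.

(* Integration by parts for the weight [(1 - x^2)^((n-2)/2)] on [[-1, 1]]. *)
Lemma zmean_deriv (p : {poly R}) :
  zmean ((1 - 'X^2) * p^`()) = n%:R * zmean ('X * p).
Proof.
rewrite -[p]coefK poly_def !raddf_sum !mulr_sumr !raddf_sum mulr_sumr.
apply: eq_bigr => i _ /=; rewrite derivZ derivXn -!scalerAr !zmeanZ mulrCA.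
congr (_ * _); have := smean_moment i.
rewrite /zmean => h; rewrite -exprS.
under [in RHS]eq_fun do rewrite hornerXn.
rewrite -h -smeanZ.
  apply: eq_smean => t _; rewrite hornerM hornerMn !hornerE.
  by rewrite /= -[_ *+ i]mulr_natl mulrC.
apply: sphere_boundedM; first exact/sphere_boundedX/sphere_bounded_coord.
have := sphere_bounded_poly (1 - 'X^2).
by under eq_fun do rewrite !hornerE.
Qed.

Section gegenbauer.
Hypothesis n1 : (1 < n)%N.
Let n2 : (2 < n.+1)%N := n1.
Let b k : {poly R} := (zbeta n.+1 k)%:P.
Let Z k : {poly R} := zonal b 'X 1 k.

(** [zonal_flow] at [t = 1], where the field satisfies [dt = 0] and [dy = 2 (1 - y^2)]; the common
    factor 2 is removed at the end. *)
Lemma zonal_poly_deriv k :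
  (1 - 'X^2) * (Z k)^`() = zkappa n.+1 k *: Z k.-1 - k%:R *: ('X * Z k).
Proof.
have D : zonal_derivation b 'X 1 (1 + 1 - 2 * 'X ^+ 2) (2 * 'X * (1 - 1))
    (fun k => 2 * (1 - 'X^2) * (Z k)^`()).
  split; first by rewrite derivC mulr0.
    by rewrite derivX; ring.
  move=> m; rewrite /Z zonalSS mulr1 derivB !derivM derivX derivC.
  set z1 := zonal _ _ _ m.+1; set z0 := zonal _ _ _ m; ring.
have kE m : (zkappa n.+1 m.+1)%:P = b m.+1 * (n.+1%:R + 2 * m%:R).
  by rewrite zkappaE// [LHS]polyCM -/(b _) polyCD polyCM !polyC_natr.
have kS m : (zkappa n.+1 m.+2)%:P = 1 + b m.+1 * (n.+1%:R + 2 * m%:R - 2).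
  rewrite zkappaS// polyCD polyC1 [X in _ + X]polyCM -/(b _).
  by rewrite polyCB polyCD polyCM !polyC_natr.
have k0 : (zkappa n.+1 0)%:P = 0 :> {poly R} by rewrite zkappa0.
have k1 : (zkappa n.+1 1)%:P = 1 :> {poly R} by rewrite zkappa1.
have H := @zonal_flow _ b (fun m => (zkappa n.+1 m)%:P) n.+1%:R k0 k1 kE kS _ _ _ D k.
have {}H : 2%:P * ((1 - 'X^2) * (Z k)^`()) =
    2%:P * (zkappa n.+1 k *: Z k.-1 - k%:R *: ('X * Z k)).
  by rewrite polyC_natr mulrA H -!mul_polyC polyC_natr /Z; ring.
by move: H; rewrite !mul_polyC => /scalerI; apply; rewrite pnatr_eq0.
Qed.

Lemma zonal_polyX k : 'X * Z k.+1 = Z k.+2 + zbeta n.+1 k.+1 *: Z k.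
Proof. by rewrite /Z zonalSS mulr1 -mul_polyC -/(b k.+1) subrK. Qed.

(** [zmean_deriv] applied to [Z m.+1] becomes, through [zonal_poly_deriv] and [zonal_polyX], a
    two-step recursion whose coefficient [m] vanishes at [m = 0]. *)
Lemma zmean_zonal k : zmean (Z k.+1) = 0.
Proof.
have n0 : 0 < n%:R :> R by rewrite ltr0n ltnW.
have hX : zmean (Z 1) = 0.
  have := zmean_deriv (Z 0); rewrite /Z/= derivC mulr0 raddf0 mulr1 => /esym/eqP.
  by rewrite mulf_eq0 gt_eqF//= => /eqP.
suff: zmean (Z k.+1) = 0 /\ zmean (Z k.+2) = 0 by case.
have step m : (n%:R + m.+1%:R) * zmean (Z m.+2) =
    m%:R * zbeta n.+1 m.+1 * zmean (Z m).
  have := zmean_deriv (Z m.+1); rewrite zonal_poly_deriv zonal_polyX.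
  rewrite raddfB /= !zmeanZ !zmeanD !zmeanZ zkappaE// -!natr1 => e.
  by move: e => /eqP; rewrite -subr_eq0 => /eqP e; apply/eqP; rewrite -subr_eq0;
    apply/eqP; rewrite -[RHS]oppr0 -[in RHS]e; ring.
elim: k => [|k [IH1 IH2]].
  split=> //; have /eqP := step 0; rewrite !mul0r mulf_eq0 gt_eqF ?addr_gt0//=.
  by move/eqP.
split=> //; have /eqP := step k.+1; rewrite IH1 mulr0 mulf_eq0 gt_eqF ?addr_gt0//=.
by move/eqP.
Qed.

(** The recurrence moves one factor ['X] from the smaller index to the larger one; the induction
    ends at indices 0 and 1, where only means of single polynomials remain. *)
Lemma zmean_orth j k : (j < k)%N -> zmean (Z j * Z k) = 0.
Proof.
elim/ltn_ind: j k => -[|[|j]] IH [//|k] jk.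
- by rewrite [Z 0]/= mul1r zmean_zonal.
- case: k jk => // k _; rewrite [Z 1]/= zonal_polyX zmeanD zmeanZ !zmean_zonal.
  by rewrite mulr0 addr0.
have -> : Z j.+2 * Z k.+1 = Z j.+1 * Z k.+2 + zbeta n.+1 k.+1 *: (Z j.+1 * Z k)
    - zbeta n.+1 j.+1 *: (Z j * Z k.+1).
  rewrite [Z j.+2 in LHS](_ : _ = 'X * Z j.+1 - zbeta n.+1 j.+1 *: Z j); last first.
    by rewrite zonal_polyX addrK.
  by rewrite scalerAr -mulrDr -zonal_polyX mulrBl -scalerAl mulrAC mulrC.
rewrite raddfB /= zmeanD !zmeanZ (IH j.+1)// ?(IH j.+1)// ?(IH j)//.
- by rewrite !mulr0 add0r subr0.
- by rewrite ltnW// ltnW.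
- by apply: ltnW; apply: ltn_trans jk _.
Qed.

(** Moving one factor ['X] across the product leaves, besides the stated term, only products of
    distinct indices, which are orthogonal. *)
Lemma zmean_sqr k :
  zmean (Z k.+1 * Z k.+1) = zbeta n.+1 k.+1 * zmean (Z k * Z k).
Proof.
case: k => [|k].
  rewrite -[Z 1 * Z 1]/('X * Z 1) zonal_polyX zmeanD zmeanZ zmean_zonal.
  by rewrite add0r [Z 0]/= mulr1.
have -> : Z k.+2 * Z k.+2 = Z k.+1 * Z k.+3 +
    zbeta n.+1 k.+2 *: (Z k.+1 * Z k.+1) - zbeta n.+1 k.+1 *: (Z k * Z k.+2).
  rewrite [Z k.+2 in X in X * _](_ : _ = 'X * Z k.+1 - zbeta n.+1 k.+1 *: Z k).
    by rewrite mulrBl mulrAC zonal_polyX -!mul_polyC; ring.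
  by rewrite zonal_polyX addrK.
by rewrite raddfB /= zmeanD !zmeanZ !(zmean_orth (leqnSn _)) mulr0 subr0 add0r.
Qed.

Lemma zmean_sqr_gt0 k : 0 < zmean (Z k * Z k).
Proof.
elim: k => [|k IH]; first by rewrite mulr1 zmean1_gt0.
by rewrite zmean_sqr mulr_gt0// zbeta_gt0.
Qed.

End gegenbauer.
End moments.

(** * Zonal H-harmonic functions *)

Section zonal_in_space.
Context {R : realType} (n : nat) (i0 : 'I_n).
Hypothesis n2 : (2 < n)%N.
Implicit Types x : 'rV[R]_n.

Definition zspace k x : R := zfun n k (x 0 i0) (sqnorm x).

Lemma zspaceE k : zspace k = radial_times (radial n k) (ZonalMpoly.zmpoly i0 k).
Proof.
apply/funext => x; rewrite /zspace /zfun /radial_times /peval.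
by rewrite ZonalMpoly.meval_zmpoly.
Qed.

Lemma zspace_Hharmonic k : Hharmonic (zspace k).
Proof.
have d0 (t : R) := @is_derive_radial R n n2 k t.
have d1 (t : R) := @is_derive_dradial R n n2 k t.
have c2 (t : R) := @ddradial_continuous R n n2 k t.
rewrite zspaceE; split; first exact: (radial_times_C2 d0 d1 c2).
move=> x xB.
rewrite (hlaplacian_radial_times d0 d1 xB (ZonalMpoly.zmpoly_laplacian i0 n2 k)
  (ZonalMpoly.zmpoly_euler i0 k)).
by rewrite (radial_ode n2 k (sqnorm_lt1 xB)) mulr0.
Qed.

Lemma zspace_Hspace k (a : R) : Hspace k (fun x => a * zspace k x).
Proof.
split.
- rewrite zspaceE => x; apply: continuousM; first exact: cst_continuous.
  apply: continuousM.
    apply: (@radial_comp_continuous R n n2 _ _ (@sqnorm R n)).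
      exact: continuous_sqnorm.
    by move=> y; rewrite /cball/= ger0_norm ?sqnorm_ge0.
  by apply: continuous_subspaceT; exact: continuous_peval.
- have := Hharmonic_lin a 0 (zspace_Hharmonic k) (zspace_Hharmonic k).
  by congr Hharmonic; apply/funext => x; rewrite mul0r addr0.
exists ((a * radial n k 1) *: ZonalMpoly.zmpoly i0 k).
  split.
    by rewrite rpredZ//; exact: ZonalMpoly.zmpoly_homog.
  under eq_bigr do rewrite !mpoly.mderivZ.
  by rewrite -scaler_sumr ZonalMpoly.zmpoly_laplacian// scaler0.
move=> z; rewrite /sphere/= => z1.
by rewrite zspaceE /radial_times z1 mpoly.mevalZ mulrA.
Qed.

(** As [mobius 0] is the map [- x], composing with the sign change makes [boost 0] the identity, so
    that an expansion in small [s] is meaningful. The coefficient of the axis vector is tanh s. *)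
Definition boost (s : R) : 'rV[R]_n -> 'rV[R]_n :=
  mobius (((expR (2 * s) - 1) / (expR (2 * s) + 1)) *: delta_mx 0 i0) \o
  (fun x => x *m (-1)%:M).

Lemma boost_mobius s : mobius_group (boost s).
Proof.
have E0 : 0 < expR (2 * s) by exact: expR_gt0.
apply: mobius_comp; last first.
  apply: mobius_orth; rewrite tr_scalar_mx -scalar_mxM mulrNN mulr1//.
apply: mobius_gen; rewrite /oball/= /sqnorm /dotp (bigD1 i0)//= big1 ?addr0; last first.
  by move=> i ii; rewrite !mxE (negbTE ii) andbF mulr0n mulr0 mul0r.
rewrite !mxE !eqxx mulr1.
set E := expR _ in E0 *; rewrite -expr2 expr_div_n ltr_pdivrMr ?exprn_gt0 ?addr_gt0//.
by nra.
Qed.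

Lemma sqnorm_axis b c x : sqnorm (b *: delta_mx 0 i0 + c *: x) =
  b ^+ 2 + 2 * b * c * x 0 i0 + c ^+ 2 * sqnorm x.
Proof.
rewrite /sqnorm /dotp (bigD1 i0)//= [in RHS](bigD1 i0)//= !mxE !eqxx.
transitivity ((b + c * x 0 i0) ^+ 2 +
   c ^+ 2 * \sum_(i < n | i != i0) x 0 i * x 0 i); last by ring.
rewrite mulr1 expr2; congr (_ + _); rewrite mulr_sumr; apply: eq_bigr => i ii.
by rewrite !mxE (negbTE ii) andbF mulr0 add0r; ring.
Qed.

(** The image lies in the span of the axis and [x], and the denominator of [mobius] at [- x] is the
    [D] of [flow_mobius]. *)
Lemma boost_coords s x : oball R n x ->
  (boost s x) 0 i0 = flow_y (x 0 i0) (sqnorm x) s /\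
  sqnorm (boost s x) = flow_t (x 0 i0) (sqnorm x) s.
Proof.
move=> xB.
have yt : x 0 i0 ^+ 2 <= sqnorm x.
  rewrite /sqnorm /dotp (bigD1 i0)//= -expr2 lerDl.
  by apply: sumr_ge0 => i _; rewrite -expr2 sqr_ge0.
have [D0 -> ->] := flow_mobius yt xB s.
rewrite /boost /=; set h := _ / _ in D0 *; set D := (X in X != 0) in D0 *.
set a := h *: _.
have -> : x *m (-1)%:M = - x by rewrite mul_mx_scalar scaleN1r.
have dxa : dotp (- x) a = - (h * x 0 i0).
  rewrite /dotp (bigD1 i0)//= big1 ?addr0; last first.
    by move=> i ii; rewrite !mxE (negbTE ii) andbF !mulr0.
  by rewrite !mxE !eqxx mulr1 mulNr mulrC.
have aa : sqnorm a = h ^+ 2.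
  rewrite (_ : a = h *: delta_mx 0 i0 + 0 *: x); last by rewrite scale0r addr0.
  by rewrite sqnorm_axis; ring.
have xx : sqnorm (- x) = sqnorm x.
  rewrite (_ : - x = 0 *: delta_mx 0 i0 + (- 1) *: x); last first.
    by rewrite scale0r add0r scaleN1r.
  by rewrite sqnorm_axis; ring.
have sxa : sqnorm (- x - a) = h ^+ 2 + 2 * h * x 0 i0 + sqnorm x.
  rewrite (_ : - x - a = (- h) *: delta_mx 0 i0 + (- 1) *: x); last first.
    by rewrite addrC scaleNr scaleN1r.
  by rewrite sqnorm_axis; ring.
have bE : mobius a (- x) =
    (D^-1 * (sqnorm (- x - a) * h + (1 - h ^+ 2) * h)) *: delta_mx 0 i0 +
    (D^-1 * (1 - h ^+ 2)) *: x.
  rewrite /mobius dxa aa xx opprK /a.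
  have -> : 1 - 2 * - (h * x 0 i0) + sqnorm x * h ^+ 2 = D by rewrite /D; ring.
  by apply/rowP => j; rewrite !mxE; move: (D^-1) => Di; ring.
rewrite bE sqnorm_axis sxa !mxE !eqxx /= mulr1; set S := sqnorm x; set y := x 0 i0.
have [Di DiD DiE] : exists2 Di, Di * D = 1 & Di = D^-1.
  by exists D^-1 => //; rewrite mulVf.
rewrite -DiE; split; first by ring.
transitivity ((Di * D) * (Di * (h ^+ 2 + 2 * h * y + S))); last first.
  by rewrite DiD mul1r; ring.
by rewrite /D -/y -/S; ring.
Qed.

End zonal_in_space.

(** * Decomposition of a boosted pair of adjacent degrees *)

Section decompositions.
Context {R : realType} (n : nat) (i0 : 'I_n).
Hypothesis n2 : (2 < n)%N.
Let K : R := 2 * n%:R.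
Let K0 : 0 <= K. Proof. by rewrite mulr_ge0. Qed.

Definition pair_coef m (lam s : R) k : R :=
  flow_coef (zup n) (zkappa n) m s k + lam * flow_coef (zup n) (zkappa n) m.+1 s k.

Lemma decomposition_pair m lam s (phi : 'rV[R]_n -> R) :
  4 * (`|s| * rate K m.+1) <= 1 ->
  (forall x, oball R n x -> phi x =
     zfun n m (flow_y (x 0 i0) (sqnorm x) s) (flow_t (x 0 i0) (sqnorm x) s) +
     lam * zfun n m.+1 (flow_y (x 0 i0) (sqnorm x) s) (flow_t (x 0 i0) (sqnorm x) s)) ->
  decomposition phi (fun k x => pair_coef m lam s k * zspace i0 k x).
Proof.
move=> small phiE; split; first by move=> k; exact: zspace_Hspace.
have [C C0 HC] := @zfun_expansion R n n2.
have small' : 4 * (`|s| * rate K m) <= 1.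
  apply: le_trans small; rewrite ler_wpM2l// ler_wpM2l// /rate ler_wpM2l ?mulr_ge0//.
  by rewrite ler_nat.
move=> A _ AB; apply: uniform_cvg_dist => e e0.
pose M := C * 4 ^+ m + `|lam| * (C * 4 ^+ m.+1).
have M0 : 0 <= M by rewrite addr_ge0 ?mulr_ge0 ?exprn_ge0.
have [J J0 HJ] : exists2 J : nat, (0 < J)%N & M * (2 / J.+1%:R) <= e.
  have hb := archi_boundP (divr_ge0 (mulr_ge0 M0 (ler0n R 2)) (ltW e0)).
  exists (Num.bound (M * 2 / e)).+1 => //.
  rewrite mulrA ler_pdivrMr// [e * _]mulrC -ler_pdivrMr//.
  by apply: le_trans (ltW hb) _; rewrite ler_nat leqW.
(* From [J + 1 <= 2^J] one gets [(J+1)(J+2) <= 2 * 4^J], an explicit rate for the error of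
   [zfun_expansion]. *)
have decay (r : R) : 0 <= r -> 4 * r <= 1 -> (J%:R + 2) * r ^+ J <= 2 / J.+1%:R.
  move=> r0 r4; apply: (@le_trans _ _ ((J%:R + 2) * (4^-1) ^+ J)).
    have r4' : r <= 4^-1 by lra.
    by rewrite ler_wpM2l ?addr_ge0// lerXn2r ?nnegrE ?invr_ge0.
  rewrite exprVn ler_pdivrMr ?exprn_gt0// mulrAC ler_pdivlMr//.
  have h1 : J.+1%:R <= 2 ^+ J :> R by rewrite -natrX ler_nat ltn_expl.
  have -> : 4 ^+ J = 2 ^+ J * 2 ^+ J :> R by rewrite -exprMn -natrM.
  have : J.+1%:R * J.+1%:R <= 2 ^+ J * 2 ^+ J :> R by rewrite ler_pM.
  rewrite -[J.+1%:R]natr1; have : 1 <= J%:R :> R by rewrite ler1n.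
  by have : 1 <= 2 ^+ J * 2 ^+ J :> R by [rewrite -exprMn exprn_ege1// -natrM ler1n|]; nra.
exists (m.+1 + J)%N => N x JN Ax.
have xB := AB x Ax; rewrite phiE//.
have yt : x 0 i0 ^+ 2 <= sqnorm x.
  rewrite /sqnorm /dotp (bigD1 i0)//= -expr2 lerDl.
  by apply: sumr_ge0 => i _; rewrite -expr2 sqr_ge0.
have JN' : (m + J <= N)%N by apply: leq_trans JN; rewrite leq_add2r.
have E1 := HC m s _ _ yt xB small' J N J0 JN'.
have E2 := HC m.+1 s _ _ yt xB small J N J0 JN.
set a := zfun n m _ _ in E1 *; set b := zfun n m.+1 _ _ in E2 *.
move: E1 E2; set Sa := \sum_(k < N) _; set Sb := \sum_(k < N) _ => E1 E2.
have -> : \sum_(k < N) pair_coef m lam s k * zspace i0 k x = Sa + lam * Sb.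
  rewrite /Sa /Sb mulr_sumr -big_split/=; apply: eq_bigr => k _.
  by rewrite /pair_coef /zspace; ring.
have -> : a + lam * b - (Sa + lam * Sb) = (a - Sa) + lam * (b - Sb) by ring.
apply: le_trans HJ; apply: le_trans (ler_normD _ _) _; rewrite /M mulrDl.
apply: lerD.
  apply: le_trans E1 _; rewrite -mulrA ler_wpM2l ?mulr_ge0 ?exprn_ge0//.
  by apply: decay => //; rewrite mulr_ge0// rate_ge0.
rewrite normrM -[leRHS]mulrA ler_wpM2l//; apply: le_trans E2 _.
rewrite -[leLHS]mulrA ler_wpM2l ?mulr_ge0 ?exprn_ge0//.
by apply: decay => //; rewrite mulr_ge0// rate_ge0.
Qed.

(** By [ladder1_diag] the term linear in [s] always comes from the other member of the pair: lowered
    from degree [m.+1] in the first estimate, raised from degree [m] in the second. *)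
Lemma pair_coef_first_order m (lam : R) : `|lam| <= 1 -> exists2 C, 0 <= C &
  forall s, 4 * (`|s| * rate K m.+1) <= 1 ->
    `|pair_coef m lam s m - (1 + lam * (s * zkappa n m.+1))| <= C * s ^+ 2 /\
    `|pair_coef m lam s m.+1 - (lam + s * zup n m)| <= C * s ^+ 2.
Proof.
move=> lam1; pose C1 m := 2 * (4 ^+ m * rate K m ^+ 2).
have C1_ge0 k : 0 <= C1 k by rewrite !mulr_ge0 ?exprn_ge0 ?rate_ge0.
exists (C1 m + C1 m.+1) => [|s small]; first exact: addr_ge0.
have small' : 4 * (`|s| * rate K m) <= 1.
  apply: le_trans small; rewrite ler_wpM2l// ler_wpM2l// /rate ler_wpM2l ?mulr_ge0//.
  by rewrite ler_nat.
have F j : 4 * (`|s| * rate K j) <= 1 -> forall k,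
    `|flow_coef (zup n) (zkappa n) j s k - (ladder (zup n) (zkappa n) j 0 k +
       s * ladder (zup n) (zkappa n) j 1 k)| <= C1 j * s ^+ 2.
  move=> sm k; exact: (@flow_coef_first_order R (zup n) (zkappa n) K K0
    (zup_le n2) (zkappa_norm_le n2) j s sm k).
have bound u v u' v' : `|u - u'| <= C1 m * s ^+ 2 -> `|v - v'| <= C1 m.+1 * s ^+ 2 ->
    `|u + lam * v - (u' + lam * v')| <= (C1 m + C1 m.+1) * s ^+ 2.
  move=> hu hv.
  have -> : u + lam * v - (u' + lam * v') = (u - u') + lam * (v - v') by ring.
  apply: le_trans (ler_normD _ _) _; rewrite mulrDl lerD// normrM.
  by apply: le_trans hv; rewrite ler_piMl.
have mm : (m == m.+1) = false by rewrite ltn_eqF.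
split.
  have := bound _ _ _ _ (F m small' m) (F m.+1 small m).
  rewrite !ladder0 eqxx mm ladder1_diag ladder1_down.
  by rewrite mulr0 addr0 add0r.
have := bound _ _ _ _ (F m small' m.+1) (F m.+1 small m.+1).
rewrite !ladder0 eqxx eq_sym mm ladder1_diag ladder1_up.
by rewrite mulr0 addr0 add0r mulr1 [s * _ + _]addrC.
Qed.

End decompositions.

(** * Norms of zonal functions *)

Section norms.
Context {R : realType} (n : nat).
Hypothesis n1 : (1 < n)%N.
Let n2 : (2 < n.+1)%N := n1.
Let Z k : {poly R} := zonal (fun k => (zbeta n.+1 k)%:P) 'X 1 k.

Lemma horner_zonal k y : (Z k).[y] = zonal (zbeta n.+1) y 1 k.
Proof.
suff: (Z k).[y] = zonal (zbeta n.+1) y 1 k /\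
  (Z k.+1).[y] = zonal (zbeta n.+1) y 1 k.+1 by case.
elim: k => [|k [IH1 IH2]]; first by rewrite /Z/= hornerC hornerX.
split=> //; rewrite /Z !zonalSS -!/(Z _) !mulr1 hornerD hornerN !hornerM hornerX.
by rewrite hornerC IH1 IH2.
Qed.

(** The square norm N_k: on the sphere, where [t = 1], the function [zspace ord0 k] is
    [radial n.+1 k 1] times the polynomial [Z k] in the axis coordinate. *)
Definition zspace_normsq k : R := radial n.+1 k 1 ^+ 2 * zmean n (Z k * Z k).

Lemma zspace_normsq_gt0 k : 0 < zspace_normsq k.
Proof.
by rewrite mulr_gt0 ?exprn_gt0 ?radial1_gt0//; exact: (zmean_sqr_gt0 n1).
Qed.

Lemma sphere_normsq_zspace (a : R) k :
  sphere_normsq (fun x => a * zspace (@ord0 n) k x) = (a ^+ 2 * zspace_normsq k)%:E.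
Proof.
pose f (t : n.+1.-tuple (measurableTypeR R)) : R :=
  (a ^+ 2 * radial n.+1 k 1 ^+ 2) * (Z k * Z k).[tnth t ord0].
have bp := sphere_bounded_poly n (Z k * Z k).
have bf : sphere_bounded f by apply: sphere_boundedM => //; exact: sphere_bounded_cst.
have -> : a ^+ 2 * zspace_normsq k = smean f.
  by rewrite /f smeanZ// /zspace_normsq mulrA.
rewrite /smean /Rintegral fineK.
  apply: eq_integral => t; rewrite inE /sphere/= => t1.
  congr EFin; rewrite /zspace t1 mxE /zfun /f hornerM !horner_zonal.
  by rewrite exprMn; ring.
apply: integrable_fin_num (sphere_bounded_integrable bf).
exact: measurable_sphere.
Qed.

Lemma normsq_zspace (c th : nat -> R) :
  normsq c (fun k x => th k * zspace (@ord0 n) k x) =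
  (\sum_(0 <= k <oo) (c k * (th k ^+ 2 * zspace_normsq k))%:E)%E.
Proof.
by apply: eq_eseriesr => k _; rewrite sphere_normsq_zspace EFinM.
Qed.

Section two_terms.
Variables (c th : nat -> R) (m : nat).
Hypothesis c0 : forall k, 0 <= c k.
Let u k := c k * (th k ^+ 2 * zspace_normsq k).
Let u0 k : (0 <= (u k)%:E)%E.
Proof.
by rewrite lee_fin mulr_ge0// mulr_ge0 ?sqr_ge0// ltW// zspace_normsq_gt0.
Qed.

Lemma normsq_ge :
  ((u m + u m.+1)%:E <= normsq c (fun k x => (th k * zspace (@ord0 n) k x)%R))%E.
Proof.
rewrite normsq_zspace; apply: le_trans (nneseries_lim_ge m.+2 (fun k _ _ => u0 k)).
rewrite !big_nat_recr//= EFinD -addeA; apply: leeDr.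
by apply: sume_ge0 => k _; exact: u0.
Qed.

Lemma normsq_supp : (forall k, k != m -> k != m.+1 -> th k = 0) ->
  normsq c (fun k x => th k * zspace (@ord0 n) k x) = (u m + u m.+1)%:E.
Proof.
move=> th0; rewrite normsq_zspace; apply: lim_near_cst => //.
exists m.+2 => // N /= mN.
have z k : k != m -> k != m.+1 -> (u k)%:E = 0%E.
  by move=> k1 k2; rewrite /u th0// expr0n/= mul0r mulr0.
rewrite (big_cat_nat (leq0n _) mN)//= [X in (_ + X)%E]big_nat [X in (_ + X)%E]big1 ?adde0; last first.
  by move=> k /andP[mk _]; apply: z; rewrite gtn_eqF// ltnW.
rewrite !big_nat_recr//= big_nat big1 ?add0e -?EFinD//.
by move=> k /andP[_ km]; apply: z; rewrite ltn_eqF// ltnW.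
Qed.

End two_terms.
End norms.

(** * From invariance to the recurrence for the weights *)

Section conclusion.
Context {R : realType} (n : nat).
Hypothesis n1 : (1 < n)%N.
Let n2 : (2 < n.+1)%N := n1.
Variable c : nat -> R.
Hypotheses (c0 : forall k, 0 <= c k) (hinv : @mobius_invariant R n.+1 c).
Let K : R := 2 * n.+1%:R.
Local Notation nu := (@zspace_normsq R n).

Lemma invariance_inequality m lam s : 4 * (`|s| * rate K m.+1) <= 1 ->
  c m * (pair_coef n.+1 m lam s m ^+ 2 * nu m) +
  c m.+1 * (pair_coef n.+1 m lam s m.+1 ^+ 2 * nu m.+1) <=
  c m * nu m + c m.+1 * (lam ^+ 2 * nu m.+1).
Proof.
move=> small.
pose f (x : 'rV[R]_n.+1) := zspace (@ord0 n) m x + lam * zspace (@ord0 n) m.+1 x.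
have ms : m.+1 == m = false by rewrite gtn_eqF.
pose th k : R := if k == m then 1 else if k == m.+1 then lam else 0.
have df : decomposition f (fun k x => th k * zspace (@ord0 n) k x).
  split; first by move=> k; exact: zspace_Hspace.
  move=> A _ _; apply: uniform_cvg_dist => e e0; exists m.+2 => N x mN _.
  rewrite -(big_mkord xpredT (fun k => th k * zspace ord0 k x)).
  rewrite (big_cat_nat (leq0n _) mN)//= [X in _ - (_ + X)]big_nat [X in _ - (_ + X)]big1 ?addr0.
    rewrite !big_nat_recr//= big_nat big1 ?add0r.
      by rewrite /th eqxx ms eqxx mul1r subrr normr0 ltW.
    by move=> k /andP[_ km]; rewrite /th !ltn_eqF ?mul0r// ltnW.
  by move=> k /andP[mk _]; rewrite /th !gtn_eqF ?mul0r// ltnW.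
have dg := @decomposition_pair R n.+1 ord0 n2 m lam s (f \o boost ord0 s) small.
have {}dg : decomposition (f \o boost ord0 s)
    (fun k x => pair_coef n.+1 m lam s k * zspace (@ord0 n) k x).
  apply: dg => x xB; have [e1 e2] := boost_coords ord0 s xB.
  by rewrite /f /= /zspace e1 e2.
have Hf : Hharmonic f.
  have := Hharmonic_lin 1 lam (zspace_Hharmonic (@ord0 n) n2 m)
    (zspace_Hharmonic (@ord0 n) n2 m.+1).
  by congr Hharmonic; apply/funext => x; rewrite mul1r.
have := hinv Hf (boost_mobius ord0 s) df dg.
rewrite (@normsq_supp _ _ c th m) => [E|k km km1]; last first.
  by rewrite /th (negbTE km) (negbTE km1).
have := normsq_ge n1 (pair_coef n.+1 m lam s) m c0; rewrite E lee_fin.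
by rewrite /th eqxx ms eqxx expr1n mul1r.
Qed.

Lemma coef_relation m : c m * nu m * zkappa n.+1 m.+1 + c m.+1 * nu m.+1 * zup n.+1 m = 0.
Proof.
set P := c m * nu m; set Q := c m.+1 * nu m.+1.
have P0 : 0 <= P by rewrite mulr_ge0// ltW// zspace_normsq_gt0.
have Q0 : 0 <= Q by rewrite mulr_ge0// ltW// zspace_normsq_gt0.
set B := zkappa _ _; set A := zup _ _.
have key lam : lam ^+ 2 = 1 -> lam * (P * B + Q * A) <= 0.
  move=> lam2; have lam1 : `|lam| <= 1.
    by rewrite -(@ler_pXn2r _ 2)// ?nnegrE// real_normK ?num_real// lam2 expr1n.
  have [C C0 HC] := @pair_coef_first_order R n.+1 n2 m lam lam1.
  rewrite leNgt; apply/negP => X0; set X := lam * _ in X0.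
  pose D := C * (P + Q).
  have D0 : 0 <= D by rewrite mulr_ge0// addr_ge0.
  pose r := rate K m.+1.
  have r0 : 0 <= r by rewrite rate_ge0// mulr_ge0.
  (* The first bound permits the expansion; the second contradicts the inequality [X <= D * s]
     reached in [e5]. *)
  pose s := Num.min (1 / (4 * (r + 1))) (X / (2 * (D + 1))).
  have s0 : 0 < s by rewrite lt_min !divr_gt0//; lra.
  have s1 : s * (4 * (r + 1)) <= 1 by rewrite -ler_pdivlMr ?ge_min ?lexx//; lra.
  have s2 : s * (2 * (D + 1)) <= X by rewrite -ler_pdivlMr ?ge_min ?lexx ?orbT//; lra.
  have small : 4 * (`|s| * rate K m.+1) <= 1.
    by rewrite gtr0_norm// -/r; nra.
  have [h1 h2] := HC s small; have := invariance_inequality lam small.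
  set a := pair_coef _ _ _ _ m in h1 *; set b := pair_coef _ _ _ _ m.+1 in h2 *.
  rewrite lam2 mul1r -/P -/Q.
  (* Convexity, [a^2 >= 2 a - 1], turns the lower bound on [a] into one on its square. In [b2] the
     same is done with [lam * b], which is close to 1 because [lam ^+ 2 = 1]. *)
  have a2 : 1 + 2 * lam * s * B - 2 * C * s ^+ 2 <= a ^+ 2.
    move: h1; rewrite ler_norml -/B => /andP[h _]; have := sqr_ge0 (a - 1); lra.
  have b2 : 1 + 2 * lam * s * A - 2 * C * s ^+ 2 <= b ^+ 2.
    have hb : `|lam * b - (1 + lam * (s * A))| <= C * s ^+ 2.
      have -> : lam * b - (1 + lam * (s * A)) = lam * (b - (lam + s * A)).
        by rewrite -lam2; ring.
      by rewrite normrM; apply: le_trans h2; rewrite ler_piMl.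
    have -> : b ^+ 2 = (lam * b) ^+ 2 by rewrite exprMn lam2 mul1r.
    move: hb; rewrite ler_norml => /andP[h _]; have := sqr_ge0 (lam * b - 1); lra.
  have e1 : P * (1 + 2 * lam * s * B - 2 * C * s ^+ 2) <= P * a ^+ 2 by rewrite ler_wpM2l.
  have e2 : Q * (1 + 2 * lam * s * A - 2 * C * s ^+ 2) <= Q * b ^+ 2 by rewrite ler_wpM2l.
  rewrite [c m * _]mulrCA [c m.+1 * _]mulrCA -/P -/Q [_ * P]mulrC [_ * Q]mulrC => e3.
  have e4 : 2 * s * X <= 2 * D * s ^+ 2 by rewrite /X /D; lra.
  have e5 : X <= D * s.
    rewrite -(ler_pM2l (_ : 0 < 2 * s)); last by rewrite mulr_gt0.
    by have -> : 2 * s * (D * s) = 2 * D * s ^+ 2 by ring.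
  nra.
have h1 := key 1 (expr1n _ _).
have h2 : - 1 * (P * B + Q * A) <= 0 by apply: key; rewrite sqrrN expr1n.
by apply/eqP; rewrite eq_le; apply/andP; split; lra.
Qed.

Lemma coef0 : c 0%N = 0.
Proof.
have := coef_relation 0; rewrite zkappa1// /zup mulr0 !mul0r oppr0 mulr0 addr0 mulr1.
by move=> /eqP; rewrite mulf_eq0 orbC gt_eqF ?zspace_normsq_gt0//= => /eqP.
Qed.

(** With [N = n.+1] the dimension, the ratio of consecutive norms is [zbeta N m.+1] times the square
    of [(2 m + N) / (2 m + 2 N - 2)]; this square and the numerator of [zup] leave one factor
    [N + m - 1], while [zbeta] cancels against [zkappa]. *)
Lemma coef_succ m : m%:R * c m.+1 = (n.+1%:R + m%:R - 1) * c m.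
Proof.
have := coef_relation m; rewrite /zspace_normsq zmean_sqr// zkappaE// /zup.
have b0 := @zbeta_gt0 R n.+1 n2 m; have z0 := @zmean_sqr_gt0 R n n1 m.
have r0 := @radial1_gt0 R n.+1 n2 m; have := @radial1_succ R n.+1 n2 m.
set N : R := n.+1%:R; have N3 : 3 <= N by rewrite (ler_nat _ 3).
have m0 := ler0n R m.
move: (zbeta _ _) (zmean n _) (radial _ m 1) (radial _ m.+1 1) b0 z0 r0.
move=> b z r r' b0 z0 r0 e1 e2.
have p0 : 2 * m%:R + 2 * N - 2 != 0 by rewrite gt_eqF//; lra.
have p1 : m%:R + N / 2 != 0 by rewrite gt_eqF//; lra.
have p2 : N + m%:R - 1 != 0 by rewrite gt_eqF//; lra.
have er : r' = (2 * m%:R + N) * r / (2 * m%:R + 2 * N - 2).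
  by rewrite -e1 [X in X / _]mulrC mulfK.
have p3 : b * z * r ^+ 2 * (N + 2 * m%:R) != 0.
  by rewrite gt_eqF// !mulr_gt0 ?exprn_gt0//; lra.
apply: (mulIf p3); apply/eqP; rewrite -subr_eq0.
have : - (N + m%:R - 1) * (c m * (r ^+ 2 * z) * (b * (N + 2 * m%:R)) + c m.+1 *
    (r' ^+ 2 * (b * z)) * - (2 * m%:R * (N + m%:R - 1) / (m%:R + N / 2))) = 0.
  by rewrite e2 mulr0.
move=> <-; apply/eqP; rewrite er; field.
by apply/andP; split; rewrite gt_eqF//; lra.
Qed.

(** [coef_succ] at 0 does not constrain [c 1], which stays as the free constant; it is divided by
    [n], the value of [(n.+1 - 1)_1 / 0!]. *)
Lemma coef_pochhammer m :
  c m.+1 = c 1%N / n%:R * (pochhammer (n.+1%:R - 1) m.+1 / m`!%:R).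
Proof.
have n0 : n%:R != 0 :> R by rewrite pnatr_eq0 -lt0n ltnW.
elim: m => [|m IH].
  rewrite /pochhammer big_ord1 fact0 divr1 addr0 -natr1 addrK divfK//.
have m0 : m.+1%:R != 0 :> R by rewrite pnatr_eq0.
have f0 : m`!%:R != 0 :> R by rewrite pnatr_eq0 -lt0n fact_gt0.
apply: (mulfI m0); rewrite coef_succ IH.
rewrite [pochhammer _ m.+2]/pochhammer big_ord_recr/= -/(pochhammer _ m.+1).
by rewrite factS natrM invfM; field; rewrite f0 n0 nat1r m0.
Qed.

End conclusion.

Theorem theorem9 (R : realType) (n : nat) (hn : (2 < n)%N) (c : nat -> R)
  (hc : forall m, 0 <= c m) (hinv : @mobius_invariant R n c) :
  exists alpha : R, 0 <= alpha /\ c 0%N = 0 /\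
    forall m : nat, (1 <= m)%N ->
      c m = alpha * (pochhammer (n%:R - 1) m / (m.-1)`!%:R).
Proof.
(* Writing the dimension as a successor provides the coordinate [ord0], the axis of the zonal
   functions. *)
case: n hn hinv => // n n1 hinv.
exists (c 1%N / n%:R); split; first by rewrite divr_ge0.
split; first exact: (coef0 n1 hc hinv).
by case=> // m _; exact: (coef_pochhammer n1 hc hinv).
Qed.
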